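(* Let $m_1,n\ge1$, take $r=m_1$, and let $k\in\mathbb Z$ with $k\le n$. Consider the $osp(2m_1,2n)$-modules $\mathcal A^{m_1}_k,\mathcal H^{m_1}_k$, the operator $\eta$, the elements $h(\vec k,\vec l,\vec s)$ and the index set $I$ defined in the context. Then $\mathcal H^{m_1}_k$ is an irreducible highest weight submodule. The highest weight is $-2\lambda_{m_1}+\nu_k$ if $k>0$ (respectively $-k\lambda_{m_1-1}+(k-2)\lambda_{m_1}$ if $k\le0$), and a corresponding highest weight vector is $\theta_1\cdots\theta_k$ (respectively $x_{m_1}^{-k}$). Moreover, $\mathcal A^{m_1}_k=\mathcal H^{m_1}_k\oplus\eta\mathcal A^{m_1}_{k-2}$, and $$\Big\{h(\vec k,\vec l,\vec s)\ \Big|\ (\vec k,\vec l,\vec s)\in I,\ \sum_{t=1}^n(l_t+l_{n+t})+2\sum_{1\le i<j\le n}l_{i,j}+\sum_{1\le p\le m_1,\,1\le q\le n}s_{p,q}-\sum_{t=1}^{m_1}k_t=k\Big\}$$ forms a basis for $\mathcal H^{m_1}_k$.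
   Context: $\mathbb N$ is the set of nonnegative integers, $\overline{i,j}=\{i,\dots,j\}$. $E_{i,j}$ is the square matrix with $(i,j)$-entry $1$ and others zero. With $m=2m_1$, the Lie superalgebra $gl(m,2n)$ of $(m+2n)\times(m+2n)$ complex matrices has even part spanned by $E_{i,j}$ ($i,j\in\overline{1,m}$) and $E_{m+s,m+t}$ ($s,t\in\overline{1,2n}$), odd part spanned by $E_{i,m+s},E_{m+s,i}$, and bracket $[u,v]=uv-(-1)^{\iota_1\iota_2}vu$ for $u,v$ of parities $\iota_1,\iota_2$. $osp(2m_1,2n)$ is the subalgebra of matrices $$\begin{pmatrix}A&B&H&H_1\\ C&-A^T&K&K_1\\ K_1^T&H_1^T&D&E\\ -K^T&-H^T&F&-D^T\end{pmatrix}$$ with $A,B,C$ of size $m_1\times m_1$, $B=-B^T$, $C=-C^T$; $D,E,F$ of size $n\times n$, $E=E^T$, $F=F^T$; $H,H_1,K,K_1$ of size $m_1\times n$. $\mathcal A=\mathbb C[x_1,\dots,x_{2m_1},\theta_1,\dots,\theta_{2n}]$ with commuting $x_i$, anticommuting $\theta_p$, $x_i\theta_p=\theta_px_i$; $\partial_{\theta_p}$ is the odd (left) derivation with $\partial_{\theta_p}(\theta_q)=\delta_{p,q}$. For $r=m_1$, $gl(m,2n)$ (restricted to $osp(2m_1,2n)$) acts on $\mathcal A$ by: - $E_{i,j}\mapsto -x_j\partial_{x_i}-\delta_{i,j}$ if $i,j\in\overline{1,m_1}$; $\partial_{x_i}\partial_{x_j}$ if $i\in\overline{1,m_1}$, $j\in\overline{m_1+1,m}$;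 $-x_ix_j$ if $j\in\overline{1,m_1}$, $i\in\overline{m_1+1,m}$; $x_i\partial_{x_j}$ if $i,j\in\overline{m_1+1,m}$; - for $p\in\overline{1,2n}$: $E_{i,m+p}\mapsto\partial_{x_i}\partial_{\theta_p}$ if $i\in\overline{1,m_1}$, and $x_i\partial_{\theta_p}$ if $i\in\overline{m_1+1,m}$; $E_{m+p,j}\mapsto-\theta_px_j$ if $j\in\overline{1,m_1}$, and $\theta_p\partial_{x_j}$ if $j\in\overline{m_1+1,m}$; - $E_{m+p,m+q}\mapsto\theta_p\partial_{\theta_q}$ for $p,q\in\overline{1,2n}$. $\mathcal A^{m_1}_k$ is the span of all $x^\alpha\theta_{i_1}\cdots\theta_{i_t}$ with $0\le t\le2n$, $i_1,\dots,i_t\in\overline{1,2n}$, $\alpha\in\mathbb N^{2m_1}$ and $t-\sum_{i=1}^{m_1}\alpha_i+\sum_{j=m_1+1}^{2m_1}\alpha_j=k$; $$\Delta=-\sum_{i=1}^{m_1}x_i\partial_{x_{m_1+i}}+\sum_{j=1}^n\partial_{\theta_j}\partial_{\theta_{n+j}},\qquad\eta=\sum_{i=1}^{m_1}x_{m_1+i}\partial_{x_i}+\sum_{j=1}^n\theta_j\theta_{n+j},$$ and $\mathcal H^{m_1}_k=\{f\in\mathcal A^{m_1}_k\mid\Delta(f)=0\}$. The Cartan subalgebra is spanned by $E_{i,i}-E_{m_1+i,m_1+i}$ ($1\le i\le m_1$) and $E_{2m_1+j,2m_1+j}-E_{2m_1+n+j,2m_1+n+j}$ ($1\le j\le n$);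 $\lambda_1,\dots,\lambda_{m_1},\nu_1,\dots,\nu_n$ are the fundamental weights of the even part $o(2m_1,\mathbb C)\oplus sp(2n,\mathbb C)$ (standard labelling). $osp(2m_1,2n)^+$ is the span of $E_{i,j}-E_{m_1+j,m_1+i}$ and $E_{i,m_1+j}-E_{j,m_1+i}$ ($1\le i<j\le m_1$), $E_{2m_1+p,2m_1+q}-E_{2m_1+n+q,2m_1+n+p}$ ($1\le p<q\le n$), $E_{2m_1+p,2m_1+n+q}+E_{2m_1+q,2m_1+n+p}$ ($1\le p\le q\le n$), $E_{i,2m_1+q}-E_{2m_1+n+q,m_1+i}$ and $E_{i,2m_1+n+q}+E_{2m_1+q,m_1+i}$ ($1\le i\le m_1$, $1\le q\le n$). A highest weight vector is a weight vector annihilated by $osp(2m_1,2n)^+$; its weight is the highest weight. Index data: $\vec k$ consists of $k_t\in\mathbb N$ ($1\le t\le m_1$) and $k_{i,j}\in\mathbb N$ ($1\le i<j\le m_1$); $\vec l$ consists of $l_t\in\{0,1\}$ ($1\le t\le 2n$) and $l_{i,j}\in\{0,1\}$ ($1\le i<j\le n$); $\vec s$ consists of $s_{p,q}\in\{0,1\}$ ($1\le p\le m_1$, $1\le q\le n$). Define $$h(\vec k,\vec l,\vec s)=\prod_{t=1}^{m_1}x_t^{k_t}\prod_{1\le i<j\le m_1}(x_ix_{m_1+j}-x_jx_{m_1+i})^{k_{i,j}}\prod_{j=1}^n\theta_j^{l_j}\theta_{n+j}^{l_{n+j}}\prod_{1\le i<j\le n}(\theta_i\theta_{n+i}-\theta_j\theta_{n+j})^{l_{i,j}}\prod_{1\le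 p\le m_1,1\le q\le n}(x_{m_1+p}-x_p\theta_q\theta_{n+q})^{s_{p,q}}.$$ $I$ is the set of $(\vec k,\vec l,\vec s)$ satisfying all of: - $l_t+l_{n+t}+\sum_{1\le i<t}l_{i,t}+\sum_{t<j\le n}l_{t,j}+\sum_{p=1}^{m_1}s_{p,t}\le1$ for $t\in\overline{1,n}$; - $k_{i,j}k_t=0$ for $i<j<t$; $k_{i,j}k_{i',j'}=0$ for $i>i'$ and $j<j'$; - $k_tl_{i,j}=0$ for $t\in\overline{1,m_1}$, $1\le i<j\le n$; $k_ts_{p,q}=0$ for $t<p$; - $k_{i,j}s_{p,q}=0$ for $i<j<p$; $s_{p,q}s_{p',q'}=0$ for $p>p'$ and $q<q'$; - $l_{i,j}=0$ if $l_t=l_{n+t}=\sum_{p=1}^{m_1}s_{p,t}=\sum_{i'<t}l_{i',t}+\sum_{j'>t}l_{t,j'}=0$ for some $i<t<j$; - $l_{i,j}l_{i',j'}=0$ if $i<i'<j<j'$; $l_{i,j}s_{p,q}=0$ if $i<j<q$. *)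

(* Defs.v *)
From HB Require Import structures.
From mathcomp Require Import all_boot all_order all_algebra.
From mathcomp Require Import mpoly.
From mathcomp Require Import ring.

Set Implicit Arguments.
Unset Strict Implicit.
Unset Printing Implicit Defensive.

Import GRing.Theory.
Local Open Scope ring_scope.

(* Superpolynomials: F[x_i (i < a)] tensored with the exterior algebra on      *)
(* theta_p (p < b).  [f S] is the coefficient, a polynomial in the x_i, of     *)
(* theta_S := \prod_(p in S, increasing) theta_p.                              *)
Definition spoly (F : fieldType) (a b : nat) : Type :=
  {ffun {set 'I_b} -> {mpoly F[a]}}.

Section SuperPolynomials.
Variables (F : fieldType) (a b : nat).
Local Notation A := (spoly F a b).

HB.instance Definition _ :=
  GRing.Lmodule.copy A {ffun {set 'I_b} -> {mpoly F[a]}}.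

(* theta_S * theta_T = (-1) ^+ inversions S T *: theta_(S :|: T) for disjoint  *)
(* S and T.                                                                    *)
Definition inversions (S T : {set 'I_b}) : nat :=
  (\sum_(p in S) \sum_(q in T) (q < p))%N.

Definition spoly_one : A := [ffun S => (S == set0)%:R].

Definition spoly_mul (f g : A) : A :=
  [ffun U : {set 'I_b} => \sum_(S : {set 'I_b} | S \subset U)
     (-1) ^+ inversions S (U :\: S) * f S * g (U :\: S)].

Lemma inversions0s T : inversions set0 T = 0%N.
Proof. by rewrite /inversions big_set0. Qed.

Lemma inversionss0 S : inversions S set0 = 0%N.
Proof. by rewrite /inversions big1 // => p _; rewrite big_set0. Qed.

Lemma inversionsUl (S T U : {set 'I_b}) : [disjoint S & T] ->
  inversions (S :|: T) U = (inversions S U + inversions T U)%N.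
Proof.
move=> dST; rewrite /inversions -(bigU _ _ _ dST) /=.
by apply: eq_bigl => p; rewrite !inE.
Qed.

Lemma inversionsUr (S T U : {set 'I_b}) : [disjoint T & U] ->
  inversions S (T :|: U) = (inversions S T + inversions S U)%N.
Proof.
move=> dTU; rewrite /inversions -big_split /=; apply: eq_bigr => p _.
by rewrite -(bigU _ _ _ dTU) /=; apply: eq_bigl => q; rewrite !inE.
Qed.

Lemma spoly_mulA : associative spoly_mul.
Proof.
move=> f g h; apply/ffunP => U; rewrite !ffunE.
under eq_bigr => S _ do rewrite ffunE mulr_sumr.
under [in RHS]eq_bigr => V _ do rewrite ffunE mulr_sumr mulr_suml.
rewrite [RHS](exchange_big_dep (fun S : {set 'I_b} => S \subset U)) /=;
  last by move=> V S sVU sSV; apply: subset_trans sVU.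
apply: eq_bigr => S sSU.
rewrite [RHS](reindex_onto (fun T => S :|: T) (fun V => V :\: S)) /=; last first.
  by move=> V /andP[_ sSV]; rewrite setDE setUIr setUCr setIT; apply/setUidPr.
apply: eq_big => [T|T].
  rewrite subUset sSU subsetUl andbT /= subsetD; congr (_ && _).
  by rewrite setDUl setDv set0U; apply/idP/eqP => [/setDidPl|/setDidPl].
rewrite subsetD => /andP[sTU dTS].
have eT : (S :|: T) :\: S = T by rewrite setDUl setDv set0U; apply/setDidPl.
have eR : (U :\: S) :\: T = U :\: (S :|: T) by rewrite setDDl.
have eUS : U :\: S = T :|: (U :\: (S :|: T)).
  by rewrite -eR -{1}(setID (U :\: S) T) (setIidPr _) // subsetD sTU.
have dTR : [disjoint T & U :\: (S :|: T)].
  by rewrite -setI_eq0 -eR setIDA setIC -setIDA setDv setI0.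
rewrite eT eR {1}eUS inversionsUr // inversionsUl 1?disjoint_sym //.
rewrite !exprD; ring.
Qed.

Lemma spoly_mul1 : left_id spoly_one spoly_mul.
Proof.
move=> f; apply/ffunP => U; rewrite ffunE (bigD1 set0) ?sub0set //=.
rewrite ffunE eqxx inversions0s expr0 !mul1r setD0 big1 ?addr0 // => S.
by case/andP=> _ /negPf nS; rewrite ffunE nS mulr0 mul0r.
Qed.

Lemma spoly_mulr1 : right_id spoly_one spoly_mul.
Proof.
move=> f; apply/ffunP => U; rewrite ffunE (bigD1 U) //= setDv.
rewrite ffunE eqxx inversionss0 expr0 mul1r mulr1 big1 ?addr0 // => S.
case/andP=> sSU nSU; rewrite ffunE setD_eq0.
rewrite (_ : (U \subset S) = false) ?mulr0 //.
by apply: contraNF nSU => sUS; rewrite eqEsubset sSU.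
Qed.

Lemma spoly_mulDl : left_distributive spoly_mul +%R.
Proof.
move=> f g h; apply/ffunP => U; rewrite !ffunE -big_split /=.
by apply: eq_bigr => S _; rewrite ffunE mulrDr mulrDl.
Qed.

Lemma spoly_mulDr : right_distributive spoly_mul +%R.
Proof.
move=> f g h; apply/ffunP => U; rewrite !ffunE -big_split /=.
by apply: eq_bigr => S _; rewrite ffunE mulrDr.
Qed.

Lemma spoly_one_neq0 : spoly_one != 0 :> A.
Proof.
by apply/eqP => /ffunP /(_ set0); rewrite !ffunE eqxx => /eqP; rewrite oner_eq0.
Qed.

HB.instance Definition _ := GRing.Zmodule_isNzRing.Build A
  spoly_mulA spoly_mul1 spoly_mulr1 spoly_mulDl spoly_mulDr spoly_one_neq0.

Lemma spoly_scaleAl (c : F) (f g : A) : c *: (f * g) = (c *: f) * g.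
Proof.
apply/ffunP => U; rewrite !ffunE scaler_sumr; apply: eq_bigr => S _.
by rewrite ffunE -scalerAr scalerAl.
Qed.

Lemma spoly_scaleAr (c : F) (f g : A) : c *: (f * g) = f * (c *: g).
Proof.
apply/ffunP => U; rewrite !ffunE scaler_sumr; apply: eq_bigr => S _.
by rewrite ffunE -scalerAr.
Qed.

HB.instance Definition _ := GRing.Lmodule_isLalgebra.Build F A spoly_scaleAl.
HB.instance Definition _ := GRing.Lalgebra_isAlgebra.Build F A spoly_scaleAr.

Definition xvar (i : 'I_a) : A :=
  [ffun S : {set 'I_b} => if S == set0 then 'X_i else 0].

Definition theta (p : 'I_b) : A :=
  [ffun S : {set 'I_b} => (S == [set p])%:R].

Definition dx (i : 'I_a) (f : A) : A := [ffun S : {set 'I_b} => (f S)^`M(i)].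

(* d(theta_p) theta_T = (-1) ^+ #|{q in T | q < p}| *: theta_(T :\ p) if       *)
(* p \in T, and 0 otherwise; see the Leibniz rules below.                      *)
Definition dtheta (p : 'I_b) (f : A) : A :=
  [ffun S : {set 'I_b} =>
     if p \in S then 0 else (-1) ^+ #|[set q in S | (q < p)%N]| * f (p |: S)].

Lemma xvarME i f (U : {set 'I_b}) : (xvar i * f) U = 'X_i * f U.
Proof.
rewrite ffunE (bigD1 set0) ?sub0set //= ffunE eqxx inversions0s expr0 mul1r.
rewrite setD0 big1 ?addr0 // => S /andP[_ /negPf nS].
by rewrite ffunE nS mulr0 mul0r.
Qed.

Lemma thetaME p f (U : {set 'I_b}) : (theta p * f) U =
  if p \in U then (-1) ^+ #|[set q in U | (q < p)%N]| * f (U :\ p) else 0.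
Proof.
rewrite ffunE; case: ifPn => pU; last first.
  rewrite big1 // => S sSU; rewrite ffunE (_ : S == _ = false) ?mulr0 ?mul0r //.
  by apply: contraNF pU => /eqP eS; rewrite -sub1set -eS.
rewrite (bigD1 [set p]) ?sub1set //= ffunE eqxx mulr1 big1 ?addr0; last first.
  by move=> S /andP[_ /negPf nS]; rewrite ffunE nS mulr0 mul0r.
rewrite /inversions big_set1; congr ((-1) ^+ _ * _).
rewrite -sum1_card big_mkcond [RHS]big_mkcond /=; apply: eq_bigr => q _.
by rewrite !inE; case: eqVneq => [->|_] /=; rewrite ?ltnn ?andbF //;
  case: (q \in U); case: (q < p)%N.
Qed.

Lemma dtheta1 p : dtheta p 1 = 0.
Proof.
apply/ffunP => S; rewrite !ffunE; case: ifP => // _.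
by rewrite setU_eq0 -cards_eq0 cards1 mulr0.
Qed.

Lemma dtheta_xvarM p i f : dtheta p (xvar i * f) = xvar i * dtheta p f.
Proof.
apply/ffunP => S; rewrite xvarME ![dtheta _ _ _]ffunE xvarME.
by case: ifP; rewrite ?mulr0 // mulrCA.
Qed.

Lemma dtheta_thetaM p q f :
  dtheta p (theta q * f) = (p == q)%:R *: f - theta q * dtheta p f.
Proof.
have subE (g h : A) S : (g - h) S = g S - h S by rewrite !ffunE.
have sclE (c : F) (g : A) S : (c *: g) S = c *: g S by rewrite !ffunE.
have dE g (S : {set 'I_b}) : dtheta p g S = if p \in S then 0
    else (-1) ^+ #|[set r in S | (r < p)%N]| * g (p |: S) by rewrite ffunE.
apply/ffunP => S; rewrite subE sclE dE !thetaME dE.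
have [-> | npq] := eqVneq p q.
  rewrite scale1r setU11 !inE eqxx /=; case: ifPn => qS.
    rewrite setD1K //.
    rewrite (_ : [set r in S :\ q | (r < q)%N] = [set r in S | (r < q)%N]).
      by rewrite mulrA -expr2 sqrr_sign mul1r subrr.
    by apply/setP => r; rewrite !inE; case: eqVneq => [->|] /=; rewrite ?ltnn ?andbF.
  rewrite setU1K //.
  rewrite (_ : [set r in q |: S | (r < q)%N] = [set r in S | (r < q)%N]).
    by rewrite mulrA -expr2 sqrr_sign mul1r subr0.
  by apply/setP => r; rewrite !inE; case: eqVneq => [->|] /=; rewrite ?ltnn ?andbF.
rewrite scale0r sub0r !inE npq /= eq_sym (negPf npq) /=.
case: ifPn => pS; first by rewrite mulr0 if_same oppr0.
case: ifPn => qS; last by rewrite mulr0 oppr0.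
have -> : #|[set r in S | (r < p)%N]|
    = ((q < p) + #|[set r in S :\ q | (r < p)%N]|)%N.
  rewrite (cardsD1 q) !inE qS; congr (_ + _)%N; apply: eq_card => r.
  by rewrite !inE andbA.
have -> : #|[set r in p |: S | (r < q)%N]|
    = ((p < q) + #|[set r in S | (r < q)%N]|)%N.
  rewrite (cardsD1 p) !inE eqxx; congr (_ + _)%N; apply: eq_card => r.
  by rewrite !inE; case: eqVneq => [->|] /=; rewrite ?(negPf pS).
have -> : (p |: S) :\ q = p |: S :\ q.
  by apply/setP => r; rewrite !inE; case: eqVneq => [->|] //=;
    rewrite eq_sym (negPf npq).
have : (p < q)%N = ~~ (q < p)%N by rewrite ltn_neqAle -leqNgt npq.
by rewrite !exprD => ->; case: (q < p)%N; rewrite !(expr0, expr1); ring.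
Qed.

End SuperPolynomials.

Section LinearNotions.
Variables (F : fieldType) (V : lmodType F).

Definition subspace (W : V -> Prop) : Prop :=
  W 0 /\ forall (c : F) (u v : V), W u -> W v -> W (c *: u + v).

Definition in_span (B : V -> Prop) (v : V) : Prop :=
  exists (N : nat) (c : 'I_N -> F) (b : 'I_N -> V),
    (forall t, B (b t)) /\ v = \sum_(t < N) c t *: b t.

Definition direct_sum_of (W U1 U2 : V -> Prop) : Prop :=
  (forall w, W w <-> exists u1 u2, [/\ U1 u1, U2 u2 & w = u1 + u2])
  /\ (forall u, U1 u -> U2 u -> u = 0).

Definition lin_indep (I : Type) (P : I -> Prop) (b : I -> V) : Prop :=
  forall (N : nat) (i : 'I_N -> I) (c : 'I_N -> F),
    injective i -> (forall t, P (i t)) ->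
    \sum_(t < N) c t *: b (i t) = 0 -> forall t, c t = 0.

Definition is_basis (I : Type) (P : I -> Prop) (b : I -> V) (W : V -> Prop) :
    Prop :=
  lin_indep P b /\
  (forall v, W v <-> in_span (fun u => exists2 i, P i & u = b i) v).

End LinearNotions.

Section Oscillator.
Variables (F : fieldType) (m n : nat).
Local Notation A := (spoly F (m + m) (n + n)).
Local Notation G := 'M[F]_(m + m + (n + n)).

(* Row and column positions i, m + i, 2 m + j, 2 m + n + j.                    *)
Definition ixL (i : 'I_m) : 'I_(m + m + (n + n)) := lshift _ (lshift m i).
Definition ixR (i : 'I_m) : 'I_(m + m + (n + n)) := lshift _ (rshift m i).
Definition ithL (j : 'I_n) : 'I_(m + m + (n + n)) := rshift _ (lshift n j).
Definition ithR (j : 'I_n) : 'I_(m + m + (n + n)) := rshift _ (rshift n j).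

Definition xL (i : 'I_m) : A := xvar F (n + n) (lshift m i).
Definition xR (i : 'I_m) : A := xvar F (n + n) (rshift m i).
Definition thL (j : 'I_n) : A := theta F (m + m) (lshift n j).
Definition thR (j : 'I_n) : A := theta F (m + m) (rshift n j).

Definition osp (g : G) : Prop :=
  exists (P B C : 'M[F]_m) (H H1 K K1 : 'M[F]_(m, n)) (D E0 F0 : 'M[F]_n),
    [/\ B = - B^T, C = - C^T, E0 = E0^T, F0 = F0^T &
        g = block_mx (block_mx P B C (- P^T)) (block_mx H H1 K K1)
                     (block_mx K1^T H1^T (- K^T) (- H^T))
                     (block_mx D E0 F0 (- D^T))].

(* The operator by which the matrix unit E_(s, t) of gl(2 m, 2 n) acts.        *)
Definition unit_action (s t : 'I_(m + m + (n + n))) (f : A) : A :=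
  match split s, split t with
  | inl i, inl j =>
      match (i < m)%N, (j < m)%N with
      | true, true => - (xvar F (n + n) j * dx i f) - (i == j)%:R *: f
      | true, false => dx i (dx j f)
      | false, true => - (xvar F (n + n) i * xvar F (n + n) j * f)
      | false, false => xvar F (n + n) i * dx j f
      end
  | inl i, inr p =>
      if (i < m)%N then dx i (dtheta p f) else xvar F (n + n) i * dtheta p f
  | inr p, inl j =>
      if (j < m)%N then - (theta F (m + m) p * xvar F (n + n) j * f)
      else theta F (m + m) p * dx j f
  | inr p, inr q => theta F (m + m) p * dtheta q f
  end.

Definition action (g : G) (f : A) : A :=
  \sum_s \sum_t g s t *: unit_action s t f.

Definition submodule (W : A -> Prop) : Prop :=
  subspace W /\ forall g f, osp g -> W f -> W (action g f).

Definition irreducible (W : A -> Prop) : Prop :=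
  [/\ submodule W, exists2 f, W f & f <> 0 &
      forall U : A -> Prop, submodule U -> (forall f, U f -> W f) ->
        (forall f, U f -> f = 0) \/ (forall f, W f -> U f)].

Definition Emx (s t : 'I_(m + m + (n + n))) : G := delta_mx s t.

Definition cartan : G -> Prop := in_span (fun g =>
  (exists i, g = Emx (ixL i) (ixL i) - Emx (ixR i) (ixR i)) \/
  (exists j, g = Emx (ithL j) (ithL j) - Emx (ithR j) (ithR j))).

Definition osp_pos : G -> Prop := in_span (fun g =>
  (exists i j : 'I_m, (i < j)%N /\
     (g = Emx (ixL i) (ixL j) - Emx (ixR j) (ixR i) \/
      g = Emx (ixL i) (ixR j) - Emx (ixL j) (ixR i))) \/
  (exists p q : 'I_n, (p < q)%N /\
     g = Emx (ithL p) (ithL q) - Emx (ithR q) (ithR p)) \/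
  (exists p q : 'I_n, (p <= q)%N /\
     g = Emx (ithL p) (ithR q) + Emx (ithL q) (ithR p)) \/
  (exists (i : 'I_m) (q : 'I_n),
     g = Emx (ixL i) (ithL q) - Emx (ithR q) (ixR i) \/
     g = Emx (ixL i) (ithR q) + Emx (ithL q) (ixR i))).

(* Weights are given as functions on matrices, of which only the restriction   *)
(* to the Cartan subalgebra matters; eps_wt and delta_wt are the coordinates   *)
(* dual to its spanning set.                                                   *)
Definition eps_wt (i : 'I_m) (g : G) : F := g (ixL i) (ixL i).
Definition delta_wt (j : 'I_n) (g : G) : F := g (ithL j) (ithL j).

(* Fundamental weights of o(2 m), 1 <= i <= m, in Bourbaki's labelling of D_m: *)
(* eps_1 + ... + eps_i for i <= m - 2,                                         *)
(* (eps_1 + ... + eps_(m-1) -/+ eps_m) / 2 for i = m - 1 and i = m.            *)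
(* For m = 1 the formulas give lambda_0 = - eps_1 / 2, lambda_1 = eps_1 / 2.   *)
Definition lambda_wt (i : nat) (g : G) : F :=
  if i == m then 2%:R^-1 * \sum_(j < m) eps_wt j g
  else if i.+1 == m then
    2%:R^-1 * \sum_(j < m) (if j.+1 == m then - eps_wt j g else eps_wt j g)
  else \sum_(j < m | (j < i)%N) eps_wt j g.

(* Fundamental weights of sp(2 n), 1 <= i <= n. *)
Definition nu_wt (i : nat) (g : G) : F := \sum_(j < n | (j < i)%N) delta_wt j g.

Definition highest_weight_vector (W : A -> Prop) (v : A) (wt : G -> F) : Prop :=
  [/\ W v, v <> 0, forall g, cartan g -> action g v = wt g *: v &
      forall g, osp_pos g -> action g v = 0].

Definition highest_weight_submodule (W : A -> Prop) (v : A) (wt : G -> F) :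
    Prop :=
  [/\ submodule W, highest_weight_vector W v wt &
      forall U : A -> Prop, submodule U -> U v -> forall f, W f -> U f].

Definition Ak (k : int) : A -> Prop := in_span (fun f =>
  exists (al : 'I_(m + m) -> nat) (ps : seq 'I_(n + n)),
    [/\ (size ps <= n + n)%N,
        (size ps)%:Z - \sum_(i < m) (al (lshift m i))%:Z
          + \sum_(i < m) (al (rshift m i))%:Z = k &
        f = \prod_(i < m + m) xvar F (n + n) i ^+ al i
            * \prod_(p <- ps) theta F (m + m) p]).

Definition Delta (f : A) : A :=
  - (\sum_(i < m) xL i * dx (rshift m i) f)
  + \sum_(j < n) dtheta (lshift n j) (dtheta (rshift n j) f).

Definition eta (f : A) : A :=
  \sum_(i < m) xR i * dx (lshift m i) f + \sum_(j < n) thL j * thR j * f.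

Definition Hk (k : int) (f : A) : Prop := Ak k f /\ Delta f = 0.

Definition etaAk (k : int) (f : A) : Prop := exists2 f', Ak k f' & f = eta f'.

End Oscillator.

(* The entries of idx_kk and idx_ll at (i, j) are only meaningful for i < j,   *)
(* and are required to vanish otherwise in [in_I].                             *)
Record index_data (m n : nat) := IndexData {
  idx_k : {ffun 'I_m -> nat};
  idx_kk : {ffun 'I_m * 'I_m -> nat};
  idx_l : {ffun 'I_(n + n) -> bool};
  idx_ll : {ffun 'I_n * 'I_n -> bool};
  idx_s : {ffun 'I_m * 'I_n -> bool} }.

Section Basis.
Variables (F : fieldType) (m n : nat).
Local Notation A := (spoly F (m + m) (n + n)).
Variable d : index_data m n.

Local Notation k t := (idx_k d t).
Local Notation kk i j := (idx_kk d (i, j)).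
Local Notation l j := (nat_of_bool (idx_l d (lshift n j))).
Local Notation l' j := (nat_of_bool (idx_l d (rshift n j))).
Local Notation ll i j := (nat_of_bool (idx_ll d (i, j))).
Local Notation s p q := (nat_of_bool (idx_s d (p, q))).

Definition hvec : A :=
  \prod_(t < m) xL F n t ^+ k t
  * \prod_(i < m) \prod_(j < m | (i < j)%N)
      (xL F n i * xR F n j - xL F n j * xR F n i) ^+ kk i j
  * \prod_(j < n) (thL F m j ^+ l j * thR F m j ^+ l' j)
  * \prod_(i < n) \prod_(j < n | (i < j)%N)
      (thL F m i * thR F m i - thL F m j * thR F m j) ^+ ll i j
  * \prod_(p < m) \prod_(q < n)
      (xR F n p - xL F n p * thL F m q * thR F m q) ^+ s p q.

Local Open Scope nat_scope.

Definition ll_at (t : 'I_n) : nat :=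
  \sum_(i < n | i < t) ll i t + \sum_(j < n | t < j) ll t j.

Definition s_at (t : 'I_n) : nat := \sum_(p < m) s p t.

Definition in_I : Prop :=
  [/\ (forall i j : 'I_m, ~~ (i < j) -> kk i j = 0)
        /\ (forall i j : 'I_n, ~~ (i < j) -> ll i j = 0),
      forall t : 'I_n, l t + l' t + ll_at t + s_at t <= 1,
      (forall i j t : 'I_m, i < j -> j < t -> kk i j * k t = 0)
        /\ (forall i j i' j' : 'I_m, i < j -> i' < j' ->
              i' < i -> j < j' -> kk i j * kk i' j' = 0),
      (forall (t : 'I_m) (i j : 'I_n), i < j -> k t * ll i j = 0)
        /\ (forall (t p : 'I_m) (q : 'I_n), t < p -> k t * s p q = 0) &
      [/\ forall (i j p : 'I_m) (q : 'I_n), i < j -> j < p ->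
            kk i j * s p q = 0,
          forall (p p' : 'I_m) (q q' : 'I_n), p' < p -> q < q' ->
            s p q * s p' q' = 0,
          forall i j t : 'I_n, i < t -> t < j ->
            l t = 0 -> l' t = 0 -> s_at t = 0 -> ll_at t = 0 -> ll i j = 0,
          forall i j i' j' : 'I_n, i < i' -> i' < j -> j < j' ->
            ll i j * ll i' j' = 0 &
          forall (i j q : 'I_n) (p : 'I_m), i < j -> j < q ->
            ll i j * s p q = 0]].

Local Open Scope ring_scope.

Definition index_degree : int :=
  (\sum_(t < n) (l t + l' t))%:Z
  + 2 * (\sum_(i < n) \sum_(j < n | (i < j)%N) ll i j)%:Z
  + (\sum_(p < m) \sum_(q < n) s p q)%:Z - (\sum_(t < m) k t)%:Z.

End Basis.

(* Main.v *)
From HB Require Import structures.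
Require Import Defs.
From mathcomp Require Import all_boot all_order all_algebra.
From mathcomp Require Import mpoly ring zify ssrAC.
From mathcomp Require boolp.
From mathcomp Require Import reals complex.

Set Implicit Arguments.
Unset Strict Implicit.
Unset Printing Implicit Defensive.

Import Order.TTheory GRing.Theory Num.Theory.
Local Open Scope ring_scope.

(* Write y_i = x_(m+i).  Delta and eta generate an sl2 in which A_k has weight  *)
(* k - n.  Since Delta is locally nilpotent, Delta eta is bijective on spaces   *)
(* of negative weight, whence A_k = H_k + eta A_(k-2) for k <= n.               *)
(*                                                                              *)
(* Basis.  Weight the variables so that each factor of h(k, l, s) has a single  *)
(* heaviest term.  The resulting leading monomials are distinct and are exactly *)
(* the monomials satisfying a ballot condition, the index data being recovered  *)
(* by a bracket matching.  Every nonzero element of the kernel of Delta         *)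
(* contains a ballot monomial (split off one pair (x_i, y_i) or                 *)
(* (theta_j, theta_(n+j)) at a time and use that the remaining partial          *)
(* Laplacian, too, has no kernel in positive weights), so that subtracting      *)
(* multiples of the h(k, l, s) reduces every element of H_k to zero.            *)
(*                                                                              *)
(* Irreducibility.  Each h(k, l, s) is obtained from the highest weight vector  *)
(* v by applying elements of osp.  The form for which the monomials are         *)
(* orthogonal, of norm the product of the factorials of the exponents, is       *)
(* contravariant and makes eta adjoint to - Delta.  A submodule U of H_k in     *)
(* which the coefficient of v always vanishes has v, hence H_k, in its          *)
(* orthogonal; being orthogonal to eta A_(k-2) as well, U is zero.  Otherwise,  *)
(* the weight of v having multiplicity one in A_k, U contains v, hence H_k.     *)

(** * Coefficients *)

(** Write y_i for x_(m+i), and work with the coefficients [cf f u S] of the monomials x^u theta_S.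
    [Delta] and [eta] generate an sl2 for which a monomial of degree k has weight k - n ([hvalT]).
    Local nilpotency of [Delta] makes [Delta] after [eta] bijective in negative weights
    ([lowering_raising_surj], [lowering_raising_inj]). For k <= n the space A_(k-2) has negative
    weight, so Delta (eta g) = Delta w has a unique solution g there, and w - eta g is the harmonic
    part of w ([Ak_direct_sum]).

    For the basis, the h(k, l, s) are harmonic because each even factor commutes with [Delta] on
    what it multiplies ([hvec_Delta]), and each has a single heaviest monomial ([hvec_lead]). A
    bracket matching shows that this monomial determines the index data ([lead_inj]) and that every
    ballot monomial arises in this way ([lead_exists]). Since nilpotency of [eta] forbids kernel
    elements of positive weight for all the partial Laplacians ([DeltaP_ker_weight]), a nonzero
    harmonic element contains a ballot monomial ([kernel_ballot]). Elimination of ballot monomials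
    then gives spanning ([Hk_in_span]).

    For irreducibility, the basis serves to show that H_k is generated by its top monomial
    ([gen_base], [gen_emon], [gen_Hk]). A bilinear form is contravariant for osp ([gen_op_adjoint])
    and makes [eta] adjoint to - [Delta] ([sform_Delta]). A submodule either has an element with
    nonzero top coefficient, and then contains the top monomial because its weight has multiplicity
    one ([cartan_wt_inj], [emon_of_weight]), or is orthogonal both to H_k and to eta A_(k-2), hence
    zero. *)

Section Coefficients.
Variables (F : fieldType) (a b : nat).
Local Notation A := (spoly F a b).
Implicit Types (f g : A) (u v : 'X_{1..a}) (S T : {set 'I_b}).

Definition cf f u S : F := (f S)@_u.

Lemma cf_inj f g : (forall u S, cf f u S = cf g u S) -> f = g.
Proof. by move=> e; apply/ffunP => S; apply/mpolyP => u; apply: e. Qed.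

Lemma cf0 u S : cf 0 u S = 0.
Proof. by rewrite /cf ffunE mcoeff0. Qed.
Lemma cfD f g u S : cf (f + g) u S = cf f u S + cf g u S.
Proof. by rewrite /cf ffunE mcoeffD. Qed.
Lemma cfN f u S : cf (- f) u S = - cf f u S.
Proof. by rewrite /cf ffunE mcoeffN. Qed.
Lemma cfB f g u S : cf (f - g) u S = cf f u S - cf g u S.
Proof. by rewrite cfD cfN. Qed.
Lemma cfZ c f u S : cf (c *: f) u S = c * cf f u S.
Proof. by rewrite /cf ffunE mcoeffZ. Qed.
Lemma cf_sum I (r : seq I) (P : pred I) (G : I -> A) u S :
  cf (\sum_(i <- r | P i) G i) u S = \sum_(i <- r | P i) cf (G i) u S.
Proof. by elim/big_ind2: _ => [|x1 x2 y1 y2 <- <-|]; rewrite ?cf0 ?cfD. Qed.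

Lemma cf_xvarM i f u S :
  cf (xvar F b i * f) u S = if (0 < u i)%N then cf f (u - U_(i))%MM S else 0.
Proof.
rewrite /cf xvarME mulrC; case: ifPn => ui; last first.
  apply/eqP; rewrite mcoeff_eq0 (perm_mem (msuppMX _ _)).
  by apply: contra ui => /mapP[v _ ->]; rewrite mnmDE mnm1E eqxx.
have {1}-> : u = ((U_(i) + (u - U_(i))))%MM.
  by rewrite addmC submK //; apply/mnm_lepP => j; rewrite mnm1E; case: eqP => // <-.
by rewrite mcoeffMX.
Qed.

Lemma cf_xvarMD i f u S : cf (xvar F b i * f) (u + U_(i))%MM S = cf f u S.
Proof. by rewrite cf_xvarM mnmDE mnm1E eqxx addn1 /= addmK. Qed.

Lemma cf_dx i f u S : cf (dx i f) u S = cf f (u + U_(i))%MM S *+ (u i).+1.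
Proof. by rewrite /cf ffunE mcoeff_deriv. Qed.

(** The sign of moving theta_p into place: theta_p theta_(S \ p) is [msgn p S] times theta_S when p
    is in S. The same sign governs [dtheta]. *)
Definition msgn (p : 'I_b) S : F := (-1) ^+ #|[set q in S | (q < p)%N]|.

Lemma msgn_neq0 p S : msgn p S != 0.
Proof. by rewrite signr_eq0. Qed.

Lemma msgnK p S : msgn p S * msgn p S = 1.
Proof. by rewrite -expr2 sqrr_sign. Qed.

Lemma signME (c : nat) (p : {mpoly F[a]}) u : ((-1) ^+ c * p)@_u = (-1) ^+ c * p@_u.
Proof.
elim: c => [|c IH]; first by rewrite !expr0 !mul1r.
by rewrite !exprS !mulN1r !mulNr mcoeffN IH.
Qed.

Lemma cf_thetaM p f u S :
  cf (theta F a p * f) u S = if p \in S then msgn p S * cf f u (S :\ p) else 0.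
Proof. by rewrite /cf thetaME; case: ifP; rewrite ?mcoeff0 ?signME. Qed.

Lemma cf_dtheta p f u S :
  cf (dtheta p f) u S = if p \in S then 0 else msgn p S * cf f u (p |: S).
Proof. by rewrite /cf ffunE; case: ifP; rewrite ?mcoeff0 ?signME. Qed.

Lemma msgnD1 p S : msgn p (S :\ p) = msgn p S.
Proof.
rewrite /msgn; congr ((-1) ^+ _); apply: eq_card => q; rewrite !inE.
by case: eqVneq => [->|_] //=; rewrite ltnn andbF.
Qed.

Lemma msgnU1 p S : msgn p (p |: S) = msgn p S.
Proof.
rewrite /msgn; congr ((-1) ^+ _); apply: eq_card => q; rewrite !inE.
by case: eqVneq => [->|_] //=; rewrite ltnn !andbF.
Qed.

Lemma cf_theta_dtheta p f u S :
  cf (theta F a p * dtheta p f) u S = (p \in S)%:R * cf f u S.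
Proof.
rewrite cf_thetaM; case: ifPn => pS; rewrite ?mul0r // mul1r.
by rewrite cf_dtheta !inE eqxx /= setD1K // msgnD1 mulrA msgnK mul1r.
Qed.

Lemma cf_xvar_dx i f u S : cf (xvar F b i * dx i f) u S = (u i)%:R * cf f u S.
Proof.
rewrite cf_xvarM; case: ifPn => ui; last first.
  by move: ui; rewrite -eqn0Ngt => /eqP ->; rewrite mul0r.
rewrite cf_dx submK; last first.
  by apply/mnm_lepP => j; rewrite mnm1E; case: eqP => // <-.
by rewrite mnmBE mnm1E eqxx subn1 prednK // mulr_natl.
Qed.

Lemma dx_is_linear i : linear (@dx F a b i).
Proof. by move=> c f g; apply/ffunP => S; rewrite !ffunE linearP. Qed.
HB.instance Definition _ i := GRing.isLinear.Build F A A *:%R (@dx F a b i) (dx_is_linear i).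

Lemma dtheta_is_linear p : linear (@dtheta F a b p).
Proof.
move=> c f g; apply/ffunP => S; rewrite !ffunE; case: ifP => _.
  by rewrite scaler0 addr0.
by rewrite mulrDr scalerAr.
Qed.
HB.instance Definition _ p :=
  GRing.isLinear.Build F A A *:%R (@dtheta F a b p) (dtheta_is_linear p).

Lemma xvarC i f : xvar F b i * f = f * xvar F b i.
Proof.
apply/ffunP => U; rewrite xvarME ffunE (bigD1 U) //= ffunE setDv eqxx.
rewrite inversionss0 expr0 mul1r big1 ?addr0 1?mulrC // => S /andP[sSU nSU].
rewrite ffunE setD_eq0 (_ : U \subset S = false) ?mulr0 //.
by apply: contraNF nSU => sUS; rewrite eqEsubset sSU.
Qed.

Lemma xvarCA i f g : f * (xvar F b i * g) = xvar F b i * (f * g).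
Proof. by rewrite mulrA -xvarC mulrA. Qed.

Lemma dx_xvarM i j f :
  dx i (xvar F b j * f) = (i == j)%:R *: f + xvar F b j * dx i f.
Proof.
have addE (g h : A) S : (g + h) S = g S + h S by rewrite ffunE.
have sclE (c : F) (g : A) S : (c *: g) S = c *: g S by rewrite ffunE.
have dE g S : dx i g S = (g S)^`M(i) by rewrite ffunE.
apply/ffunP => S; rewrite dE xvarME mderivM mderivX mnm1E addE sclE xvarME dE eq_sym.
case: eqVneq => [->|_] /=; rewrite ?mulr1n ?mulr0n ?scale1r ?submm ?mpolyX0 ?mul1r //.
  by rewrite (_ : U_(j) - U_(j) = 0)%MM ?mpolyX0 ?mul1r //; apply/mnmP => k; rewrite mnmBE subnn mnm0E.
by rewrite !scale0r mul0r.
Qed.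

Lemma dx_thetaM i p f : dx i (theta F a p * f) = theta F a p * dx i f.
Proof.
apply: cf_inj => u S; rewrite cf_dx !cf_thetaM.
by case: ifP => _; rewrite ?mul0rn // cf_dx mulrnAr.
Qed.

Lemma dx_dx i j f : dx i (dx j f) = dx j (dx i f).
Proof. by apply/ffunP => S; rewrite !ffunE mderiv_comm. Qed.

Lemma dx_dtheta i p f : dx i (dtheta p f) = dtheta p (dx i f).
Proof.
apply: cf_inj => u S; rewrite cf_dx !cf_dtheta.
by case: ifP => _; rewrite ?mul0rn // cf_dx mulrnAr.
Qed.

Lemma theta_thetaM p q f :
  theta F a p * (theta F a q * f) = - (theta F a q * (theta F a p * f)).
Proof.
wlog lt : p q f / (p < q)%N.
  move=> H; have [lt|lt|e] := ltngtP p q; first exact: H.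
    by rewrite [in RHS]H // opprK.
  have -> : p = q by apply: val_inj.
  suff -> : theta F a q * (theta F a q * f) = 0 by rewrite oppr0.
  apply: cf_inj => u S; rewrite cf0 cf_thetaM; case: ifP => // qS.
  by rewrite cf_thetaM !inE eqxx /= mulr0.
apply: cf_inj => u S; rewrite cfN !cf_thetaM !inE.
have npq : p != q by rewrite neq_ltn lt.
case: (boolP (p \in S)) => pS; case: (boolP (q \in S)) => qS;
  rewrite ?cf_thetaM ?inE ?qS ?pS ?mulr0 ?oppr0 ?npq //= ?[q == p]eq_sym ?npq ?andbF ?mulr0 ?oppr0 //=.
have -> : S :\ p :\ q = S :\ q :\ p by rewrite !setDDl setUC.
have -> : msgn q S = - msgn q (S :\ p).
  rewrite /msgn (cardsD1 p) !inE pS lt add1n exprS mulN1r; congr (- ((-1) ^+ _)).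
  by apply: eq_card => r; rewrite !inE andbA.
have -> : msgn p (S :\ q) = msgn p S.
  rewrite /msgn; congr ((-1) ^+ _); apply: eq_card => r; rewrite !inE.
  by case: eqVneq => [->|_] //=; rewrite ltnNge ltnW // andbF.
ring.
Qed.

Lemma dtheta_dtheta p q f : dtheta p (dtheta q f) = - dtheta q (dtheta p f).
Proof.
wlog lt : p q f / (p < q)%N.
  move=> H; have [lt|lt|e] := ltngtP p q; first exact: H.
    by rewrite [in RHS]H // opprK.
  have -> : p = q by apply: val_inj.
  suff -> : dtheta q (dtheta q f) = 0 by rewrite oppr0.
  apply: cf_inj => u S; rewrite cf0 cf_dtheta; case: ifP => // qS.
  by rewrite cf_dtheta !inE eqxx /= mulr0.
apply: cf_inj => u S; rewrite cfN !cf_dtheta !inE.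
have npq : p != q by rewrite neq_ltn lt.
case: (boolP (p \in S)) => pS; case: (boolP (q \in S)) => qS;
  rewrite ?inE ?orbT ?qS ?pS ?mulr0 ?oppr0 ?[q == p]eq_sym ?(negPf npq) //=
          ?orbT ?mulr0 ?oppr0 //.
have -> : q |: (p |: S) = p |: (q |: S) by rewrite setUCA.
have -> : msgn q (p |: S) = - msgn q S.
  rewrite /msgn (cardsD1 p) !inE eqxx lt add1n exprS mulN1r; congr (- ((-1) ^+ _)).
  by apply: eq_card => r; rewrite !inE; case: eqVneq => [->|_] //=; rewrite (negPf pS).
have -> : msgn p (q |: S) = msgn p S.
  rewrite /msgn; congr ((-1) ^+ _); apply: eq_card => r; rewrite !inE.
  by case: eqVneq => [->|_] //=; rewrite ltnNge ltnW // !andbF.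
ring.
Qed.

Definition emon u S : A := [ffun T => if T == S then 'X_[u] else 0].

Lemma cf_emon u S v T : cf (emon u S) v T = ((u == v) && (T == S))%:R.
Proof.
by rewrite /cf ffunE; case: eqP => _; rewrite ?andbF ?mcoeff0 // andbT mcoeffX.
Qed.

Lemma emonE f : f = \sum_S \sum_(u <- msupp (f S)) cf f u S *: emon u S.
Proof.
apply: cf_inj => v T; rewrite cf_sum (bigD1 T) //= [X in _ + X]big1 ?addr0; last first.
  move=> S nST; rewrite cf_sum big1 // => u _.
  by rewrite cfZ cf_emon [T == S]eq_sym (negPf nST) andbF mulr0.
rewrite cf_sum; have [vf|vf] := boolP (v \in msupp (f T)).
  rewrite (big_rem v) //= big1_seq ?addr0 => [|u /=].
    by rewrite cfZ cf_emon !eqxx mulr1.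
  rewrite mem_rem_uniq ?msupp_uniq // !inE => /andP[nuv _].
  by rewrite cfZ cf_emon (negPf nuv) mulr0.
rewrite big1_seq => [|u /=]; first by apply/eqP; rewrite /cf mcoeff_eq0.
move=> uf; rewrite cfZ cf_emon; case: eqVneq uf => [-> uf|_ _]; last by rewrite mulr0.
by rewrite uf in vf.
Qed.

End Coefficients.

(** * The sl2-triple of Delta and eta *)

Section AbstractSl2.
Variables (F : numFieldType) (V : lmodType F) (W : int -> V -> Prop).
Variables D E : {linear V -> V}.
Hypothesis subW : forall mu, subspace (W mu).
Hypothesis WD : forall mu v, W mu v -> W (mu - 2) (D v).
Hypothesis WE : forall mu v, W mu v -> W (mu + 2) (E v).
Hypothesis WDE : forall mu v, W mu v -> D (E v) = E (D v) + mu%:~R *: v.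

Lemma iter_lowering mu N v : W mu v -> W (mu - (N * 2)%N%:Z) (iter N D v).
Proof.
move=> Wv; elim: N => [|N IH] /=; first by rewrite subr0.
by rewrite (_ : _ - _ = mu - (N * 2)%N%:Z - 2); [exact: WD | lia].
Qed.

Lemma iter_linear0 (L : {linear V -> V}) N : iter N L 0 = 0.
Proof. by elim: N => //= N ->; rewrite linear0. Qed.

(** Moving E through N + 1 copies of D collects the weights mu, mu - 2, ..., mu - 2 N, whose sum is
    (N + 1) (mu - N). *)
Lemma iter_lowering_raising mu N v : W mu v ->
  iter N.+1 D (E v) =
  E (iter N.+1 D v) + (N.+1%:Z * (mu - N%:Z))%:~R *: iter N D v.
Proof.
move=> Wv; elim: N => [|N IH]; first by rewrite /= subr0 mul1r (WDE Wv).
rewrite iterS IH linearD linearZ /= (WDE (iter_lowering N.+1 Wv)) -addrA /=.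
congr (_ + _); rewrite -scalerDl -intrD.
by congr (_%:~R *: _); lia.
Qed.

(** The hypotheses pass from v to E v, with mu + 2 and N + 1 in place of mu and N, so induction on K
    gives E v = 0. After that the scalars (N' + 1) (mu - N') with N' < N are nonzero, and the copies
    of D are peeled off one by one. *)
Lemma iter_lowering_inj K : forall mu N v, W mu v -> N%:Z <= mu ->
  iter K E v = 0 -> iter N D v = 0 -> v = 0.
Proof.
elim: K => [//|K IH] mu N v Wv le_N; rewrite iterSr => EK DN.
have Ev0 : E v = 0.
  apply: (IH (mu + 2) N.+1 (E v)) => //; first exact: WE.
    by lia.
  by rewrite (iter_lowering_raising _ Wv) iterS DN !linear0 add0r.
elim: N le_N DN => [//|N IHN] le_N DN; apply: IHN; first by lia.
have := iter_lowering_raising N Wv.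
rewrite Ev0 DN iter_linear0 linear0 add0r => /esym/eqP.
by rewrite scaler_eq0 intr_eq0 => /orP[/eqP|/eqP //]; nia.
Qed.

(** Induction on the nilpotency order: D E v - c v is killed by one power of D fewer than v, and c
    is nonzero because mu is negative. Solving for this remainder solves for v. *)
Lemma lowering_raising_surj mu v N : W mu v -> mu < 0 -> iter N D v = 0 ->
  exists2 g, W mu g & D (E g) = v.
Proof.
move=> + mu_lt0; elim: N v => [|N IH] v Wv /= DN.
  by exists 0; [case: (subW mu) | rewrite !linear0].
set c : F := (N.+1%:Z * (mu - N%:Z))%:~R.
have c_neq0 : c != 0 by rewrite intr_eq0; nia.
have WDEv : W mu (D (E v)).
  by rewrite (_ : mu = mu + 2 - 2); [apply/WD/WE | lia].
have [g Wg gE] : exists2 g, W mu g & D (E g) = D (E v) - c *: v.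
  apply: IH; first by rewrite addrC -scaleNr; apply (subW mu).2.
  have iterB n x y : iter n D (x - y) = iter n D x - iter n D y.
    by elim: n => //= n ->; rewrite linearB.
  have iterZ n a x : iter n D (a *: x) = a *: iter n D x.
    by elim: n => //= n ->; rewrite linearZ.
  rewrite iterB iterZ -iterSr (iter_lowering_raising _ Wv) iterS DN.
  by rewrite !linear0 add0r subrr.
exists (c^-1 *: (v - g)).
  rewrite -[_ *: _]addr0; apply (subW mu).2; last by case: (subW mu).
  by rewrite addrC -scaleN1r; apply (subW mu).2.
by rewrite !linearZ !linearB /= gE opprB addrC subrK scalerA mulVf ?scale1r.
Qed.

(** Applying a power of D to D (E v) = 0 leaves the multiple (N + 1) (mu - N) of D^N v, so the
    nilpotency order of v drops down to zero. *)
Lemma lowering_raising_inj mu v N : W mu v -> mu < 0 -> iter N D v = 0 ->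
  D (E v) = 0 -> v = 0.
Proof.
move=> Wv mu_lt0 + DE0; elim: N => [//|N IH] DN; apply: IH.
have := iter_lowering_raising N Wv.
rewrite iterSr DE0 iter_linear0 DN linear0 add0r => /esym/eqP.
by rewrite scaler_eq0 intr_eq0 => /orP[/eqP|/eqP //]; nia.
Qed.

End AbstractSl2.

(** * Commutation rules of the partial Laplacians *)

Section PartialLaplacian.
Variables (F : numFieldType) (m n : nat).
Local Notation A := (spoly F (m + m) (n + n)).
Implicit Types (f g : A) (u : 'X_{1..m + m}) (S : {set 'I_(n + n)}).
Implicit Types (P : pred 'I_m) (Q : pred 'I_n).

Local Notation xl i := (xL F n i).
Local Notation xr i := (xR F n i).
Local Notation tl j := (thL F m j).
Local Notation tr j := (thR F m j).
Local Notation dl i := (@dx F _ _ (lshift m i)).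
Local Notation dr i := (@dx F _ _ (rshift m i)).
Local Notation el j := (@dtheta F _ _ (lshift n j)).
Local Notation er j := (@dtheta F _ _ (rshift n j)).

(* Delta and eta restricted to the index pairs in P and Q: again an sl2-triple. *)
Definition DeltaP P Q f : A :=
  - (\sum_(i | P i) xl i * dr i f) + \sum_(j | Q j) el j (er j f).

Definition etaP P Q f : A :=
  \sum_(i | P i) xr i * dl i f + \sum_(j | Q j) tl j * tr j * f.

(** The commutator of [DeltaP] and [etaP], that is, the Cartan element of the restricted sl2; [hval]
    is its eigenvalue on a monomial. *)
Definition hP P Q f : A :=
  \sum_(i | P i) (xr i * dr i f - xl i * dl i f)
  + \sum_(j | Q j) (tl j * el j f + tr j * er j f - f).

Lemma DeltaPT f : Delta f = DeltaP predT predT f. Proof. by []. Qed.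
Lemma etaPT f : eta f = etaP predT predT f. Proof. by []. Qed.

Lemma DeltaP_is_linear P Q : linear (DeltaP P Q).
Proof.
move=> c f g; rewrite /DeltaP scalerDr scalerN !scaler_sumr addrACA -opprD -!big_split /=.
congr (- _ + _); apply: eq_bigr => i _; first by rewrite linearP mulrDr scalerAr.
by rewrite !linearP.
Qed.
HB.instance Definition _ P Q :=
  GRing.isLinear.Build F A A *:%R (DeltaP P Q) (DeltaP_is_linear P Q).

Lemma etaP_is_linear P Q : linear (etaP P Q).
Proof.
move=> c f g; rewrite /etaP scalerDr !scaler_sumr addrACA -!big_split /=.
congr (_ + _); apply: eq_bigr => i _; first by rewrite linearP mulrDr scalerAr.
by rewrite mulrDr scalerAr.
Qed.
HB.instance Definition _ P Q :=
  GRing.isLinear.Build F A A *:%R (etaP P Q) (etaP_is_linear P Q).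

Lemma sum_delta (I : finType) (V : lmodType F) (P : pred I) (a : I) (G : I -> V) :
  \sum_(i | P i) (i == a)%:R *: G i = (P a)%:R *: G a.
Proof.
rewrite big_mkcond (bigD1 a) //= eqxx scale1r big1 ?addr0.
  by case: (P a); rewrite ?scale1r ?scale0r.
by move=> i /negPf ->; rewrite scale0r if_same.
Qed.

Lemma DeltaP_xL P Q a f : DeltaP P Q (xl a * f) = xl a * DeltaP P Q f.
Proof.
rewrite /DeltaP mulrDr mulrN !mulr_sumr; congr (- _ + _); apply: eq_bigr => i _.
  by rewrite dx_xvarM eq_rlshift scale0r add0r xvarCA.
by rewrite !dtheta_xvarM.
Qed.

Lemma DeltaP_xR P Q a f :
  DeltaP P Q (xr a * f) = xr a * DeltaP P Q f - (P a)%:R *: (xl a * f).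
Proof.
rewrite /DeltaP mulrDr mulrN !mulr_sumr [in RHS]addrAC -opprD.
congr (- _ + _); last by apply: eq_bigr => i _; rewrite !dtheta_xvarM.
rewrite -(sum_delta P a (fun i => xl i * f)) -big_split /=.
apply: eq_bigr => i _; rewrite dx_xvarM eq_rshift mulrDr xvarCA addrC.
by rewrite scalerAr.
Qed.

Lemma DeltaP_dxL P Q a f :
  DeltaP P Q (dl a f) = dl a (DeltaP P Q f) + (P a)%:R *: dr a f.
Proof.
rewrite /DeltaP linearD linearN !linear_sum /= addrAC.
congr (_ + _); last first.
  by apply: eq_bigr => j _; rewrite -!dx_dtheta.
rewrite -(sum_delta P a (fun i => dr i f)) -big_split /=.
apply: eq_bigr => i _; rewrite dx_xvarM eq_lshift opprD addrAC eq_sym addNr add0r.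
by rewrite dx_dx.
Qed.

Lemma DeltaP_dxR P Q a f : DeltaP P Q (dr a f) = dr a (DeltaP P Q f).
Proof.
rewrite /DeltaP linearD linearN !linear_sum /=.
congr (_ + _); apply: eq_bigr => i _; last by rewrite -!dx_dtheta.
by rewrite dx_xvarM eq_rlshift scale0r add0r dx_dx.
Qed.

Lemma DeltaP_thL P Q q f :
  DeltaP P Q (tl q * f) = tl q * DeltaP P Q f - (Q q)%:R *: er q f.
Proof.
rewrite /DeltaP mulrDr mulrN !mulr_sumr -addrA; congr (- _ + _).
  apply: eq_bigr => i _; rewrite dx_thetaM.
  by rewrite -xvarCA.
rewrite -(sum_delta Q q (fun i => er i f)) -sumrN -big_split /=.
apply: eq_bigr => j _; rewrite dtheta_thetaM eq_rlshift scale0r sub0r linearN /=.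
by rewrite dtheta_thetaM eq_lshift opprB.
Qed.

Lemma DeltaP_thR P Q q f :
  DeltaP P Q (tr q * f) = tr q * DeltaP P Q f + (Q q)%:R *: el q f.
Proof.
rewrite /DeltaP mulrDr mulrN !mulr_sumr -addrA; congr (- _ + _).
  apply: eq_bigr => i _; rewrite dx_thetaM.
  by rewrite -xvarCA.
rewrite -(sum_delta Q q (fun i => el i f)) -big_split /=.
apply: eq_bigr => j _; rewrite dtheta_thetaM eq_rshift linearB linearZ /=.
by rewrite dtheta_thetaM eq_lrshift scale0r sub0r opprK addrC.
Qed.

Lemma DeltaP_dtheta P Q p f : DeltaP P Q (dtheta p f) = dtheta p (DeltaP P Q f).
Proof.
rewrite /DeltaP linearD linearN !linear_sum /=.
congr (_ + _); apply: eq_bigr => i _.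
  by rewrite dtheta_xvarM dx_dtheta.
by rewrite [er i (dtheta p f)]dtheta_dtheta linearN /= dtheta_dtheta opprK.
Qed.

Lemma DeltaP_etaP P Q f :
  DeltaP P Q (etaP P Q f) = etaP P Q (DeltaP P Q f) + hP P Q f.
Proof.
rewrite /etaP /hP linearD !linear_sum /= addrACA -!big_split /=.
congr (_ + _); apply: eq_bigr => i Pi.
  by rewrite DeltaP_xR DeltaP_dxL Pi !scale1r mulrDr addrA.
rewrite -!mulrA DeltaP_thL DeltaP_thR Pi !scale1r mulrDr -!addrA; congr (_ + (_ + _)).
by rewrite dtheta_thetaM eqxx scale1r opprB.
Qed.

Definition hval P Q u S : int :=
  \sum_(i | P i) ((u (rshift m i))%:Z - (u (lshift m i))%:Z)
  + \sum_(j | Q j) ((lshift n j \in S)%:Z + (rshift n j \in S)%:Z - 1).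

Lemma cf_hP P Q f u S : cf (hP P Q f) u S = (hval P Q u S)%:~R * cf f u S.
Proof.
rewrite /hP /hval cfD !cf_sum intrD mulrDl !rmorph_sum /= !mulr_suml.
congr (_ + _); apply: eq_bigr => i _.
  by rewrite cfB !cf_xvar_dx rmorphB /= mulrBl.
by rewrite cfB cfD !cf_theta_dtheta rmorphB rmorphD /= mulrBl mulrDl mul1r.
Qed.

Definition supp (M : 'X_{1..m + m} -> {set 'I_(n + n)} -> Prop) f : Prop :=
  forall u S, cf f u S != 0 -> M u S.

Lemma supp_subspace M : subspace (supp M).
Proof.
split=> [u S|c f g Mf Mg u S]; first by rewrite cf0 eqxx.
rewrite cfD cfZ; case: (eqVneq (cf f u S) 0) => [->|/Mf //].
by rewrite mulr0 add0r => /Mg.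
Qed.

Lemma sum_neq0 (I : finType) (P : pred I) (G : I -> F) :
  \sum_(i | P i) G i != 0 -> exists2 i, P i & G i != 0.
Proof.
move=> nz; have [/existsP[i /andP[Pi Gi]]|] := boolP [exists i, P i && (G i != 0)].
  by exists i.
rewrite negb_exists => /forallP H; case/eqP: nz; apply: big1 => i Pi.
by have := H i; rewrite Pi negbK => /eqP.
Qed.

Lemma cf_DeltaP_neq0 P Q f u S : cf (DeltaP P Q f) u S != 0 ->
  (exists2 i, P i & (0 < u (lshift m i))%N /\
     cf f (u - U_(lshift m i) + U_(rshift m i))%MM S != 0) \/
  (exists2 j, Q j & [/\ lshift n j \notin S, rshift n j \notin S &
     cf f u (lshift n j |: (rshift n j |: S)) != 0]).
Proof.
rewrite cfD cfN !cf_sum; case: (eqVneq (\sum_(i | P i) cf (xl i * dr i f) u S) 0).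
  move=> ->; rewrite oppr0 add0r => /sum_neq0[j Qj]; rewrite !cf_dtheta !inE.
  rewrite eq_rlshift /=; case: ifP => lS; first by rewrite eqxx.
  case: ifP => rS; first by rewrite mulr0 eqxx.
  rewrite !mulf_eq0 !negb_or => /and3P[_ _ nz]; right; exists j => //.
  by rewrite lS rS; split=> //; rewrite setUCA.
move=> /sum_neq0[i Pi]; rewrite cf_xvarM; case: ifP => // u0; last by rewrite eqxx.
rewrite cf_dx; case: (eqVneq (cf f (u - U_(lshift m i) + U_(rshift m i))%MM S) 0) => [->|].
  by rewrite mul0rn eqxx.
by move=> nz _ _; left; exists i.
Qed.

Lemma cf_etaP_neq0 P Q f u S : cf (etaP P Q f) u S != 0 ->
  (exists2 i, P i & (0 < u (rshift m i))%N /\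
     cf f (u - U_(rshift m i) + U_(lshift m i))%MM S != 0) \/
  (exists2 j, Q j & [/\ lshift n j \in S, rshift n j \in S &
     cf f u (S :\ lshift n j :\ rshift n j) != 0]).
Proof.
rewrite cfD !cf_sum; case: (eqVneq (\sum_(i | P i) cf (xr i * dl i f) u S) 0).
  move=> ->; rewrite add0r => /sum_neq0[j Qj]; rewrite -mulrA !cf_thetaM !inE.
  rewrite eq_rlshift /=; case: ifP => lS; last by rewrite eqxx.
  case: ifP => rS; last by rewrite mulr0 eqxx.
  by rewrite !mulf_eq0 !negb_or => /and3P[_ _ nz]; right; exists j => //.
move=> /sum_neq0[i Pi]; rewrite cf_xvarM; case: ifP => // u0; last by rewrite eqxx.
rewrite cf_dx; case: (eqVneq (cf f (u - U_(rshift m i) + U_(lshift m i))%MM S) 0) => [->|].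
  by rewrite mul0rn eqxx.
by move=> nz _ _; left; exists i.
Qed.

End PartialLaplacian.

(** * Supports, weight spaces and local nilpotency *)

Section Grading.
Variables (F : numFieldType) (m n : nat).
Local Notation A := (spoly F (m + m) (n + n)).
Implicit Types (f g : A) (u : 'X_{1..m + m}) (S : {set 'I_(n + n)}).
Implicit Types (P : pred 'I_m) (Q : pred 'I_n).

(** Only finitely many monomials occur in f, so any numerical function of monomials can serve as a
    termination measure. *)
Lemma supp_bounded (phi : 'X_{1..m + m} -> {set 'I_(n + n)} -> nat) f :
  exists K, supp (fun u S => (phi u S < K)%N) f.
Proof.
exists (\sum_S \sum_(u <- msupp (f S)) (phi u S).+1)%N => u S nz.
rewrite (bigD1 S) //= (big_rem u) /=; last by rewrite mcoeff_msupp.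
by rewrite -addnA ltn_addr.
Qed.

Definition res (b : 'X_{1..m + m} -> {set 'I_(n + n)} -> bool) f : A :=
  [ffun S => \sum_(u <- msupp (f S) | b u S) cf f u S *: 'X_[u]].

Lemma cf_res b f u S : cf (res b f) u S = if b u S then cf f u S else 0.
Proof.
rewrite /cf ffunE linear_sum /=; have [uf|uf] := boolP (u \in msupp (f S)).
  rewrite (big_rem u) //= big1_seq ?addr0 => [|v /= /andP[_]].
    by case: (b u S); rewrite ?mcoeff0 // mcoeffZ mcoeffX eqxx mulr1.
  rewrite mem_rem_uniq ?msupp_uniq // !inE => /andP[nuv _].
  by rewrite mcoeffZ mcoeffX (negPf nuv) mulr0.
rewrite big1_seq => [|v /= /andP[_ vf]].
  by rewrite -mcoeff_eq0 in uf; rewrite (eqP uf) if_same.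
rewrite mcoeffZ mcoeffX; case: eqVneq vf => [-> vf|_ _]; last by rewrite mulr0.
by rewrite vf in uf.
Qed.

(** These four moves go against the operators: the coefficient of [DeltaP P Q f] at (u, S) draws on
    those of f at ([up_u u i], S) and (u, [pairs_up S j]), and [etaP] uses [dn_u] and [pairs_dn]
    likewise. *)
Definition up_u u i := (u - U_(lshift m i) + U_(rshift m i))%MM.
Definition dn_u u i := (u - U_(rshift m i) + U_(lshift m i))%MM.
Definition pairs_up S j := lshift n j |: (rshift n j |: S).
Definition pairs_dn S j := S :\ lshift n j :\ rshift n j.

Lemma up_uL u i k : up_u u i (lshift m k) = (u (lshift m k) - (i == k))%N.
Proof. by rewrite mnmDE mnmBE !mnm1E eq_lshift eq_rlshift addn0. Qed.
Lemma up_uR u i k : up_u u i (rshift m k) = (u (rshift m k) + (i == k))%N.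
Proof. by rewrite mnmDE mnmBE !mnm1E eq_rshift eq_lrshift subn0. Qed.
Lemma dn_uL u i k : dn_u u i (lshift m k) = (u (lshift m k) + (i == k))%N.
Proof. by rewrite mnmDE mnmBE !mnm1E eq_lshift eq_rlshift subn0. Qed.
Lemma dn_uR u i k : dn_u u i (rshift m k) = (u (rshift m k) - (i == k))%N.
Proof. by rewrite mnmDE mnmBE !mnm1E eq_rshift eq_lrshift addn0. Qed.
Lemma pairs_upL S j k : (lshift n k \in pairs_up S j) = (k == j) || (lshift n k \in S).
Proof. by rewrite !inE eq_lshift eq_lrshift. Qed.
Lemma pairs_upR S j k : (rshift n k \in pairs_up S j) = (k == j) || (rshift n k \in S).
Proof. by rewrite !inE eq_rshift eq_rlshift. Qed.
Lemma pairs_dnL S j k : (lshift n k \in pairs_dn S j) = (k != j) && (lshift n k \in S).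
Proof. by rewrite !inE eq_lshift eq_lrshift. Qed.
Lemma pairs_dnR S j k : (rshift n k \in pairs_dn S j) = (k != j) && (rshift n k \in S).
Proof. by rewrite !inE eq_rshift eq_rlshift. Qed.

Lemma sum_bump (R : nmodType) (I : finType) (P : pred I) (i : I) (G H : I -> R) (c : R) :
  P i -> G i = H i + c -> (forall k, k != i -> G k = H k) ->
  \sum_(k | P k) G k = \sum_(k | P k) H k + c.
Proof.
move=> Pi Gi GH; rewrite (bigD1 i) //= Gi [in RHS](bigD1 i) //= [in RHS]addrAC.
by congr (_ + _); apply: eq_bigr => k /andP[_ /GH].
Qed.

Lemma hval_up_u P Q u S i : P i -> (0 < u (lshift m i))%N ->
  hval P Q (up_u u i) S = hval P Q u S + 2.
Proof.
move=> Pi u0; rewrite /hval addrAC; congr (_ + _); apply: (sum_bump Pi).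
  by rewrite up_uL up_uR eqxx; lia.
by move=> k /negPf nk; rewrite up_uL up_uR eq_sym nk; lia.
Qed.

Lemma hval_dn_u P Q u S i : P i -> (0 < u (rshift m i))%N ->
  hval P Q (dn_u u i) S = hval P Q u S - 2.
Proof.
move=> Pi u0; rewrite /hval [in RHS]addrAC; congr (_ + _); apply: (sum_bump Pi).
  by rewrite dn_uL dn_uR eqxx; lia.
by move=> k /negPf nk; rewrite dn_uL dn_uR eq_sym nk; lia.
Qed.

Lemma hval_pairs_up P Q u S j : Q j -> lshift n j \notin S -> rshift n j \notin S ->
  hval P Q u (pairs_up S j) = hval P Q u S + 2.
Proof.
move=> Qj /negPf lS /negPf rS; rewrite /hval -addrA; congr (_ + _); apply: (sum_bump Qj).
  by rewrite pairs_upL pairs_upR eqxx lS rS.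
by move=> k /negPf nk; rewrite pairs_upL pairs_upR nk.
Qed.

Lemma hval_pairs_dn P Q u S j : Q j -> lshift n j \in S -> rshift n j \in S ->
  hval P Q u (pairs_dn S j) = hval P Q u S - 2.
Proof.
move=> Qj lS rS; rewrite /hval -addrA; congr (_ + _); apply: (sum_bump Qj).
  by rewrite pairs_dnL pairs_dnR eqxx lS rS.
by move=> k nk; rewrite pairs_dnL pairs_dnR nk.
Qed.

Lemma DeltaP_supp P Q (M M' : 'X_{1..m + m} -> {set 'I_(n + n)} -> Prop) f :
  (forall u S i, P i -> (0 < u (lshift m i))%N -> M (up_u u i) S -> M' u S) ->
  (forall u S j, Q j -> lshift n j \notin S -> rshift n j \notin S ->
     M u (pairs_up S j) -> M' u S) ->
  supp M f -> supp M' (DeltaP P Q f).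
Proof.
move=> Mu MS Mf u S /cf_DeltaP_neq0[[i Pi [u0 /Mf]]|[j Qj [lS rS /Mf]]].
  exact: Mu.
exact: MS.
Qed.

Lemma etaP_supp P Q (M M' : 'X_{1..m + m} -> {set 'I_(n + n)} -> Prop) f :
  (forall u S i, P i -> (0 < u (rshift m i))%N -> M (dn_u u i) S -> M' u S) ->
  (forall u S j, Q j -> lshift n j \in S -> rshift n j \in S ->
     M u (pairs_dn S j) -> M' u S) ->
  supp M f -> supp M' (etaP P Q f).
Proof.
move=> Mu MS Mf u S /cf_etaP_neq0[[i Pi [u0 /Mf]]|[j Qj [lS rS /Mf]]].
  exact: Mu.
exact: MS.
Qed.

(** This is how graded pieces of a kernel element remain in the kernel. *)
Lemma DeltaP_res P Q b b' f :
  (forall u S i, P i -> (0 < u (lshift m i))%N -> b (up_u u i) S = b' u S) ->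
  (forall u S j, Q j -> lshift n j \notin S -> rshift n j \notin S ->
     b u (pairs_up S j) = b' u S) ->
  DeltaP P Q (res b f) = res b' (DeltaP P Q f).
Proof.
move=> bu bS; apply: cf_inj => u S; rewrite cf_res /DeltaP !cfD !cfN !cf_sum.
case: ifPn => [|/negPf] b'u.
  congr (- _ + _); apply: eq_bigr => i Pi.
    rewrite !cf_xvarM; case: ifP => // u0.
    by rewrite !cf_dx cf_res -/(up_u u i) bu // b'u.
  rewrite !cf_dtheta !inE eq_rlshift /=; case: ifPn => // lS; case: ifPn => // rS.
  by rewrite cf_res setUCA -/(pairs_up S i) bS // b'u.
rewrite !big1 ?oppr0 ?addr0 // => i Pi.
  rewrite !cf_dtheta !inE eq_rlshift /=; case: ifPn => // lS; case: ifPn => // rS.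
    by rewrite mulr0.
  by rewrite cf_res setUCA -/(pairs_up S i) bS // b'u !mulr0.
rewrite cf_xvarM; case: ifP => // u0.
by rewrite cf_dx cf_res -/(up_u u i) bu // b'u mul0rn.
Qed.

Lemma ltn_sum_at (I : finType) (P : pred I) (i : I) (G H : I -> nat) :
  P i -> (G i < H i)%N -> (forall k, (G k <= H k)%N) ->
  (\sum_(k | P k) G k < \sum_(k | P k) H k)%N.
Proof.
move=> Pi lt le; rewrite (bigD1 i) //= [X in (_ < X)%N](bigD1 i) //=.
by rewrite -addSn leq_add // leq_sum.
Qed.

Definition hgrade P Q (mu : int) : A -> Prop := supp (fun u S => hval P Q u S = mu).

Lemma hgrade_DeltaP P Q mu f : hgrade P Q mu f -> hgrade P Q (mu - 2) (DeltaP P Q f).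
Proof.
apply: DeltaP_supp => u S i Pi.
  by move=> u0; rewrite hval_up_u //; lia.
by move=> lS rS; rewrite hval_pairs_up //; lia.
Qed.

Lemma hgrade_etaP P Q mu f : hgrade P Q mu f -> hgrade P Q (mu + 2) (etaP P Q f).
Proof.
apply: etaP_supp => u S i Pi.
  by move=> u0; rewrite hval_dn_u //; lia.
by move=> lS rS; rewrite hval_pairs_dn //; lia.
Qed.

Lemma hgrade_hP P Q mu f : hgrade P Q mu f -> hP P Q f = mu%:~R *: f.
Proof.
move=> Wf; apply: cf_inj => u S; rewrite cf_hP cfZ.
by case: (eqVneq (cf f u S) 0) => [->|/Wf ->]; rewrite ?mulr0.
Qed.

Lemma hgrade_commutator P Q mu f : hgrade P Q mu f ->
  DeltaP P Q (etaP P Q f) = etaP P Q (DeltaP P Q f) + mu%:~R *: f.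
Proof. by move=> Wf; rewrite DeltaP_etaP (hgrade_hP Wf). Qed.

Lemma supp_false f : supp (fun _ _ => False) f -> f = 0.
Proof.
by move=> Mf; apply: cf_inj => u S; rewrite cf0; apply/eqP/negPn/negP => /Mf.
Qed.

(** Each term consumes a y_i with i in P or a theta pair with index in Q, so [phi] strictly
    decreases. *)
Lemma DeltaP_nilpotent P Q f : exists K, iter K (DeltaP P Q) f = 0.
Proof.
pose phi u S := (\sum_(i | P i) u (rshift m i)
  + \sum_(j | Q j) ((lshift n j \in S) + (rshift n j \in S)))%N.
have [K] := supp_bounded phi f; elim: K f => [|K IH] f Kf.
  by exists 0%N; apply: supp_false => u S /Kf.
have [|K' K'f] := IH (DeltaP P Q f); last by exists K'.+1; rewrite iterSr.
apply: DeltaP_supp Kf => u S i Pi.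
  move=> u0; rewrite ltnS; apply: leq_trans; rewrite /phi ltn_add2r.
  apply: (ltn_sum_at Pi) => [|k]; rewrite up_uR; last exact: leq_addr.
  by rewrite eqxx addn1.
move=> /negPf lS /negPf rS; rewrite ltnS; apply: leq_trans; rewrite /phi ltn_add2l.
apply: (ltn_sum_at Pi) => [|k]; rewrite pairs_upL pairs_upR.
  by rewrite eqxx lS rS.
by case: eqP; case: (_ \in S); case: (_ \in S).
Qed.

(** Each term consumes an x_i or fills in two missing thetas; [phi] counts the x-factors and the
    missing thetas. *)
Lemma etaP_nilpotent P Q f : exists K, iter K (etaP P Q) f = 0.
Proof.
pose phi u S := (\sum_(i | P i) u (lshift m i)
  + \sum_(j | Q j) ((lshift n j \notin S) + (rshift n j \notin S)))%N.
have [K] := supp_bounded phi f; elim: K f => [|K IH] f Kf.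
  by exists 0%N; apply: supp_false => u S /Kf.
have [|K' K'f] := IH (etaP P Q f); last by exists K'.+1; rewrite iterSr.
apply: etaP_supp Kf => u S i Pi.
  move=> u0; rewrite ltnS; apply: leq_trans; rewrite /phi ltn_add2r.
  apply: (ltn_sum_at Pi) => [|k]; rewrite dn_uL; last exact: leq_addr.
  by rewrite eqxx addn1.
move=> lS rS; rewrite ltnS; apply: leq_trans; rewrite /phi ltn_add2l.
apply: (ltn_sum_at Pi) => [|k]; rewrite pairs_dnL pairs_dnR.
  by rewrite eqxx lS rS.
by case: eqP; case: (_ \in S); case: (_ \in S).
Qed.

(** The component [g] of f in a fixed weight is again in the kernel. Since [etaP] is locally
    nilpotent, [iter_lowering_inj] with N = 1 makes [DeltaP] injective in positive weights. *)
Lemma DeltaP_ker_weight P Q f : DeltaP P Q f = 0 ->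
  supp (fun u S => hval P Q u S <= 0) f.
Proof.
move=> Df u S nz; rewrite leNgt; apply/negP => mu_gt0.
set mu := hval P Q u S in mu_gt0.
pose g := res (fun u S => hval P Q u S == mu) f.
have Dg : DeltaP P Q g = 0.
  rewrite (@DeltaP_res _ _ _ (fun u S => hval P Q u S == mu - 2)) ?Df.
  - by apply: cf_inj => v T; rewrite cf_res cf0 if_same.
  - by move=> v T i Pi v0; rewrite hval_up_u //; lia.
  by move=> v T j Qj lT rT; rewrite hval_pairs_up //; lia.
have Wg : hgrade P Q mu g.
  by move=> v T; rewrite cf_res; case: ifP => [/eqP|]; rewrite ?eqxx.
have [K etaK] := etaP_nilpotent P Q g.
have g0 : g = 0.
  apply: (@iter_lowering_inj _ _ (hgrade P Q) (DeltaP P Q) (etaP P Q) _ _ _ K mu 1%N) => //.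
  - exact: hgrade_DeltaP.
  - exact: hgrade_etaP.
  - exact: hgrade_commutator.
by have := cf_res (fun u S => hval P Q u S == mu) f u S; rewrite -/g g0 eqxx cf0 => /esym/eqP; rewrite (negPf nz).
Qed.

End Grading.

(** * Subspaces and spans *)

Section Spans.
Variables (F : fieldType) (V : lmodType F).
Implicit Types (B W : V -> Prop).

Lemma subspaceZ W c v : subspace W -> W v -> W (c *: v).
Proof. by move=> [W0 WL] Wv; rewrite -[_ *: _]addr0; apply: WL. Qed.

Lemma subspaceD W u v : subspace W -> W u -> W v -> W (u + v).
Proof. by move=> [_ WL] Wu Wv; rewrite -[u]scale1r; apply: WL. Qed.

Lemma subspaceN W v : subspace W -> W v -> W (- v).
Proof. by move=> sW Wv; rewrite -scaleN1r; apply: subspaceZ. Qed.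

Lemma subspaceB W u v : subspace W -> W u -> W v -> W (u - v).
Proof. by move=> sW Wu Wv; apply: subspaceD => //; apply: subspaceN. Qed.

Lemma subspace_sum W (I : Type) (r : seq I) (P : pred I) (G : I -> V) :
  subspace W -> (forall i, P i -> W (G i)) -> W (\sum_(i <- r | P i) G i).
Proof.
move=> sW WG; elim/big_ind: _ => //; first exact: sW.1.
by move=> u v; apply: subspaceD.
Qed.

Lemma in_span_subspace B : subspace (in_span B).
Proof.
split.
  exists 0%N, (fun _ => 0), (fun _ => 0); split; first by case.
  by rewrite big_ord0.
move=> a u v [M [c [b [Bb ->]]]] [N [d [e [Be ->]]]].
exists (M + N)%N, (fun i => match split i with inl i => a * c i | inr i => d i end),
  (fun i => match split i with inl i => b i | inr i => e i end); split.
  by move=> t; case: (split t).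
rewrite big_split_ord /= scaler_sumr; congr (_ + _); apply: eq_bigr => i _.
  by rewrite (unsplitK (inl i)) scalerA.
by rewrite (unsplitK (inr i)).
Qed.

Lemma in_span_incl B v : B v -> in_span B v.
Proof.
move=> Bv; exists 1%N, (fun _ => 1), (fun _ => v); split=> //.
by rewrite big_ord1 scale1r.
Qed.

Lemma in_span_min B W v : subspace W -> (forall u, B u -> W u) -> in_span B v -> W v.
Proof.
move=> sW BW [N [c [b [Bb ->]]]]; apply: subspace_sum => // i _.
by apply: subspaceZ => //; apply: BW.
Qed.

End Spans.

(** * The spaces A_k in terms of monomials *)

Section Degree.
Variables (F : numFieldType) (m n : nat).
Local Notation A := (spoly F (m + m) (n + n)).
Implicit Types (f g : A) (u v : 'X_{1..m + m}) (S : {set 'I_(n + n)}).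

Lemma cfM_neq0 f g u S : cf (f * g) u S != 0 ->
  exists v w (T : {set 'I_(n + n)}), [/\ u = (v + w)%MM, T \subset S, cf f v T != 0 & cf g w (S :\: T) != 0].
Proof.
rewrite {1}/cf ffunE linear_sum /= => /sum_neq0[T TS].
rewrite -mulrA signME mulf_eq0 negb_or => /andP[_].
rewrite -mcoeff_msupp => /msuppM_le /allpairsP[[v w] /= [vf wg ->]].
by exists v, w, T; rewrite /cf -!mcoeff_msupp.
Qed.

Definition kdeg u S : int :=
  #|S|%:Z - \sum_(i < m) (u (lshift m i))%:Z + \sum_(i < m) (u (rshift m i))%:Z.

Definition kgrade (k : int) : A -> Prop := supp (fun u S => kdeg u S = k).

Lemma kgradeM k l f g : kgrade k f -> kgrade l g -> kgrade (k + l) (f * g).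
Proof.
move=> kf lg u S /cfM_neq0[v [w [T [-> TS /kf <- /lg <-]]]].
rewrite /kdeg -(cardsID T S) (setIidPr TS).
have e (h : 'I_m -> 'I_(m + m)) : \sum_(i < m) ((v + w)%MM (h i))%:Z =
    \sum_(i < m) (v (h i))%:Z + \sum_(i < m) (w (h i))%:Z.
  by rewrite -big_split; apply: eq_bigr => i _; rewrite mnmDE.
by rewrite !e; lia.
Qed.

Lemma kgrade_subspace k : subspace (kgrade k).
Proof. exact: supp_subspace. Qed.

Lemma kgrade_emon u S : kgrade (kdeg u S) (emon F u S).
Proof.
by move=> v T; rewrite cf_emon; case: (u =P v) => [<-|_]; case: (T =P S) => [->|_]; rewrite ?eqxx.
Qed.

Lemma emon1 : emon F 0 set0 = 1 :> A.
Proof.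
by apply/ffunP => S; rewrite !ffunE mpolyX0; case: eqP.
Qed.

Lemma xvar_emon i u S : xvar F (n + n) i * emon F u S = emon F (u + U_(i)) S.
Proof.
apply/ffunP => T; rewrite xvarME !ffunE; case: eqP => _; last by rewrite mulr0.
by rewrite -mpolyXD addmC.
Qed.

Lemma theta_emon p u S : theta F (m + m) p * emon F u S =
  if p \in S then 0 else msgn F p S *: emon F u (p |: S).
Proof.
apply: cf_inj => v T; rewrite cf_thetaM cf_emon; case: ifPn => pT.
  case: ifPn => pS.
    rewrite cf0 (_ : T :\ p == S = false) ?andbF ?mulr0 //.
    by apply: contraTF pS => /eqP <-; rewrite !inE eqxx.
  rewrite cfZ cf_emon; case: eqVneq => [_|]; rewrite ?mulr0 // !andTb.
  have -> : (T == p |: S) = (T :\ p == S).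
    by apply/eqP/eqP => [->|<-]; rewrite ?setU1K ?setD1K.
  case: eqVneq => [<-|]; rewrite ?mulr0 //.
  by rewrite msgnD1.
case: ifPn => pS; rewrite ?cf0 // cfZ cf_emon (_ : T == _ = false) ?andbF ?mulr0 //.
by apply: contraNF pT => /eqP ->; rewrite !inE eqxx.
Qed.

(** Reordering anticommuting factors costs only a sign, recorded as an unspecified nonzero
    scalar. *)
Lemma emonS_theta (s : seq 'I_(n + n)) : uniq s -> exists2 c : F, c != 0 &
  \prod_(p <- s) theta F (m + m) p = c *: emon F 0 [set p in s].
Proof.
elim: s => [_|p s IH /= /andP[ps us]].
  by exists 1; rewrite ?oner_neq0 // big_nil scale1r set_nil -emon1.
have [c c0 e] := IH us => {IH}; exists (c * msgn F p [set p in s]).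
  by rewrite mulf_neq0 ?msgn_neq0.
by rewrite big_cons e -scalerAr theta_emon !inE (negPf ps) scalerA set_cons.
Qed.

Lemma prod_xvar_emon (r : seq 'I_(m + m)) (al : 'I_(m + m) -> nat) v S :
  (\prod_(i <- r) xvar F (n + n) i ^+ al i) * emon F v S =
  emon F (v + \sum_(i <- r) (U_(i) *+ al i))%MM S.
Proof.
elim: r v => [|i r IH] v; first by rewrite !big_nil mul1r addm0.
rewrite !big_cons -mulrA IH [(U_(i) *+ _ + _)%MM]addmC addmA; move: (v + _)%MM => w {v IH}.
elim: (al i) => [|c IH]; first by rewrite expr0 mul1r mulm0n addm0.
by rewrite exprS -mulrA IH xvar_emon mulmS -addmA [(U_(i) + _)%MM]addmC.
Qed.

Lemma kgrade1 : kgrade 0 1.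
Proof.
rewrite -emon1 (_ : 0 = kdeg 0 set0); first exact: kgrade_emon.
by rewrite /kdeg cards0 !big1 // => i _; rewrite mnm0E.
Qed.

Lemma kgrade_theta p : kgrade 1 (theta F (m + m) p).
Proof.
rewrite -[theta _ _ _]mulr1 -emon1 theta_emon inE setU0 /=.
rewrite (_ : 1 = kdeg 0 [set p]); first by apply: (subspaceZ _ (kgrade_subspace _)); exact: kgrade_emon.
by rewrite /kdeg cards1 !big1 // => i _; rewrite mnm0E.
Qed.

(** Replaces the span by a condition on supports. Repetitions in [ps] make the product vanish, but
    multiplicativity of the grading covers that case too. *)
Lemma AkE k f : Ak k f <-> kgrade k f.
Proof.
split.
  apply: in_span_min; first exact: kgrade_subspace.
  move=> _ [al [ps [_ <- ->]]]; rewrite -addrA addrC; apply: kgradeM; last first.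
    elim: ps => [|p ps IH]; first by rewrite big_nil; apply: kgrade1.
    by rewrite big_cons (PoszD 1 (size ps)); apply: kgradeM => //; apply: kgrade_theta.
  have := prod_xvar_emon (index_enum _) al 0 set0.
  rewrite emon1 mulr1 => ->; rewrite add0m.
  set u := (\sum_(i <- _) _)%MM; have uE i : u i = al i.
    rewrite /u mnm_sumE (bigD1 i) //= mulmnE mnm1E eqxx mul1n big1 ?addn0 // => j.
    by rewrite mulmnE mnm1E => /negPf ->.
  have -> : - (\sum_(i < m) (al (lshift m i))%:Z) + \sum_(i < m) (al (rshift m i))%:Z
      = kdeg u set0.
    rewrite /kdeg cards0 add0r; congr (- _ + _); apply: eq_bigr => i _; by rewrite uE.
  exact: kgrade_emon.
move=> kf; rewrite (emonE f); apply: subspace_sum => [|S _]; first exact: in_span_subspace.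
apply: subspace_sum => [|u _]; first exact: in_span_subspace.
have [->|nz] := eqVneq (cf f u S) 0; first by rewrite scale0r; apply (in_span_subspace _).1.
have [c c0 e] := emonS_theta (enum_uniq (mem S)).
have kE : [set p in enum S] = S by apply/setP => p; rewrite inE mem_enum.
rewrite kE in e.
have -> : cf f u S *: emon F u S = (cf f u S / c) *:
   (\prod_(i < m + m) xvar F (n + n) i ^+ u i * \prod_(p <- enum S) theta F (m + m) p).
  rewrite e -scalerAr scalerA divfK // prod_xvar_emon add0m.
  by congr (_ *: emon F _ S); rewrite [LHS]multinomUE_id.
apply: subspaceZ; first exact: in_span_subspace.
apply: in_span_incl; exists u, (enum S); split=> //.
  by rewrite -cardE (leq_trans (max_card _)) // card_ord.
by rewrite -cardE; exact: kf nz.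
Qed.

End Degree.

(** * Decomposition of A_k into harmonics and the image of eta *)

Section DirectSum.
Variables (F : numFieldType) (m n : nat).
Local Notation A := (spoly F (m + m) (n + n)).
Implicit Types (f g : A) (u v : 'X_{1..m + m}) (S : {set 'I_(n + n)}).

Lemma card_pairs S : #|S| = (\sum_(j < n) ((lshift n j \in S) + (rshift n j \in S)))%N.
Proof. by rewrite -sum1_card big_mkcond big_split_ord big_split. Qed.

Lemma hvalT u S : hval predT predT u S = kdeg u S - n%:Z.
Proof.
rewrite /hval /kdeg card_pairs (big_morph Posz PoszD (erefl _)).
have -> : \sum_(j < n) ((lshift n j \in S)%:Z + (rshift n j \in S)%:Z - 1) =
    \sum_(j < n) ((lshift n j \in S) + (rshift n j \in S))%:Z - n%:Z.
  by rewrite sumrB sumr_const card_ord natz.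
by rewrite sumrB; ring.
Qed.

Lemma kgrade_hgrade k f : kgrade k f <-> hgrade predT predT (k - n%:Z) f.
Proof. by split=> kf u S /kf; rewrite hvalT; lia. Qed.

Lemma Hk_subspace k : subspace (@Hk F m n k).
Proof.
split; first by split; [apply: (in_span_subspace _).1 | rewrite DeltaPT linear0].
move=> c f g [Af Df] [Ag Dg]; split; first by apply: (in_span_subspace _).2.
by rewrite DeltaPT linearP /= -!DeltaPT Df Dg scaler0 addr0.
Qed.

Theorem Ak_direct_sum k : k <= n%:Z ->
  direct_sum_of (@Ak F m n k) (Hk k) (etaAk (k - 2)).
Proof.
move=> kn; have neg : k - 2 - n%:Z < 0 by lia.
have comm mu f : hgrade predT predT mu f ->
    @DeltaP F m n predT predT (etaP predT predT f)
      = etaP predT predT (DeltaP predT predT f) + mu%:~R *: f.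
  exact: hgrade_commutator.
split=> [w|u [_ Du] [g /AkE/kgrade_hgrade kg uE]]; last first.
  (* For eta g in the kernel, Delta (eta g) = 0 forces g = 0, as g has the negative weight k - 2 -
     n. *)
  have [K DK] := @DeltaP_nilpotent F m n predT predT g.
  rewrite uE (_ : g = 0) ?etaPT ?linear0 //.
  apply: (lowering_raising_inj (@hgrade_DeltaP F m n _ _) comm kg neg DK).
  by rewrite /= -etaPT -DeltaPT -uE.
split=> [/AkE/kgrade_hgrade kw|[u1 [u2 [[Au _] [g /AkE kg ->] ->]]]]; last first.
  apply/AkE; apply: (subspaceD (@kgrade_subspace F m n k)); first exact/AkE.
  rewrite (_ : k = k - 2 + 2); last by lia.
  by apply/kgrade_hgrade; rewrite addrAC; apply/hgrade_etaP/kgrade_hgrade.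
(* Delta w has weight k - 2 - n < 0, so it equals Delta (eta g) for some g of that weight. *)
have kDw : hgrade predT predT (k - 2 - n%:Z) (DeltaP predT predT w).
  by rewrite addrAC; apply: hgrade_DeltaP.
have [K DK] := @DeltaP_nilpotent F m n predT predT (DeltaP predT predT w).
have [g kg gE] := lowering_raising_surj (W := hgrade predT predT) (fun mu => @supp_subspace F m n _)
  (@hgrade_DeltaP F m n _ _) (@hgrade_etaP F m n _ _) comm kDw neg DK.
have Ag : Ak (k - 2) g by apply/AkE/kgrade_hgrade.
exists (w - eta g), (eta g); split; [|by exists g|by rewrite subrK].
split; last by rewrite DeltaPT linearB /= -gE subrr.
apply/AkE; apply: (subspaceB (@kgrade_subspace F m n k)).
  exact/kgrade_hgrade.
rewrite (_ : k = k - 2 + 2); last by lia.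
by apply/kgrade_hgrade; rewrite addrAC; apply/hgrade_etaP.
Qed.

End DirectSum.

(** * The action of osp and the contravariant form *)

Section Generators.
Variables (F : numFieldType) (m n : nat).
Local Notation A := (spoly F (m + m) (n + n)).
Local Notation G := 'M[F]_(m + m + (n + n)).
Local Notation ixL := (@ixL m n).
Local Notation ixR := (@ixR m n).
Local Notation ithL := (@ithL m n).
Local Notation ithR := (@ithR m n).
Local Notation Emx := (@Emx F m n).
Local Notation xl i := (xL F n i).
Local Notation xr i := (xR F n i).
Local Notation tl j := (thL F m j).
Local Notation tr j := (thR F m j).
Local Notation dl i := (@dx F _ _ (lshift m i)).
Local Notation dr i := (@dx F _ _ (rshift m i)).
Local Notation el j := (@dtheta F _ _ (lshift n j)).
Local Notation er j := (@dtheta F _ _ (rshift n j)).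
Implicit Types (f g : A).

(** One family per independent block of the matrices in osp; the remaining blocks are determined by
    these. *)
Inductive osp_gen :=
  | GenP of 'I_m & 'I_m | GenB of 'I_m & 'I_m | GenC of 'I_m & 'I_m
  | GenH of 'I_m & 'I_n | GenH1 of 'I_m & 'I_n
  | GenK of 'I_m & 'I_n | GenK1 of 'I_m & 'I_n
  | GenD of 'I_n & 'I_n | GenE of 'I_n & 'I_n | GenF of 'I_n & 'I_n.

Definition gen_mx (x : osp_gen) : G :=
  match x with
  | GenP i j => Emx (ixL i) (ixL j) - Emx (ixR j) (ixR i)
  | GenB i j => Emx (ixL i) (ixR j) - Emx (ixL j) (ixR i)
  | GenC i j => Emx (ixR i) (ixL j) - Emx (ixR j) (ixL i)
  | GenH i q => Emx (ixL i) (ithL q) - Emx (ithR q) (ixR i)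
  | GenH1 i q => Emx (ixL i) (ithR q) + Emx (ithL q) (ixR i)
  | GenK i q => Emx (ixR i) (ithL q) - Emx (ithR q) (ixL i)
  | GenK1 i q => Emx (ixR i) (ithR q) + Emx (ithL q) (ixL i)
  | GenD p q => Emx (ithL p) (ithL q) - Emx (ithR q) (ithR p)
  | GenE p q => Emx (ithL p) (ithR q) + Emx (ithL q) (ithR p)
  | GenF p q => Emx (ithR p) (ithL q) + Emx (ithR q) (ithL p)
  end.

Definition gen_op (x : osp_gen) f : A :=
  match x with
  | GenP i j => - (xl j * dl i f) - (i == j)%:R *: f - xr j * dr i f
  | GenB i j => dl i (dr j f) - dl j (dr i f)
  | GenC i j => xr j * (xl i * f) - xr i * (xl j * f)
  | GenH i q => dl i (el q f) - tr q * dr i f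
  | GenH1 i q => dl i (er q f) + tl q * dr i f
  | GenK i q => xr i * el q f + tr q * (xl i * f)
  | GenK1 i q => xr i * er q f - tl q * (xl i * f)
  | GenD p q => tl p * el q f - tr q * er p f
  | GenE p q => tl p * er q f + tl q * er p f
  | GenF p q => tr p * el q f + tr q * el p f
  end.

Lemma actionP c (g h : G) f : action (c *: g + h) f = c *: action g f + action h f.
Proof.
rewrite /action scaler_sumr -big_split; apply: eq_bigr => s _.
rewrite scaler_sumr -big_split; apply: eq_bigr => t _ /=.
by rewrite !mxE scalerDl scalerA.
Qed.

Lemma actionD (g h : G) f : action (g + h) f = action g f + action h f.
Proof. by rewrite -[g]scale1r actionP !scale1r. Qed.

Lemma actionN (g : G) f : action (- g) f = - action g f.
Proof.
rewrite /action -sumrN; apply: eq_bigr => s _; rewrite -sumrN; apply: eq_bigr => t _.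
by rewrite mxE scaleNr.
Qed.

Lemma action_Emx s t f : action (Emx s t) f = unit_action s t f.
Proof.
rewrite /action (bigD1 s) //= [X in _ + X]big1 ?addr0 => [|s' /negPf ns].
  rewrite (bigD1 t) //= big1 ?addr0 => [|t' /negPf nt].
    by rewrite mxE !eqxx scale1r.
  by rewrite mxE nt andbF scale0r.
by rewrite big1 // => t' _; rewrite mxE ns scale0r.
Qed.

Lemma split_lshift a b (i : 'I_a) : split (lshift b i) = inl i.
Proof. exact: (unsplitK (inl i)). Qed.

Lemma split_rshift a b (i : 'I_b) : split (rshift a i) = inr i.
Proof. exact: (unsplitK (inr i)). Qed.

Definition unit_actionE := (split_lshift, split_rshift).

Lemma action_gen x f : action (gen_mx x) f = gen_op x f.
Proof.
have lt (i : 'I_m) : (lshift m i < m)%N by rewrite /=.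
have nlt (i : 'I_m) : (rshift m i < m)%N = false by rewrite /= ltnNge leq_addr.
case: x => i j /=; rewrite actionD ?actionN !action_Emx /unit_action
  /ixL /ixR /ithL /ithR !unit_actionE ?lt ?nlt ?eq_lshift -?mulrA //.
  by rewrite opprK addrC.
by rewrite opprK.
Qed.

Lemma osp_gen_mx x : osp (gen_mx x).
Proof.
have Z a b : (0 : 'M[F]_(a, b))^T = 0 by rewrite trmx0.
have skew (i j : 'I_m) : delta_mx i j - delta_mx j i
    = - (delta_mx i j - delta_mx j i)^T :> 'M[F]_m.
  by rewrite linearB /= !trmx_delta opprB.
have sym (i j : 'I_n) : delta_mx i j + delta_mx j i
    = (delta_mx i j + delta_mx j i)^T :> 'M[F]_n.
  by rewrite linearD /= !trmx_delta addrC.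
case: x => i j;
  [ exists (delta_mx i j), 0, 0, 0, 0, 0, 0, 0, 0, 0
  | exists 0, (delta_mx i j - delta_mx j i), 0, 0, 0, 0, 0, 0, 0, 0
  | exists 0, 0, (delta_mx i j - delta_mx j i), 0, 0, 0, 0, 0, 0, 0
  | exists 0, 0, 0, (delta_mx i j), 0, 0, 0, 0, 0, 0
  | exists 0, 0, 0, 0, (delta_mx i j), 0, 0, 0, 0, 0
  | exists 0, 0, 0, 0, 0, (delta_mx i j), 0, 0, 0, 0
  | exists 0, 0, 0, 0, 0, 0, (delta_mx i j), 0, 0, 0
  | exists 0, 0, 0, 0, 0, 0, 0, (delta_mx i j), 0, 0
  | exists 0, 0, 0, 0, 0, 0, 0, 0, (delta_mx i j + delta_mx j i), 0
  | exists 0, 0, 0, 0, 0, 0, 0, 0, 0, (delta_mx i j + delta_mx j i) ];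
  split; rewrite ?Z ?oppr0 //.
all: apply/matrixP => s t; case: (split_ordP s) => s' ->; case: (split_ordP s') => s'' ->;
  case: (split_ordP t) => t' ->; case: (split_ordP t') => t'' ->;
  rewrite !(block_mxEul, block_mxEur, block_mxEdl, block_mxEdr) !mxE
    ?(eq_lshift, eq_rshift, eq_lrshift, eq_rlshift) /= ?andbF ?subr0 ?sub0r ?addr0 ?add0r ?oppr0 //.
all: by rewrite andbC.
Qed.

Lemma pair_sum p q (c : 'M[F]_(p, q)) (d : 'M[F]_(q, p)) (e : F)
    (U : 'I_p -> 'I_q -> A) (V : 'I_q -> 'I_p -> A) : d = e *: c^T ->
  \sum_i \sum_j c i j *: U i j + \sum_j \sum_i d j i *: V j i =
  \sum_i \sum_j c i j *: (U i j + e *: V j i).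
Proof.
move=> ->; rewrite [X in _ + X]exchange_big -big_split; apply: eq_bigr => i _ /=.
rewrite -big_split; apply: eq_bigr => j _ /=.
by rewrite !mxE scalerDr scalerA mulrC.
Qed.

(** In a skew or symmetric block the positions (i, j) and (j, i) carry the same generator up to
    sign, whence the factor one half. *)
Lemma sym_sum p (c : 'M[F]_p) (e : F) (U : 'I_p -> 'I_p -> A) : c = e *: c^T ->
  \sum_i \sum_j c i j *: U i j = \sum_i \sum_j (c i j / 2) *: (U i j + e *: U j i).
Proof.
move=> ce; have half : (2^-1 + 2^-1 : F) = 1 by field.
have := @pair_sum p p c c e U U ce => eq2.
transitivity (2^-1 *: (\sum_i \sum_j c i j *: U i j + \sum_i \sum_j c i j *: U i j)).
  by rewrite scalerDr -scalerDl half scale1r.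
rewrite eq2 scaler_sumr; apply: eq_bigr => i _; rewrite scaler_sumr.
by apply: eq_bigr => j _; rewrite scalerA mulrC.
Qed.

Definition block_action p q (c : 'M[F]_(p, q)) r t f : A :=
  \sum_i \sum_j c i j *: unit_action (r i) (t j) f.

Lemma block_action_block p1 p2 q1 q2 (a : 'M[F]_(p1, q1)) b c
    (d : 'M[F]_(p2, q2)) r t f :
  block_action (block_mx a b c d) r t f =
  (block_action a (r \o @lshift _ _) (t \o @lshift _ _) f +
   block_action b (r \o @lshift _ _) (t \o @rshift _ _) f) +
  (block_action c (r \o @rshift _ _) (t \o @lshift _ _) f +
   block_action d (r \o @rshift _ _) (t \o @rshift _ _) f).
Proof.
rewrite /block_action big_split_ord -!big_split /=; congr (_ + _); apply: eq_bigr => i _;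
  rewrite big_split_ord /=; congr (_ + _); apply: eq_bigr => j _;
  by rewrite ?(block_mxEul, block_mxEur, block_mxEdl, block_mxEdr).
Qed.

(** Reduces stability under osp to the ten families of [gen_op]. *)
Lemma action_osp (g : G) f : osp g ->
  in_span (fun h => exists x, h = gen_op x f) (action g f).
Proof.
move=> [P [B [C [H [H1 [K [K1 [D [E0 [F0 [Bs Cs Es Fs ->]]]]]]]]]]].
pose W := in_span (fun h => exists x, h = gen_op x f).
have sW : subspace W := in_span_subspace _.
have Wgen x : W (action (gen_mx x) f).
  by apply: in_span_incl; exists x; rewrite action_gen.
have W2 p q (c : 'M[F]_(p, q)) (x : 'I_p -> 'I_q -> osp_gen) (Y : 'I_p -> 'I_q -> A) :
    (forall i j, action (gen_mx (x i j)) f = Y i j) -> W (\sum_i \sum_j c i j *: Y i j).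
  move=> xY; apply: subspace_sum => // i _; apply: subspace_sum => // j _.
  by apply: subspaceZ => //; rewrite -xY.
have Wpair p q (c : 'M[F]_(p, q)) (d : 'M[F]_(q, p)) e r1 t1 r2 t2 (x : 'I_p -> 'I_q -> osp_gen) :
    d = e *: c^T -> (forall i j, gen_mx (x i j) = Emx (r1 i) (t1 j) + e *: Emx (r2 j) (t2 i)) ->
    W (block_action c r1 t1 f + block_action d r2 t2 f).
  move=> dc xE; rewrite /block_action (pair_sum _ _ dc); apply: (W2 _ _ _ x) => i j.
  by rewrite xE addrC actionP !action_Emx addrC.
have Wsym p (c : 'M[F]_p) e r t (x : 'I_p -> 'I_p -> osp_gen) :
    c = e *: c^T -> (forall i j, gen_mx (x i j) = Emx (r i) (t j) + e *: Emx (r j) (t i)) ->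
    W (block_action c r t f).
  move=> cc xE; rewrite /block_action (sym_sum _ cc).
  have -> : \sum_i \sum_j (c i j / 2) *: (unit_action (r i) (t j) f + e *: unit_action (r j) (t i) f)
    = \sum_i \sum_j (2^-1 *: c) i j *: action (gen_mx (x i j)) f.
    apply: eq_bigr => i _; apply: eq_bigr => j _.
    by rewrite xE [Emx _ _ + _]addrC actionP !action_Emx [unit_action _ _ f + _]addrC mxE mulrC.
  exact: (W2 _ _ _ x).
rewrite -/W -[action _ f]/(block_action _ id id f) !block_action_block.
(* The sixteen blocks are numbered as the nested splitting lists them. Each product a*b joins a
   block to the one it determines, such as H with - H^T; the single numbers 2, 3, 14, 15 are the
   skew and symmetric blocks. *)
rewrite [X in W X](AC (((2*2)*(2*2))*((2*2)*(2*2)))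
  ((1*4)*2*3*(5*12)*(6*10)*(7*11)*(8*9)*(13*16)*14*15)).
apply: (subspaceD sW); last by apply: (Wsym _ _ 1 _ _ GenF) => [|i j]; rewrite ?scale1r.
apply: (subspaceD sW); last by apply: (Wsym _ _ 1 _ _ GenE) => [|i j]; rewrite ?scale1r.
apply: (subspaceD sW); last by apply: (Wpair _ _ _ _ (-1) _ _ _ _ GenD) => [|i j]; rewrite ?scaleN1r.
apply: (subspaceD sW); last by apply: (Wpair _ _ _ _ 1 _ _ _ _ GenK1) => [|i j]; rewrite ?scale1r.
apply: (subspaceD sW); last by apply: (Wpair _ _ _ _ (-1) _ _ _ _ GenK) => [|i j]; rewrite ?scaleN1r.
apply: (subspaceD sW); last by apply: (Wpair _ _ _ _ 1 _ _ _ _ GenH1) => [|i j]; rewrite ?scale1r.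
apply: (subspaceD sW); last by apply: (Wpair _ _ _ _ (-1) _ _ _ _ GenH) => [|i j]; rewrite ?scaleN1r.
apply: (subspaceD sW); last by apply: (Wsym _ _ (-1) _ _ GenC) => [|i j]; rewrite ?scaleN1r.
apply: (subspaceD sW); last by apply: (Wsym _ _ (-1) _ _ GenB) => [|i j]; rewrite ?scaleN1r.
by apply: (Wpair _ _ _ _ (-1) _ _ _ _ GenP) => [|i j]; rewrite ?scaleN1r.
Qed.

End Generators.

(** * The Fischer form on polynomials *)

Section Form.
Variables (F : numFieldType) (N : nat).
Implicit Types (p q : {mpoly F[N]}) (u : 'X_{1..N}).

Definition mfact u : F := \prod_i (u i)`!%:R.

Lemma mfact_neq0 u : mfact u != 0.
Proof. by apply/prodf_neq0 => i _; rewrite pnatr_eq0 -lt0n fact_gt0. Qed.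

Lemma mfactD u i : mfact (u + U_(i))%MM = mfact u *+ (u i).+1.
Proof.
rewrite /mfact (bigD1 i) //= [in RHS](bigD1 i) //= mnmDE mnm1E eqxx addn1 factS.
rewrite natrM -mulrA mulr_natl; congr (_ * _ *+ _); apply: eq_bigr => j nj.
by rewrite mnmDE mnm1E eq_sym (negPf nj) addn0.
Qed.

(** The Fischer form: monomials are orthogonal and x^u has norm u!. It is bilinear, without complex
    conjugation, so nondegeneracy has to replace positivity. *)
Definition mform p q : F := \sum_(u <- msupp p) mfact u * p@_u * q@_u.

Lemma mform_seq (s : seq 'X_{1..N}) p q : uniq s -> {subset msupp p <= s} ->
  mform p q = \sum_(u <- s) mfact u * p@_u * q@_u.
Proof.
move=> us sub; rewrite (bigID (mem (msupp p))) /= [X in _ + X]big1 ?addr0; last first.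
  by move=> u; rewrite -mcoeff_eq0 => /eqP ->; rewrite mulr0 mul0r.
rewrite -big_filter; apply: perm_big; apply: uniq_perm; rewrite ?msupp_uniq ?filter_uniq //.
by move=> u; rewrite mem_filter; case: (boolP (u \in msupp p)) => // /sub ->.
Qed.

Lemma mformC p q : mform p q = mform q p.
Proof.
pose s := undup (msupp p ++ msupp q).
rewrite !(@mform_seq s) ?undup_uniq // => [|u|u]; first by apply: eq_bigr => u _; ring.
  by rewrite mem_undup mem_cat orbC => ->.
by rewrite mem_undup mem_cat => ->.
Qed.

Lemma mformDr p q1 q2 : mform p (q1 + q2) = mform p q1 + mform p q2.
Proof. by rewrite -big_split; apply: eq_bigr => u _; rewrite mcoeffD mulrDr. Qed.

Lemma mformZr p c q : mform p (c *: q) = c * mform p q.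
Proof. by rewrite mulr_sumr; apply: eq_bigr => u _; rewrite mcoeffZ; ring. Qed.

(** The factor u_i + 1 produced by differentiation is the quotient of the factorial norms of u + e_i
    and u. *)
Lemma mform_deriv i p q : mform ('X_i * p) q = mform p (q^`M(i)).
Proof.
rewrite mulrC /mform (perm_big _ (msuppMX _ _)) /= big_map; apply: eq_bigr => u _.
by rewrite mcoeffMX mcoeff_deriv addmC mfactD -!mulrA mulrnAl !mulrnAr.
Qed.

End Form.

(** * Invariance of H_k and the form on superpolynomials *)

Section OspModule.
Variables (F : numFieldType) (m n : nat).
Local Notation A := (spoly F (m + m) (n + n)).
Implicit Types (f g : A) (u v : 'X_{1..m + m}) (S : {set 'I_(n + n)}).

Lemma submodule_gen (W : A -> Prop) : subspace W ->
  (forall (x : osp_gen m n) f, W f -> W (gen_op x f)) -> submodule W.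
Proof.
move=> sW Wx; split=> // g f /action_osp osp_g Wf.
by apply: in_span_min (osp_g f) => // _ [x ->]; apply: Wx.
Qed.

Lemma submodule_op (W : A -> Prop) (x : osp_gen m n) f :
  submodule W -> W f -> W (gen_op x f).
Proof. by move=> [_ Wg] Wf; rewrite -action_gen; apply/Wg/Wf/osp_gen_mx. Qed.

(** Moving [Delta] inward past variables and derivatives leaves correction terms that cancel in
    pairs. This commutation makes the kernel of [Delta] stable under osp. *)
Lemma Delta_gen_op (x : osp_gen m n) f : Delta (gen_op x f) = gen_op x (Delta f).
Proof.
have := @DeltaP_dtheta F m n predT predT; have := @DeltaP_thR F m n predT predT.
have := @DeltaP_thL F m n predT predT; have := @DeltaP_dxR F m n predT predT.
have := @DeltaP_dxL F m n predT predT; have := @DeltaP_xR F m n predT predT.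
have := @DeltaP_xL F m n predT predT.
have : forall c g, DeltaP predT predT (c *: g) = c *: DeltaP predT predT g :> A.
  by move=> c g; rewrite linearZ.
have : forall g, DeltaP predT predT (- g) = - DeltaP predT predT g :> A.
  by move=> g; rewrite linearN.
have : forall g h, DeltaP predT predT (g + h) = DeltaP predT predT g + DeltaP predT predT h :> A.
  by move=> g h; rewrite linearD.
rewrite /= !DeltaPT.
move: (DeltaP _ _) => D DD DN DZ DxL DxR DdL DdR DtL DtR Dt.
case: x => i j; rewrite /= !(DD, DN, DZ) ?(DxL, DxR, DdL, DdR, DtL, DtR, Dt)
  ?(DxL, DxR, DdL, DdR, DtL, DtR, Dt) ?scale1r ?mulrDr ?dx_dtheta ?dtheta_xvarM.
(* In the families B, C, D, E, F the two correction terms cancel only after two commuting or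
   anticommuting operators are put in the same order. *)
2: rewrite [dx (rshift m i) (dx (rshift m j) f)]dx_dx.
3: rewrite [xL F n j * (xL F n i * f)]xvarCA.
8: rewrite [dtheta (rshift n i) (dtheta (lshift n j) f)]dtheta_dtheta.
9: rewrite [dtheta (rshift n i) (dtheta (rshift n j) f)]dtheta_dtheta.
10: rewrite [dtheta (lshift n i) (dtheta (lshift n j) f)]dtheta_dtheta.
all: by apply: cf_inj => u S; rewrite !(cfD, cfN, cfZ); ring.
Qed.

Lemma kdeg_addL u S i : kdeg (u + U_(lshift m i)) S = kdeg u S - 1.
Proof.
rewrite /kdeg (@sum_bump _ _ _ i (fun k => ((u + U_(lshift m i))%MM (lshift m k))%:Z)
  (fun k => (u (lshift m k))%:Z) 1) //.
- rewrite [X in _ + X](_ : _ = \sum_(k < m) (u (rshift m k))%:Z); first by ring.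
  by apply: eq_bigr => k _; rewrite mnmDE mnm1E eq_lrshift addn0.
- by rewrite mnmDE mnm1E eqxx PoszD.
by move=> k /negPf nk; rewrite mnmDE mnm1E eq_lshift eq_sym nk addn0.
Qed.

Lemma kdeg_addR u S i : kdeg (u + U_(rshift m i)) S = kdeg u S + 1.
Proof.
rewrite /kdeg (@sum_bump _ _ _ i (fun k => ((u + U_(rshift m i))%MM (rshift m k))%:Z)
  (fun k => (u (rshift m k))%:Z) 1) //.
- rewrite [X in _ - X](_ : _ = \sum_(k < m) (u (lshift m k))%:Z); first by ring.
  by apply: eq_bigr => k _; rewrite mnmDE mnm1E eq_rlshift addn0.
- by rewrite mnmDE mnm1E eqxx PoszD.
by move=> k /negPf nk; rewrite mnmDE mnm1E eq_rshift eq_sym nk addn0.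
Qed.

Lemma kgrade_xL (i : 'I_m) : kgrade (- 1) (xL F n i : A).
Proof.
rewrite -[xL F n i]mulr1 -emon1 xvar_emon.
suff <- : kdeg (0 + U_(lshift m i))%MM (set0 : {set 'I_(n + n)}) = - 1 by apply: kgrade_emon.
by rewrite kdeg_addL /kdeg cards0 !big1 // => j _; rewrite mnm0E.
Qed.

Lemma kgrade_xR (i : 'I_m) : kgrade 1 (xR F n i : A).
Proof.
rewrite -[xR F n i]mulr1 -emon1 xvar_emon.
suff <- : kdeg (0 + U_(rshift m i))%MM (set0 : {set 'I_(n + n)}) = 1 by apply: kgrade_emon.
by rewrite kdeg_addR /kdeg cards0 !big1 // => j _; rewrite mnm0E.
Qed.

Lemma kgrade_dxL k i f : kgrade k f -> kgrade (k + 1) (dx (lshift m i) f).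
Proof.
move=> kf u S; rewrite cf_dx; case: (eqVneq (cf f (u + U_(lshift m i))%MM S) 0).
  by move=> ->; rewrite mul0rn eqxx.
by move/kf; rewrite kdeg_addL => <- _; rewrite subrK.
Qed.

Lemma kgrade_dxR k i f : kgrade k f -> kgrade (k - 1) (dx (rshift m i) f).
Proof.
move=> kf u S; rewrite cf_dx; case: (eqVneq (cf f (u + U_(rshift m i))%MM S) 0).
  by move=> ->; rewrite mul0rn eqxx.
by move/kf; rewrite kdeg_addR => <- _; rewrite addrK.
Qed.

Lemma kgrade_dtheta k p f : kgrade k f -> kgrade (k - 1) (dtheta p f).
Proof.
move=> kf u S; rewrite cf_dtheta; case: ifPn => [|pS]; first by rewrite eqxx.
rewrite mulf_eq0 negb_or => /andP[_ /kf]; rewrite /kdeg cardsU1 pS => <-.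
by rewrite addnC PoszD /=; ring.
Qed.

Lemma kgrade_gen_op k (x : osp_gen m n) f : kgrade k f -> kgrade k (gen_op x f).
Proof.
move=> kf; have sB := subspaceB (@kgrade_subspace F m n k).
have sD := subspaceD (@kgrade_subspace F m n k).
have H l g : kgrade l g -> l = k -> kgrade k g by move=> ? <-.
have gxL i : kgrade (- 1) (xL F n i : A) by exact: kgrade_xL.
have gxR i : kgrade 1 (xR F n i : A) by exact: kgrade_xR.
have gdL l i g : kgrade l g -> kgrade (l + 1) (dx (lshift m i) g : A).
  exact: kgrade_dxL.
have dL i : kgrade (k + 1) (dx (lshift m i) f) by exact: gdL.
have dR i : kgrade (k - 1) (dx (rshift m i) f) by exact: kgrade_dxR.
have xf i := kgradeM (gxL i) kf.
have dt p : kgrade (k - 1) (dtheta p f) by exact: kgrade_dtheta.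
have th p : kgrade 1 (theta F (m + m) p : A) by exact: kgrade_theta.
case: x => i j /=.
- apply: (sB); last by apply: (H _ _ (kgradeM (gxR j) (dR i))); ring.
  apply: (sB); last exact: (subspaceZ _ (@kgrade_subspace F m n k) kf).
  apply: (subspaceN (@kgrade_subspace F m n k)).
  by apply: (H _ _ (kgradeM (gxL j) (dL i))); ring.
- apply: (sB); first by apply: (H _ _ (gdL _ i _ (dR j))); ring.
  by apply: (H _ _ (gdL _ j _ (dR i))); ring.
- apply: (sB); first by apply: (H _ _ (kgradeM (gxR j) (xf i))); ring.
  by apply: (H _ _ (kgradeM (gxR i) (xf j))); ring.
- apply: (sB); first by apply: (H _ _ (gdL _ i _ (dt _))); ring.
  by apply: (H _ _ (kgradeM (th _) (dR i))); ring.
- apply: (sD); first by apply: (H _ _ (gdL _ i _ (dt _))); ring.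
  by apply: (H _ _ (kgradeM (th _) (dR i))); ring.
- apply: (sD); first by apply: (H _ _ (kgradeM (gxR i) (dt _))); ring.
  by apply: (H _ _ (kgradeM (th _) (xf i))); ring.
- apply: (sB); first by apply: (H _ _ (kgradeM (gxR i) (dt _))); ring.
  by apply: (H _ _ (kgradeM (th _) (xf i))); ring.
- by apply: (sB); apply: (H _ _ (kgradeM (th _) (dt _))); ring.
- by apply: (sD); apply: (H _ _ (kgradeM (th _) (dt _))); ring.
- by apply: (sD); apply: (H _ _ (kgradeM (th _) (dt _))); ring.
Qed.

Lemma Hk_submodule k : submodule (@Hk F m n k).
Proof.
apply: submodule_gen => [|x f [/AkE kf Df]]; first exact: Hk_subspace.
split; first by apply/AkE/kgrade_gen_op.
rewrite Delta_gen_op Df; case: x => i j /=; rewrite ?linear0 ?mulr0 ?linear0 ?scaler0;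
  by rewrite ?mulr0 ?(subr0, addr0, oppr0, linear0).
Qed.

(** The Fischer form extended by making the theta_S orthonormal. It detects every coefficient by
    [sform_emon]. *)
Definition sform f g : F := \sum_S mform (f S) (g S).

Lemma sformC f g : sform f g = sform g f.
Proof. by apply: eq_bigr => S _; apply: mformC. Qed.

Lemma sformDr f g h : sform f (g + h) = sform f g + sform f h.
Proof. by rewrite -big_split; apply: eq_bigr => S _; rewrite ffunE mformDr. Qed.

Lemma sformZr f c g : sform f (c *: g) = c * sform f g.
Proof. by rewrite mulr_sumr; apply: eq_bigr => S _; rewrite ffunE mformZr. Qed.

Lemma sformNr f g : sform f (- g) = - sform f g.
Proof. by rewrite -scaleN1r sformZr mulN1r. Qed.

Lemma sformDl f g h : sform (f + g) h = sform f h + sform g h.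
Proof. by rewrite !(sformC _ h) sformDr. Qed.

Lemma sformZl c f g : sform (c *: f) g = c * sform f g.
Proof. by rewrite !(sformC _ g) sformZr. Qed.

Lemma sformNl f g : sform (- f) g = - sform f g.
Proof. by rewrite !(sformC _ g) sformNr. Qed.

Lemma sform0r f : sform f 0 = 0.
Proof. by rewrite -(scale0r (0 : A)) sformZr mul0r. Qed.

Lemma sform_suml I (r : seq I) (P : pred I) (G : I -> A) g :
  sform (\sum_(i <- r | P i) G i) g = \sum_(i <- r | P i) sform (G i) g.
Proof.
elim/big_ind2: _ => [|x1 x2 y1 y2 <- <-|] //; first by rewrite sformC sform0r.
exact: sformDl.
Qed.

Lemma sform_sumr I (r : seq I) (P : pred I) (G : I -> A) f :
  sform f (\sum_(i <- r | P i) G i) = \sum_(i <- r | P i) sform f (G i).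
Proof. by rewrite sformC sform_suml; apply: eq_bigr => i _; rewrite sformC. Qed.

Lemma sform_emon f u S : sform f (emon F u S) = mfact F u * cf f u S.
Proof.
rewrite sformC /sform (bigD1 S) //= big1 ?addr0 => [|T /negPf nT].
  by rewrite ffunE eqxx /mform msuppX big_seq1 mcoeffX eqxx mulr1.
by rewrite ffunE nT /mform msupp0 big_nil.
Qed.

Lemma sform_xvar i f g : sform (xvar F (n + n) i * f) g = sform f (dx i g).
Proof. by apply: eq_bigr => S _; rewrite xvarME ffunE mform_deriv. Qed.

Lemma sform_dx i f g : sform (dx i f) g = sform f (xvar F (n + n) i * g).
Proof. by rewrite sformC -sform_xvar sformC. Qed.

Lemma sform_theta p f g : sform (theta F (m + m) p * f) g = sform f (dtheta p g).
Proof.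
have mform0l q : @mform F (m + m) 0 q = 0 by rewrite /mform msupp0 big_nil.
have mform0r q : @mform F (m + m) q 0 = 0 by rewrite mformC.
have signr q1 (c : nat) q2 : @mform F (m + m) q1 ((-1) ^+ c * q2) = (-1) ^+ c * mform q1 q2.
  rewrite /mform mulr_sumr; apply: eq_bigr => u _; rewrite signME; ring.
rewrite /sform (bigID (fun S => p \in S)) /= [X in _ + X]big1 ?addr0 => [|S /negPf pS]; last first.
  by rewrite thetaME pS.
rewrite [RHS](bigID (fun S => p \in S)) /= [X in X + _]big1 ?add0r => [|S pS]; last first.
  by rewrite ffunE pS.
(* Sets containing p correspond to sets avoiding it, and both operators carry the same sign on
   corresponding sets. *)
rewrite (reindex_onto (fun T => p |: T) (fun S => S :\ p)) /=; last first.
  by move=> S pS; rewrite setD1K.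
apply: eq_big => [T|T /andP[_ /eqP TE]].
  rewrite !inE eqxx /=; apply/eqP/idP => [<-|pT]; last by rewrite setU1K.
  by rewrite !inE eqxx.
have pT : p \notin T by rewrite -TE !inE eqxx.
rewrite thetaME !inE eqxx /= TE ffunE (negPf pT) mformC !signr mformC.
by have := msgnU1 F p T; rewrite /msgn => ->.
Qed.

Lemma sform_dtheta p f g : sform (dtheta p f) g = sform f (theta F (m + m) p * g).
Proof. by rewrite sformC -sform_theta sformC. Qed.

(** On the x-part the minus sign is the one in [Delta]; on the theta-part it comes from the reversal
    of theta_j and theta_(n+j) under adjunction. *)
Lemma sform_Delta f g : sform (Delta f) g = - sform f (eta g).
Proof.
rewrite /Delta /eta sformDl sformNl sformDr !sform_suml !sform_sumr opprD -!sumrN.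
congr (_ + _); apply: eq_bigr => i _; first by rewrite sform_xvar sform_dx.
by rewrite !sform_dtheta -mulrA theta_thetaM sformNr.
Qed.

End OspModule.

(** * Contravariance of the form *)

Section Adjoint.
Variables (F : numFieldType) (m n : nat).
Local Notation A := (spoly F (m + m) (n + n)).
Implicit Types (f g : A).

(** Adjunction is a transpose of osp up to signs: the indices of P and of D are swapped, while B and
    C, H and K1, H1 and K, E and F are exchanged. *)
Lemma gen_op_adjoint (x : osp_gen m n) : exists (c : F) (y : osp_gen m n),
  forall f g, sform (gen_op x f) g = c * sform f (gen_op y g).
Proof.
have xl i f g : sform (xL F n i * f) g = sform f (dx (lshift m i) g).
  exact: sform_xvar.
have xr i f g : sform (xR F n i * f) g = sform f (dx (rshift m i) g).
  exact: sform_xvar.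
have dl i f g : sform (dx (lshift m i) f) g = sform f (xL F n i * g).
  exact: sform_dx.
have dr i f g : sform (dx (rshift m i) f) g = sform f (xR F n i * g).
  exact: sform_dx.
have tl j f g : sform (thL F m j * f) g = sform f (dtheta (lshift n j) g).
  exact: sform_theta.
have tr j f g : sform (thR F m j * f) g = sform f (dtheta (rshift n j) g).
  exact: sform_theta.
have el j f g : sform (dtheta (lshift n j) f) g = sform f (thL F m j * g).
  exact: sform_dtheta.
have er j f g : sform (dtheta (rshift n j) f) g = sform f (thR F m j * g).
  exact: sform_dtheta.
have xlCA i f g : f * (xL F n i * g) = xL F n i * (f * g) by exact: xvarCA.
case: x => i j.
- exists 1, (GenP n j i) => f g.
  rewrite /= mul1r sformDl sformDl 2!sformNl sformNl sformZl xl dl xr dr.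
  by rewrite [in RHS]sformDr sformDr 3!sformNr sformZr eq_sym.
- exists 1, (GenC n i j) => f g.
  by rewrite /= mul1r sformDl sformNl dl dr dl dr sformDr sformNr.
- exists 1, (GenB n i j) => f g.
  by rewrite /= mul1r sformDl sformNl xr xl xr xl [in RHS]sformDr sformNr.
- exists (- 1), (GenK1 i j) => f g.
  rewrite /= mulN1r sformDl sformNl dl el tr dr [in RHS]sformDr sformNr xlCA.
  by rewrite opprD opprK addrC.
- exists 1, (GenK i j) => f g.
  by rewrite /= mul1r sformDl dl er tl dr [in RHS]sformDr xlCA addrC.
- exists 1, (GenH1 i j) => f g.
  by rewrite /= mul1r sformDl xr el tr xl [in RHS]sformDr dx_dtheta addrC.
- exists (- 1), (GenH i j) => f g.
  rewrite /= mulN1r sformDl sformNl xr er tl xl [in RHS]sformDr sformNr dx_dtheta.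
  by rewrite opprD opprK addrC.
- exists 1, (GenD m j i) => f g.
  by rewrite /= mul1r sformDl sformNl tl el tr er [in RHS]sformDr sformNr.
- exists 1, (GenF m i j) => f g.
  by rewrite /= mul1r sformDl tl er tl er [in RHS]sformDr addrC.
- exists 1, (GenE m i j) => f g.
  by rewrite /= mul1r sformDl tr el tr el [in RHS]sformDr addrC.
Qed.

End Adjoint.

(** * Leading monomials *)

Section IndexData.
Variables m n : nat.
Implicit Types (d : index_data m n) (u : 'X_{1..m + m}) (S : {set 'I_(n + n)}).

(** The left-hand side of the first condition of I: the number of factors of h that involve the pair
    theta_t, theta_(n+t). *)
Definition site d (t : 'I_n) : nat :=
  (idx_l d (lshift n t) + idx_l d (rshift n t) + ll_at d t + s_at d t)%N.

(** The conditions of I with vanishing products recast as order relations between the indices of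
    factors that are present. *)
Record good d : Prop := Good {
  g_kk_lt : forall i j : 'I_m, (0 < idx_kk d (i, j))%N -> (i < j)%N;
  g_ll_lt : forall i j : 'I_n, idx_ll d (i, j) -> (i < j)%N;
  g_site : forall t, (site d t <= 1)%N;
  g_kk_k : forall i j t : 'I_m, (0 < idx_kk d (i, j))%N -> (0 < idx_k d t)%N -> (t <= j)%N;
  g_kk_kk : forall i j i' j' : 'I_m, (0 < idx_kk d (i, j))%N ->
    (0 < idx_kk d (i', j'))%N -> (i' < i)%N -> (j' <= j)%N;
  g_k_ll : forall (t : 'I_m) (i j : 'I_n), (0 < idx_k d t)%N -> ~~ idx_ll d (i, j);
  g_k_s : forall (t p : 'I_m) (q : 'I_n),
    (0 < idx_k d t)%N -> idx_s d (p, q) -> (p <= t)%N;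
  g_kk_s : forall (i j p : 'I_m) (q : 'I_n),
    (0 < idx_kk d (i, j))%N -> idx_s d (p, q) -> (p <= j)%N;
  g_s_s : forall (p p' : 'I_m) (q q' : 'I_n),
    idx_s d (p, q) -> idx_s d (p', q') -> (p' < p)%N -> (q' <= q)%N;
  g_gap : forall i j t : 'I_n, (i < t)%N -> (t < j)%N -> site d t = 0%N ->
    ~~ idx_ll d (i, j);
  g_ll_ll : forall i j i' j' : 'I_n, idx_ll d (i, j) -> idx_ll d (i', j') ->
    (i < i')%N -> (i' < j)%N -> (j' <= j)%N;
  g_ll_s : forall (i j q : 'I_n) (p : 'I_m),
    idx_ll d (i, j) -> idx_s d (p, q) -> (q <= j)%N }.

Lemma mul_bool_eq0 (a b : bool) : (a * b = 0)%N <-> (a -> ~~ b).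
Proof. by case: a; case: b; split=> //= H; have := H isT. Qed.

Lemma muln_bool_eq0 (a : nat) (b : bool) : (a * b = 0)%N <-> ((0 < a)%N -> ~~ b).
Proof.
by case: a b => [|a] [] //=; split=> //= H; rewrite ?muln0 //; have := H isT.
Qed.

Lemma site_eq0 d t : site d t = 0%N <->
  [/\ nat_of_bool (idx_l d (lshift n t)) = 0%N, nat_of_bool (idx_l d (rshift n t)) = 0%N,
      s_at d t = 0%N & ll_at d t = 0%N].
Proof. by rewrite /site; split=> [H|[-> -> -> ->] //]; split; lia. Qed.

Lemma in_IP d : in_I d <-> good d.
Proof.
split.
  case=> [[k0 l0]] st [kkk kkkk] [kll ks] [kks ss gap llll lls]; split=> //.
  - by move=> i j; apply: contraTT => /k0 ->.
  - by move=> i j; apply: contraTT => /l0; case: (idx_ll d _).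
  - move=> i j t H1 H2; rewrite leqNgt; apply/negP => lt.
    have := kkk i j t _ lt; case: (ltnP i j) => [_ /(_ isT)|le]; first by nia.
    by rewrite k0 -?leqNgt in H1.
  - move=> i j i' j' H1 H2 lt; rewrite leqNgt; apply/negP => lt2.
    have ij : (i < j)%N by apply: contraTT H1 => /k0 ->.
    have ij' : (i' < j')%N by apply: contraTT H2 => /k0 ->.
    by have := kkkk i j i' j' ij ij' lt lt2; nia.
  - move=> t i j H1; case: (ltnP i j) => [lt|]; last first.
      by rewrite leqNgt => /l0; case: (idx_ll d _).
    by apply/muln_bool_eq0: H1; apply: kll.
  - move=> t p q H1 H2; rewrite leqNgt; apply/negP => lt.
    by have := ks t p q lt; rewrite H2 muln1; lia.
  - move=> i j p q H1 H2; rewrite leqNgt; apply/negP => lt.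
    have ij : (i < j)%N by apply: contraTT H1 => /k0 ->.
    by have := kks i j p q ij lt; rewrite H2 muln1; lia.
  - move=> p p' q q' H1 H2 lt; rewrite leqNgt; apply/negP => lt2.
    by have := ss p p' q q' lt lt2; rewrite H1 H2.
  - move=> i j t lt1 lt2 /site_eq0[H1 H2 H3 H4].
    by have := gap i j t lt1 lt2 H1 H2 H3 H4; case: (idx_ll d _).
  - move=> i j i' j' H1 H2 lt1 lt2; rewrite leqNgt; apply/negP => lt3.
    by have := llll i j i' j' lt1 lt2 lt3; rewrite H1 H2.
  - move=> i j q p H1 H2; rewrite leqNgt; apply/negP => lt.
    have ij : (i < j)%N by apply: contraTT H1 => /l0; case: (idx_ll d _).
    by have := lls i j q p ij lt; rewrite H1 H2.
case=> k0 l0 st kkk kkkk kll ks kks ss gap llll lls; split=> //.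
- split=> i j; first by apply: contraNeq; rewrite -lt0n; apply: k0.
  by apply: contraNeq; rewrite eqb0 negbK; apply: l0.
- split=> [i j t _ lt|i j i' j' _ _ lt1 lt2].
    apply/eqP; rewrite -leqn0 leqNgt muln_gt0; apply/negP => /andP[H1 H2].
    by have := kkk i j t H1 H2; rewrite leqNgt lt.
  apply/eqP; rewrite -leqn0 leqNgt muln_gt0; apply/negP => /andP[H1 H2].
  by have := kkkk _ _ _ _ H1 H2 lt1; rewrite leqNgt lt2.
- split=> [t i j _|t p q lt]; first by apply/muln_bool_eq0 => H; apply: kll H.
  apply/muln_bool_eq0 => H; apply/negP => H2.
  by have := ks _ _ _ H H2; rewrite leqNgt lt.
- split.
  + move=> i j p q _ lt; apply/muln_bool_eq0 => H; apply/negP => H2.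
    by have := kks _ _ _ _ H H2; rewrite leqNgt lt.
  + move=> p p' q q' lt1 lt2; apply/mul_bool_eq0 => H; apply/negP => H2.
    by have := ss _ _ _ _ H H2 lt1; rewrite leqNgt lt2.
  + move=> i j t lt1 lt2 H1 H2 H3 H4; apply/eqP; rewrite eqb0; apply: gap lt1 lt2 _.
    exact/site_eq0.
  + move=> i j i' j' lt1 lt2 lt3; apply/mul_bool_eq0 => H; apply/negP => H2.
    by have := llll _ _ _ _ H H2 lt1 lt2; rewrite leqNgt lt3.
  + move=> i j q p _ lt; apply/mul_bool_eq0 => H; apply/negP => H2.
    by have := lls _ _ _ _ H H2; rewrite leqNgt lt.
Qed.

Definition fupd (T : finType) (R : Type) (f : {ffun T -> R}) (a : T) (c : R) :
  {ffun T -> R} := [ffun x => if x == a then c else f x].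

Lemma fupdE (T : finType) (R : Type) (f : {ffun T -> R}) a c x :
  fupd f a c x = if x == a then c else f x.
Proof. by rewrite ffunE. Qed.

Definition upd_kk d ij c :=
  IndexData (idx_k d) (fupd (idx_kk d) ij c) (idx_l d) (idx_ll d) (idx_s d).
Definition upd_l d p c :=
  IndexData (idx_k d) (idx_kk d) (fupd (idx_l d) p c) (idx_ll d) (idx_s d).
Definition upd_ll d ij c :=
  IndexData (idx_k d) (idx_kk d) (idx_l d) (fupd (idx_ll d) ij c) (idx_s d).
Definition upd_s d pq c :=
  IndexData (idx_k d) (idx_kk d) (idx_l d) (idx_ll d) (fupd (idx_s d) pq c).

Definition pair_of (p : 'I_(n + n)) : 'I_n :=
  match split p with inl q => q | inr q => q end.

(** Holds when the leading monomial takes the pair theta_t theta_(n+t) from an ll- or s-factor. *)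
Definition is_top d (t : 'I_n) : bool :=
  [exists i, idx_ll d (i, t)] || [exists p, idx_s d (p, t)].

(* The monomials obtained from h by choosing - x_j y_i from x_i y_j - x_j y_i,  *)
(* theta_j theta_(n+j) from the l_ij-factors and x_p theta_q theta_(n+q) from   *)
(* the s_pq-factors.                                                            *)
Definition lead_u d : 'X_{1..m + m} :=
  [multinom match split i with
   | inl t => (idx_k d t + \sum_i idx_kk d (i, t) + \sum_q idx_s d (t, q))%N
   | inr t => (\sum_j idx_kk d (t, j))%N end | i < m + m].

Definition lead_S d : {set 'I_(n + n)} :=
  [set p | idx_l d p || is_top d (pair_of p)].

Lemma lead_uL d t : lead_u d (lshift m t) =
  (idx_k d t + \sum_i idx_kk d (i, t) + \sum_q idx_s d (t, q))%N.
Proof. by rewrite mnmE split_lshift. Qed.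

Lemma lead_uR d t : lead_u d (rshift m t) = (\sum_j idx_kk d (t, j))%N.
Proof. by rewrite mnmE split_rshift. Qed.

Lemma lead_SL d t : (lshift n t \in lead_S d) = idx_l d (lshift n t) || is_top d t.
Proof. by rewrite inE /pair_of split_lshift. Qed.

Lemma lead_SR d t : (rshift n t \in lead_S d) = idx_l d (rshift n t) || is_top d t.
Proof. by rewrite inE /pair_of split_rshift. Qed.

Lemma sum_le1_at (T : finType) (P : pred T) (f : T -> nat) a :
  P a -> (f a <= \sum_(x | P x) f x)%N.
Proof. by move=> Pa; rewrite (bigD1 a) //= leq_addr. Qed.

Lemma s_at_gt0 d p q : idx_s d (p, q) -> (0 < s_at d q)%N.
Proof. by move=> H; apply: leq_trans (sum_le1_at _ (erefl : predT p)); rewrite H. Qed.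

Lemma ll_at_gt0L d i j : idx_ll d (i, j) -> (i < j)%N -> (0 < ll_at d i)%N.
Proof.
move=> H lt; apply: leq_trans (leq_addl _ _).
by apply: leq_trans (@sum_le1_at _ _ (fun j => nat_of_bool (idx_ll d (i, j))) j lt); rewrite H.
Qed.

Lemma ll_at_gt0R d i j : idx_ll d (i, j) -> (i < j)%N -> (0 < ll_at d j)%N.
Proof.
move=> H lt; apply: leq_trans (leq_addr _ _).
by apply: leq_trans (@sum_le1_at _ _ (fun i => nat_of_bool (idx_ll d (i, j))) i lt); rewrite H.
Qed.

Lemma top_site d t : good d -> is_top d t ->
  (idx_l d (lshift n t) = false) * (idx_l d (rshift n t) = false).
Proof.
move=> gd top; have := g_site gd t; rewrite /site.
have : (0 < ll_at d t + s_at d t)%N.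
  case/orP: top => /existsP[x H]; rewrite addn_gt0.
    by rewrite (ll_at_gt0R H) ?(g_ll_lt gd H).
  by rewrite (s_at_gt0 H) orbT.
by move=> pos le; split; apply/negbTE/negP => H; move: le pos; rewrite H; lia.
Qed.

End IndexData.

(** * Adding and removing one minor *)

Section Steps.
Variables m n : nat.
Implicit Types (d e : index_data m n) (u : 'X_{1..m + m}) (S : {set 'I_(n + n)}).

Lemma sumn_at (T : finType) (P : pred T) a (f g : T -> nat) c :
  (forall x, f x = g x + (x == a) * c)%N ->
  (\sum_(x | P x) f x = \sum_(x | P x) g x + P a * c)%N.
Proof.
move=> fg; rewrite (eq_bigr _ (fun x _ => fg x)) big_split /=; congr (_ + _)%N.
rewrite big_mkcond (bigD1 a) //= eqxx big1 ?addn0 => [|x /negPf ->]; last by rewrite if_same.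
by case: (P a); rewrite ?mul1n.
Qed.

Lemma index_data_eq d e : idx_k d =1 idx_k e -> idx_kk d =1 idx_kk e ->
  idx_l d =1 idx_l e -> idx_ll d =1 idx_ll e -> idx_s d =1 idx_s e -> d = e.
Proof.
case: d e => [k kk l ll s] [k' kk' l' ll' s'] /= *.
by congr IndexData; apply/ffunP.
Qed.

Definition both S (t : 'I_n) := (lshift n t \in S) && (rshift n t \in S).
Definition none S (t : 'I_n) := (lshift n t \notin S) && (rshift n t \notin S).

Lemma l_site d p : good d -> idx_l d p ->
  [/\ ll_at d (pair_of p) = 0%N, s_at d (pair_of p) = 0%N,
      forall i, idx_ll d (i, pair_of p) = false,
      forall j, idx_ll d (pair_of p, j) = false &
      forall q, idx_s d (q, pair_of p) = false].
Proof.
move=> gd lp; have := g_site gd (pair_of p); set t := pair_of p; rewrite /site => le.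
have lt : (0 < idx_l d (lshift n t) + idx_l d (rshift n t))%N.
  rewrite /t /pair_of; case: (split_ordP p) lp => q ->; rewrite ?split_lshift ?split_rshift => ->.
    by [].
  by rewrite addn1.
have l0 : ll_at d t = 0%N by lia.
have s0 : s_at d t = 0%N by lia.
split=> // [i|j|q]; apply/negbTE/negP => H.
- by have := ll_at_gt0R H (g_ll_lt gd H); rewrite l0.
- by have := ll_at_gt0L H (g_ll_lt gd H); rewrite l0.
by have := s_at_gt0 H; rewrite s0.
Qed.

(** Two separate l-factors cannot fill a pair, because [g_site] allows one factor per site. *)
Lemma both_lead d t : good d -> both (lead_S d) t = is_top d t.
Proof.
move=> gd; rewrite /both lead_SL lead_SR -orb_andl.
case: (boolP (is_top d t)) => _; rewrite ?orbT // orbF.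
apply/negbTE/negP => /andP[H H'].
by have := g_site gd t; rewrite /site H H' !addSn.
Qed.

Lemma none_lead d t :
  none (lead_S d) t = [&& ~~ idx_l d (lshift n t), ~~ idx_l d (rshift n t) & ~~ is_top d t].
Proof.
rewrite /none lead_SL lead_SR.
by case: (idx_l d _); case: (idx_l d _); case: (is_top d t).
Qed.

Lemma site0_none d t : good d -> site d t = 0%N -> none (lead_S d) t.
Proof.
move=> gd /site_eq0[H1 H2 H3 H4]; rewrite none_lead.
case: (idx_l d _) H1 => // _; case: (idx_l d _) H2 => // _ /=.
rewrite negb_or !negb_exists; apply/andP; split; apply/forallP => x; apply/negP => H.
  by have := ll_at_gt0R H (g_ll_lt gd H); rewrite H4.
by have := s_at_gt0 H; rewrite H3.
Qed.

(* On leading monomials: [addkk] multiplies by x_j y_i, [l2s] by                *)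
(* x_p theta_(n+q), and [l2ll] trades theta_i for theta_j.                      *)
Definition addkk e (i j : 'I_m) := upd_kk e (i, j) (idx_kk e (i, j)).+1.
Definition l2s e (p : 'I_m) (q : 'I_n) :=
  upd_s (upd_l e (lshift n q) false) (p, q) true.
Definition l2ll e (i j : 'I_n) :=
  upd_ll (upd_l (upd_l e (lshift n i) false) (rshift n j) false) (i, j) true.

Lemma lead_u_addkk e i j :
  lead_u (addkk e i j) = (lead_u e + U_(rshift m i) + U_(lshift m j))%MM.
Proof.
apply/mnmP => x; rewrite !mnmDE !mnm1E; case: (split_ordP x) => t ->.
  rewrite !lead_uL eq_rlshift eq_lshift addn0 /=.
  rewrite (@sumn_at _ _ i _ (fun i' => idx_kk e (i', t)) (j == t)); first by rewrite mul1n addnA addnAC.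
  move=> i'; rewrite fupdE xpair_eqE; case: eqVneq => [->|_] /=; last by rewrite addn0.
  by rewrite mul1n eq_sym; case: eqVneq => [->|_]; rewrite ?addn1 ?addn0.
rewrite !lead_uR eq_lrshift eq_rshift addn0 /=.
rewrite (@sumn_at _ _ j _ (fun i' => idx_kk e (t, i')) (i == t)); first by rewrite mul1n.
move=> i'; rewrite fupdE xpair_eqE andbC; case: eqVneq => [->|_] /=; last by rewrite addn0.
by rewrite mul1n eq_sym; case: eqVneq => [->|_]; rewrite ?addn1 ?addn0.
Qed.

Lemma lead_S_addkk e i j : lead_S (addkk e i j) = lead_S e.
Proof. by []. Qed.

Lemma lead_uR_gt0 d i : (0 < lead_u d (rshift m i))%N -> exists j, (0 < idx_kk d (i, j))%N.
Proof.
rewrite lead_uR => H; apply/existsP; apply: contraLR H.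
rewrite negb_exists => /forallP H; rewrite big1 // => j _.
by apply/eqP; have := H j; rewrite -eqn0Ngt.
Qed.

Lemma kk_lead_uR d i j : (0 < idx_kk d (i, j))%N -> (0 < lead_u d (rshift m i))%N.
Proof. by move=> H; rewrite lead_uR (bigD1 j) //= addn_gt0 H. Qed.

Lemma kk_lead_uL d i j : (0 < idx_kk d (i, j))%N -> (0 < lead_u d (lshift m j))%N.
Proof. by move=> H; rewrite lead_uL (bigD1 i) //= !addn_gt0 H orbT. Qed.

Lemma k_lead_uL d t : (0 < idx_k d t)%N -> (0 < lead_u d (lshift m t))%N.
Proof. by move=> H; rewrite lead_uL !addn_gt0 H. Qed.

Lemma s_lead_uL d p q : idx_s d (p, q) -> (0 < lead_u d (lshift m p))%N.
Proof. by move=> H; rewrite lead_uL addn_gt0 orbC (bigD1 q) //= H. Qed.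

Lemma lead_uL_gt0 d t : (0 < lead_u d (lshift m t))%N ->
  [\/ (0 < idx_k d t)%N, exists i, (0 < idx_kk d (i, t))%N | exists q, idx_s d (t, q)].
Proof.
rewrite lead_uL !addn_gt0 -orbA => /or3P[H|H|H]; first by apply: Or31.
  apply: Or32; apply/existsP; apply: contraLR H.
  rewrite negb_exists => /forallP H; rewrite big1 // => j _.
  by apply/eqP; have := H j; rewrite -eqn0Ngt.
apply: Or33; apply/existsP; apply: contraLR H.
rewrite negb_exists => /forallP H; rewrite big1 // => j _.
by have := H j; case: (idx_s d _).
Qed.

Section AddKK.
Variables (e : index_data m n) (i j : 'I_m).
Hypothesis ij : (i < j)%N.
Let d := addkk e i j.

Lemma kk_addkk a b : idx_kk d (a, b) = (idx_kk e (a, b) + ((a, b) == (i, j)))%N.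
Proof. by rewrite /= fupdE; case: eqP => [->|_]; rewrite ?addn1 ?addn0. Qed.

Lemma kk_addkk_gt0 a b : (0 < idx_kk d (a, b))%N ->
  (a = i /\ b = j) \/ (0 < idx_kk e (a, b))%N.
Proof.
rewrite kk_addkk addn_gt0 => /orP[|]; first by right.
by case: eqP => [[-> ->]|//]; left.
Qed.

(** With i and j at least as large as all y- and x-indices already present, the new minor crosses
    nothing. *)
Lemma good_addkk : good e ->
  (forall a, (0 < lead_u e (rshift m a))%N -> (a <= i)%N) ->
  (forall a, (0 < lead_u e (lshift m a))%N -> (a <= j)%N) -> good d.
Proof.
move=> [H1 H2 H3 H4 H5 H6 H7 H8 H9 H10 H11 H12] ui uj; split=> //.
- by move=> a b /kk_addkk_gt0[[-> ->]|/H1].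
- move=> a b t /kk_addkk_gt0[[_ ->]|]; last exact: H4.
  by move=> H; apply: uj; apply: (@k_lead_uL e).
- move=> a b a' b' /kk_addkk_gt0[[-> ->]|K] /kk_addkk_gt0[[-> ->]|K'] //.
  + by move=> _; apply: uj; apply: (kk_lead_uL K').
  + by move=> lt; have := ui _ (kk_lead_uR K); rewrite leqNgt lt.
  exact: H5 K K'.
move=> a b p q /kk_addkk_gt0[[_ ->]|]; last exact: H8.
by move=> H; apply: uj; apply: (@s_lead_uL e _ q).
Qed.

Lemma good_addkk_inv : good d -> good e.
Proof.
have mono a b : (0 < idx_kk e (a, b))%N -> (0 < idx_kk d (a, b))%N.
  by move=> H; rewrite kk_addkk addn_gt0 H.
move=> [H1 H2 H3 H4 H5 H6 H7 H8 H9 H10 H11 H12]; split=> //.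
- by move=> a b /mono/H1.
- by move=> a b t /mono/H4; apply.
- by move=> a b a' b' /mono K /mono; apply: H5 K.
by move=> a b p q /mono/H8; apply.
Qed.

End AddKK.

(** The largest y-index i and the largest x-index j must lie in one minor. Otherwise y_i sits in a
    minor (i, j') with j' < j, and any factor supplying x_j, other than the minor (i, j) itself,
    violates a condition of I against it. *)
Lemma addkk_split d i j : good d ->
  (0 < lead_u d (rshift m i))%N -> (forall a, (0 < lead_u d (rshift m a))%N -> (a <= i)%N) ->
  (0 < lead_u d (lshift m j))%N -> (forall a, (0 < lead_u d (lshift m a))%N -> (a <= j)%N) ->
  exists2 e, d = addkk e i j & good e.
Proof.
move=> gd ri ui lj uj; have [j' kij'] := lead_uR_gt0 ri.
have kij : (0 < idx_kk d (i, j))%N.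
  have := uj _ (kk_lead_uL kij'); rewrite leq_eqVlt => /orP[/eqP/val_inj <- //|lt].
  have [Hk|[i' Hk]|[q Hs]] := lead_uL_gt0 lj.
  - by have := g_kk_k gd kij' Hk; rewrite leqNgt lt.
  - have := ui _ (kk_lead_uR Hk); rewrite leq_eqVlt => /orP[/eqP/val_inj <- //|lt'].
    by have := g_kk_kk gd kij' Hk lt'; rewrite leqNgt lt.
  by have := g_kk_s gd kij' Hs; rewrite leqNgt lt.
pose e := upd_kk d (i, j) (idx_kk d (i, j)).-1.
have de : d = addkk e i j.
  apply: index_data_eq => //= -[a b]; rewrite !fupdE eqxx prednK //.
  by case: eqP => // ->.
exists e => //; apply: (@good_addkk_inv e i j); rewrite -de //.
Qed.

End Steps.

(** * Exchanging an l-factor for an s-factor *)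

Section LToS.
Variables (m n : nat) (e : index_data m n) (p : 'I_m) (q : 'I_n).
Let d := l2s e p q.

Hypothesis lq : idx_l e (lshift n q).

Section SiteB.
Hypothesis s0 : idx_s e (p, q) = false.

Lemma s_l2s a b : idx_s d (a, b) = ((a, b) == (p, q)) || idx_s e (a, b).
Proof. by rewrite /= fupdE; case: eqP. Qed.

Lemma s_l2sn a b :
  nat_of_bool (idx_s d (a, b)) = (idx_s e (a, b) + ((a == p) && (b == q)))%N.
Proof.
rewrite s_l2s xpair_eqE; case: eqP => [->|_]; case: eqP => [->|_]; rewrite ?addn0 //=.
by rewrite s0.
Qed.

Lemma lead_u_l2s : lead_u d = (lead_u e + U_(lshift m p))%MM.
Proof.
apply/mnmP => x; rewrite mnmDE mnm1E; case: (split_ordP x) => t ->; last first.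
  by rewrite !lead_uR eq_lrshift addn0.
rewrite !lead_uL eq_lshift.
rewrite (@sumn_at _ _ q _
  (fun b => nat_of_bool (idx_s e (t, b))) (p == t)); first by rewrite mul1n addnA.
by move=> b; rewrite s_l2sn andbC -mulnb [p == t]eq_sym.
Qed.

Lemma s_at_l2s t : s_at d t = (s_at e t + (t == q))%N.
Proof.
rewrite /s_at (@sumn_at _ _ p _
  (fun a => nat_of_bool (idx_s e (a, t))) (t == q)) ?mul1n //.
by move=> a; rewrite s_l2sn -mulnb.
Qed.

Lemma site_l2s t : site d t = site e t.
Proof.
rewrite /site s_at_l2s /= !fupdE eq_lshift eq_rlshift /ll_at /=.
by case: eqVneq => [->|_]; rewrite ?lq; lia.
Qed.

Lemma good_l2s_inv : good d -> good e.
Proof.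
have mono a b : idx_s e (a, b) -> idx_s d (a, b) by rewrite s_l2s orbC => ->.
move=> [H1 H2 H3 H4 H5 H6 H7 H8 H9 H10 H11 H12]; split=> //.
- by move=> t; rewrite -site_l2s.
- by move=> t a b /H7 K /mono; apply: K.
- by move=> a b a' b' /H8 K /mono; apply: K.
- by move=> a a' b b' /mono K /mono; apply: H9 K.
- by move=> i j t lt1 lt2; rewrite -site_l2s; apply: H10.
by move=> a b a' b' /H12 K /mono; apply: K.
Qed.

End SiteB.

Lemma is_top_l2s t : is_top d t = (t == q) || is_top e t.
Proof.
rewrite /is_top [RHS]orbCA; congr (_ || _); apply/existsP/orP => [[a]|[/eqP ->|/existsP[a H]]].
- rewrite s_l2s xpair_eqE => /orP[/andP[_ ->]|H]; [by left | by right; apply/existsP; exists a].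
- by exists p; rewrite s_l2s eqxx.
by exists a; rewrite s_l2s H orbT.
Qed.

Lemma lead_S_l2s : lead_S d = rshift n q |: lead_S e.
Proof.
apply/setP => x; rewrite in_setU1; case: (split_ordP x) => t ->.
  rewrite !lead_SL eq_lrshift is_top_l2s /= fupdE eq_lshift.
  by case: eqVneq => [->|_]; rewrite ?lq ?orbT.
by rewrite !lead_SR eq_rshift is_top_l2s /= fupdE eq_rlshift orbCA.
Qed.

Hypothesis ge : good e.

Lemma l2s_site_facts : [/\ ll_at e q = 0%N, s_at e q = 0%N,
  forall i, idx_ll e (i, q) = false, forall j, idx_ll e (q, j) = false &
  forall a, idx_s e (a, q) = false].
Proof. by have := l_site ge lq; rewrite /pair_of split_lshift. Qed.

Lemma rshift_lead_l2s : rshift n q \notin lead_S e.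
Proof.
have [_ _ H1 _ H2] := l2s_site_facts.
rewrite lead_SR negb_or; apply/andP; split.
  by have := g_site ge q; rewrite /site lq; case: (idx_l e (rshift n q)).
by rewrite negb_or !negb_exists; apply/andP; split; apply/forallP => a; rewrite ?H1 ?H2.
Qed.

(** Applies once no y is left. Minimality of p among the x-indices and of q among the full pairs
    keeps the new factor from crossing the old ones. *)
Lemma good_l2s :
  (forall i, lead_u e (rshift m i) = 0%N) ->
  (forall a, (0 < lead_u e (lshift m a))%N -> (p <= a)%N) ->
  (forall t, both (lead_S e) t -> (q <= t)%N) -> good d.
Proof.
move=> u0 up tq; have [_ _ _ _ /(_ p) s0] := l2s_site_facts; have [H1 H2 H3 H4 H5 H6 H7 H8 H9 H10 H11 H12] := ge.
have nokk a b : (0 < idx_kk d (a, b))%N -> False by move=> /(kk_lead_uR (d := e)); rewrite u0.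
have topq t : is_top e t -> (q <= t)%N by move=> H; apply: tq; rewrite both_lead.
have sq a b : idx_s e (a, b) -> (q <= b)%N.
  by move=> H; apply/topq/orP; right; apply/existsP; exists a.
split=> //.
- by move=> t; rewrite (site_l2s s0).
- move=> t a b Hk; rewrite s_l2s => /orP[/eqP[-> _]|]; last exact: H7 Hk.
  by apply: up; apply: (k_lead_uL (d := e)).
- by move=> a b a' b' /nokk.
- move=> a a' b b'; rewrite !s_l2s => /orP[/eqP[-> ->]|s1] /orP[/eqP[-> ->]|s2] //.
  + by move=> lt; have := up _ (s_lead_uL s2); rewrite leqNgt lt.
  + by move=> _; apply: sq s1.
  exact: H9 s1 s2.
- by move=> i j t lt1 lt2; rewrite (site_l2s s0); apply: H10.
move=> i j b a Hll; rewrite s_l2s => /orP[/eqP[_ ->]|]; last exact: H12 Hll.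
by apply/topq/orP; left; apply/existsP; exists i.
Qed.

End LToS.

(** * Exchanging two l-factors for an ll-factor *)

Section LToLL.
Variables (m n : nat) (e : index_data m n) (i j : 'I_n).
Let d := l2ll e i j.
Hypothesis ij : (i < j)%N.
Hypotheses (li : idx_l e (lshift n i)) (lj : idx_l e (rshift n j)).

Let nij : i != j. Proof. by rewrite neq_ltn ij. Qed.

Section SiteC.
Hypothesis ll0 : idx_ll e (i, j) = false.

Lemma ll_l2ll a b : idx_ll d (a, b) = ((a, b) == (i, j)) || idx_ll e (a, b).
Proof. by rewrite /= fupdE; case: eqP. Qed.

Lemma ll_l2lln a b :
  nat_of_bool (idx_ll d (a, b)) = (idx_ll e (a, b) + ((a == i) && (b == j)))%N.
Proof.
rewrite ll_l2ll xpair_eqE; case: eqP => [->|_]; case: eqP => [->|_]; rewrite ?addn0 //=.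
by rewrite ll0.
Qed.

Lemma ll_at_l2ll t : ll_at d t = (ll_at e t + (t == i) + (t == j))%N.
Proof.
rewrite /ll_at (@sumn_at _ _ i _
  (fun a => nat_of_bool (idx_ll e (a, t))) (t == j)); last first.
  by move=> a; rewrite ll_l2lln -mulnb.
rewrite [X in (_ + X)%N = _](@sumn_at _ _ j _
  (fun a => nat_of_bool (idx_ll e (t, a))) (t == i)); last first.
  by move=> a; rewrite ll_l2lln andbC -mulnb.
have -> : ((i < t) * (t == j) = (t == j))%N by case: eqVneq => [->|_]; rewrite ?ij ?muln0.
have -> : ((t < j) * (t == i) = (t == i))%N by case: eqVneq => [->|_]; rewrite ?ij ?muln0.
by rewrite addnACA [((t == j) + _)%N]addnC addnA.
Qed.

Lemma site_l2ll t : site d t = site e t.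
Proof.
have -> : site d t = (idx_l d (lshift n t) + idx_l d (rshift n t) + ll_at d t + s_at e t)%N.
  by [].
rewrite /site ll_at_l2ll /= !fupdE !eq_lshift !eq_rshift eq_lrshift eq_rlshift.
case: (eqVneq t i) => [->|_] /=; first by rewrite (negPf nij) li; lia.
by case: (eqVneq t j) => [->|_] /=; rewrite ?lj; lia.
Qed.

Lemma good_l2ll_inv : good d -> good e.
Proof.
have mono a b : idx_ll e (a, b) -> idx_ll d (a, b) by rewrite ll_l2ll orbC => ->.
move=> [H1 H2 H3 H4 H5 H6 H7 H8 H9 H10 H11 H12]; split=> //.
- by move=> a b /mono/H2.
- by move=> t; rewrite -site_l2ll.
- by move=> t a b /H6 K; apply: contra (K a b) => /mono.
- by move=> a b t lt1 lt2; rewrite -site_l2ll => /(H10 _ _ _ lt1 lt2); apply/contra/mono.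
- by move=> a b a' b' /mono K /mono; apply: H11 K.
by move=> a b a' b' /mono/H12; apply.
Qed.

End SiteC.

Lemma is_top_l2ll t : is_top d t = (t == j) || is_top e t.
Proof.
rewrite /is_top orbA; congr (_ || _); apply/existsP/orP => [[a]|[/eqP ->|/existsP[a H]]].
- rewrite ll_l2ll xpair_eqE => /orP[/andP[_ ->]|H]; [by left | by right; apply/existsP; exists a].
- by exists i; rewrite ll_l2ll eqxx.
by exists a; rewrite ll_l2ll H orbT.
Qed.

Hypothesis ge : good e.

Lemma l2ll_facts_i : [/\ ll_at e i = 0%N, s_at e i = 0%N,
  forall a, idx_ll e (a, i) = false, forall a, idx_ll e (i, a) = false &
  forall a, idx_s e (a, i) = false].
Proof. by have := l_site ge li; rewrite /pair_of split_lshift. Qed.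

Lemma l2ll_facts_j : [/\ ll_at e j = 0%N, s_at e j = 0%N,
  forall a, idx_ll e (a, j) = false, forall a, idx_ll e (j, a) = false &
  forall a, idx_s e (a, j) = false].
Proof. by have := l_site ge lj; rewrite /pair_of split_rshift. Qed.

Lemma top_e : (is_top e i = false) * (is_top e j = false).
Proof.
have [_ _ H1 _ H2] := l2ll_facts_i; have [_ _ H3 _ H4] := l2ll_facts_j.
split; apply/negbTE; rewrite negb_or !negb_exists;
  by apply/andP; split; apply/forallP => a; rewrite ?(H1, H2, H3, H4).
Qed.

Lemma lead_S_l2ll : lead_S d = lshift n j |: (lead_S e :\ lshift n i).
Proof.
apply/setP => x; rewrite in_setU1 in_setD1; case: (split_ordP x) => t ->.
  rewrite !lead_SL !eq_lshift is_top_l2ll /= !fupdE !eq_lrshift eq_lshift.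
  case: (eqVneq t i) => [->|_] /=; first by rewrite (negPf nij) top_e.
  by case: eqVneq => // ->; rewrite orbT.
rewrite !lead_SR !eq_rlshift is_top_l2ll /= !fupdE eq_rshift eq_rlshift.
by case: (eqVneq t j) => [->|] //=; rewrite lj.
Qed.

Lemma lead_S_l2ll_inv : lead_S e = lshift n i |: (lead_S d :\ lshift n j).
Proof.
rewrite lead_S_l2ll setU1K ?setD1K //; first by rewrite lead_SL li.
rewrite in_setD1 lead_SL top_e orbF negb_and; apply/orP; right.
by have := g_site ge j; rewrite /site lj; case: (idx_l e (lshift n j)); rewrite // !addSn.
Qed.

Lemma lead_u_l2ll : lead_u d = lead_u e. Proof. by []. Qed.

(** Applies once no x or y is left. As no empty site lies strictly between i and j, the new factor
    spans no gap and crosses no other ll-factor. *)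
Lemma good_l2ll : (forall x, lead_u e x = 0%N) ->
  (forall t, both (lead_S e) t -> (j <= t)%N) ->
  (forall t : 'I_n, (t < j)%N -> none (lead_S e) t -> (t <= i)%N) -> good d.
Proof.
move=> u0 tj ti; have [_ _ _ /(_ j) ll0 _] := l2ll_facts_i; have [H1 H2 H3 H4 H5 H6 H7 H8 H9 H10 H11 H12] := ge.
have nokk a b : (0 < idx_kk d (a, b))%N -> False by move=> /(kk_lead_uR (d := e)); rewrite u0.
have nok t : (0 < idx_k d t)%N -> False by move=> /(k_lead_uL (d := e)); rewrite u0.
have nos a b : idx_s d (a, b) -> False by move=> /(s_lead_uL (d := e)); rewrite u0.
have topj t : is_top e t -> (j <= t)%N by move=> H; apply: tj; rewrite both_lead.
split=> //.
- by move=> a b; rewrite ll_l2ll => /orP[/eqP[-> ->]|/H2].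
- by move=> t; rewrite (site_l2ll ll0).
- by move=> t a b /nok.
- move=> a b t; rewrite ll_l2ll (site_l2ll ll0) => lt1 lt2 s0.
  have := H10 _ _ _ lt1 lt2 s0; case: eqP => [[ai bj]|] // _.
  rewrite ai in lt1; rewrite bj in lt2.
  by have := ti t lt2 (site0_none ge s0); rewrite leqNgt lt1.
- move=> a b a' b'; rewrite !ll_l2ll => /orP[/eqP[-> ->]|l1] /orP[/eqP[-> ->]|l2] //.
  (* The lower end of another ll-factor shows neither theta in the leading monomial, so it counts as
     empty and cannot lie strictly between i and j. *)
  + move=> lt1 lt2; have : none (lead_S e) a'.
      rewrite none_lead; have := g_site ge a'; have := ll_at_gt0L l2 (H2 _ _ l2).
      rewrite /site => pos le; apply/and3P; split.
      * by apply/negP => H; move: le; rewrite H; lia.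
      * by apply/negP => H; move: le; rewrite H; lia.
      rewrite negb_or !negb_exists; apply/andP; split; apply/forallP => x; apply/negP => H.
        move: le; have := H2 _ _ l2; have := H2 _ _ H; rewrite /ll_at => xa ab le.
        have := @sum_le1_at _ (fun y : 'I_n => (y < a')%N) (fun y => nat_of_bool (idx_ll e (y, a'))) x xa.
        have := @sum_le1_at _ (fun y : 'I_n => (a' < y)%N) (fun y => nat_of_bool (idx_ll e (a', y))) b' ab.
        rewrite H l2; move: le; set s1 := (\sum_(y < n | (y < a')%N) _)%N.
        by set s2 := (\sum_(y < n | (a' < y)%N) _)%N; lia.
      by have := s_at_gt0 H; lia.
    by move=> /(ti _ lt2); rewrite leqNgt lt1.
  + by move=> _ _; apply/topj/orP; left; apply/existsP; exists a.
  exact: H11 l1 l2.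
by move=> a b t c _ /nos.
Qed.

End LToLL.

(** * Leading monomials and ballot sequences *)

Section LeadBijection.
Variables m n : nat.
Implicit Types (d e : index_data m n) (u : 'X_{1..m + m}) (S : {set 'I_(n + n)}).

(** The minimal x_p and the minimal full pair q must come from a single factor. The conditions of I
    exclude k_p as the source of x_p, and they force any s-factor containing x_p to sit at q. *)
Lemma l2s_split d p q : good d -> (forall i, lead_u d (rshift m i) = 0%N) ->
  (0 < lead_u d (lshift m p))%N -> (forall a, (0 < lead_u d (lshift m a))%N -> (p <= a)%N) ->
  both (lead_S d) q -> (forall t, both (lead_S d) t -> (q <= t)%N) ->
  exists e, [/\ d = l2s e p q, good e & idx_l e (lshift n q)].
Proof.
move=> gd u0 lp up bq tq.
have top_q t : is_top d t -> (q <= t)%N by rewrite -both_lead //; apply: tq.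
have s_top a b : idx_s d (a, b) -> is_top d b.
  by move=> H; apply/orP; right; apply/existsP; exists a.
have top : is_top d q by rewrite -both_lead.
have nokk i j : (0 < idx_kk d (i, j))%N -> False by move=> /kk_lead_uR; rewrite u0.
have spq : idx_s d (p, q).
  have [a saq] : exists a, idx_s d (a, q).
    case/orP: top => [/existsP[i lliq]|/existsP //].
    have [Hk|[i' /nokk //]|[b sb]] := lead_uL_gt0 lp.
      by have := g_k_ll gd i q Hk; rewrite lliq.
    have := g_ll_s gd lliq sb; have := top_q _ (s_top _ _ sb) => le1 le2.
    by exists p; rewrite (_ : q = b) //; apply/val_inj/eqP; rewrite eqn_leq le1 le2.
  have := up _ (s_lead_uL saq); rewrite leq_eqVlt => /orP[/eqP/val_inj -> //|lt].
  have [Hk|[i' /nokk //]|[b sb]] := lead_uL_gt0 lp.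
    by have := g_k_s gd Hk saq; rewrite leqNgt lt.
  have := g_s_s gd saq sb lt => le1; have := top_q _ (s_top _ _ sb) => le2.
  by rewrite (_ : q = b) //; apply/val_inj/eqP; rewrite eqn_leq le1 le2.
pose e := upd_l (upd_s d (p, q) false) (lshift n q) true.
have de : d = l2s e p q.
  apply: index_data_eq => //= x; rewrite !fupdE.
    by case: eqP => // ->; rewrite (top_site gd top).
  by case: eqP => // ->.
have lq : idx_l e (lshift n q) by rewrite /= fupdE eqxx.
exists e; split=> //; apply: (good_l2s_inv lq (p := p)); last by rewrite -de.
by rewrite /= fupdE eqxx.
Qed.

Lemma ll_none d a b : good d -> idx_ll d (a, b) -> ~~ is_top d a -> none (lead_S d) a.
Proof.
move=> gd lab nta; rewrite none_lead; have := g_site gd a.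
have := ll_at_gt0L lab (g_ll_lt gd lab).
rewrite /site => pos le; apply/and3P; split=> //.
  by apply/negP => H; move: le; rewrite H; lia.
by apply/negP => H; move: le; rewrite H; lia.
Qed.

(** The last empty site i before the first full pair j is its partner. If the factor ending at j
    began at some a < i, then either i would be a forbidden gap, or an ll-factor would start at i,
    and noncrossing together with minimality of j makes it end at j. *)
Lemma l2ll_split d (i j : 'I_n) : good d -> (forall x, lead_u d x = 0%N) -> (i < j)%N ->
  both (lead_S d) j -> (forall t, both (lead_S d) t -> (j <= t)%N) ->
  none (lead_S d) i ->
  (forall t : 'I_n, (t < j)%N -> none (lead_S d) t -> (t <= i)%N) ->
  exists e, [/\ d = l2ll e i j, good e, idx_l e (lshift n i) & idx_l e (rshift n j)].
Proof.
move=> gd u0 ij bj tj ni ti.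
have top_j t : is_top d t -> (j <= t)%N by rewrite -both_lead //; apply: tj.
have ll_top a b : idx_ll d (a, b) -> is_top d b.
  by move=> H; apply/orP; left; apply/existsP; exists a.
have top : is_top d j by rewrite -both_lead.
have nos a b : idx_s d (a, b) -> False by move=> /s_lead_uL; rewrite u0.
move: (ni); rewrite none_lead => /and3P[/negbTE li /negbTE ri nti].
have llij : idx_ll d (i, j).
  have [a laj] : exists a, idx_ll d (a, j).
    by case/orP: top => [/existsP //|/existsP[b /nos //]].
  have aj := g_ll_lt gd laj.
  have na : none (lead_S d) a.
    by apply: ll_none laj _ => //; apply/negP => /top_j; rewrite leqNgt aj.
  have := ti a aj na; rewrite leq_eqVlt => /orP[/eqP/val_inj <- //|ai].
  have [s0|] := posnP (site d i).
    by have := g_gap gd ai ij s0; rewrite laj.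
  rewrite /site li ri (_ : s_at d i = 0%N); last first.
    by rewrite /s_at big1 // => b _; apply/eqP; rewrite eqb0; apply/negP => /nos.
  rewrite addn0 add0n /ll_at big1 ?add0n => [|b _]; last first.
    apply/eqP; rewrite eqb0; apply/negP => /ll_top; exact/negP.
  rewrite lt0n => nz; have [b ib lib] : exists2 b : 'I_n, (i < b)%N & idx_ll d (i, b).
    apply/exists_inP; apply: contraNT nz; rewrite negb_exists_in => /forall_inP H.
    by rewrite big1 // => b /H/negPf ->.
  have := g_ll_ll gd laj lib ai ij => le1; have := top_j _ (ll_top _ _ lib) => le2.
  by rewrite (_ : j = b) //; apply/val_inj/eqP; rewrite eqn_leq le1 le2.
pose e := upd_l (upd_l (upd_ll d (i, j) false) (lshift n i) true) (rshift n j) true.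
have li' : idx_l e (lshift n i) by rewrite /= !fupdE eqxx eq_lrshift.
have rj' : idx_l e (rshift n j) by rewrite /= !fupdE eqxx.
have de : d = l2ll e i j.
  apply: index_data_eq => //= x; rewrite !fupdE.
    case: eqP => [->|_]; first by rewrite (top_site gd top).
    by case: eqP => // ->.
  by case: eqP => // ->.
exists e; split=> //; apply: (good_l2ll_inv ij li' rj'); last by rewrite -de.
by rewrite /= fupdE eqxx.
Qed.

(** Drops by exactly one when [addkk], [l2s] or [l2ll] is undone. *)
Definition lead_size u S : nat := (\sum_i u (rshift m i) + \sum_t both S t)%N.

Lemma both_addR S t : lshift n t \in S -> rshift n t \notin S ->
  forall x, (both (rshift n t |: S) x = both S x + (x == t) * 1 :> nat)%N.
Proof.
move=> lS rS x; rewrite /both !in_setU1 eq_rshift eq_lrshift /= muln1.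
by case: eqVneq => [->|_]; rewrite ?(negPf rS) ?lS ?andbF //= addn0.
Qed.

Lemma ex_max N (P : pred 'I_N) a : P a ->
  exists2 i, P i & forall b, P b -> (b <= i)%N.
Proof.
by move=> Pa; case: (@arg_maxnP _ a P (fun i : 'I_N => i : nat) Pa) => i Pi max; exists i.
Qed.

Lemma ex_min N (P : pred 'I_N) a : P a ->
  exists2 i, P i & forall b, P b -> (i <= b)%N.
Proof.
by move=> Pa; case: (@arg_minnP _ a P (fun i : 'I_N => i : nat) Pa) => i Pi min; exists i.
Qed.

Lemma sum_bool_gt0 (I : finType) (P : pred I) (f : I -> bool) :
  (0 < \sum_(i | P i) f i)%N -> exists2 i, P i & f i.
Proof.
move=> H; apply/exists_inP; apply: contraLR H.
rewrite negb_exists_in => /forall_inP H; rewrite big1 // => i /H.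
by case: (f i).
Qed.

(** The extremal factor is determined by the monomial alone, so both index data contain it and it
    can be removed from both. When there is no y and no full pair, only k and l can be nonzero, and
    they are read off directly. *)
Lemma lead_inj d1 d2 : good d1 -> good d2 ->
  lead_u d1 = lead_u d2 -> lead_S d1 = lead_S d2 -> d1 = d2.
Proof.
move: {2}(lead_size _ _).+1 (ltnSn (lead_size (lead_u d1) (lead_S d1))) => N.
elim: N d1 d2 => // N IH d1 d2 leN g1 g2 eu eS.
have [/existsP[i0 ri0]|/existsPn u0] := boolP [exists i, 0 < lead_u d1 (rshift m i)]%N.
  have [i ri ui] := @ex_max _ (fun i => 0 < lead_u d1 (rshift m i))%N _ ri0.
  have [j0 /kk_lead_uL lj0] := lead_uR_gt0 ri.
  have [j lj uj] := @ex_max _ (fun j => 0 < lead_u d1 (lshift m j))%N j0 lj0.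
  have [e1 de1 ge1] := addkk_split g1 ri ui lj uj.
  rewrite eu in ri ui lj uj; have [e2 de2 ge2] := addkk_split g2 ri ui lj uj.
  rewrite de1 de2 (IH e1 e2) //.
  - move: leN; rewrite de1 lead_S_addkk lead_u_addkk /lead_size.
    rewrite (@sumn_at _ predT i _ (fun x => lead_u e1 (rshift m x)) 1); first by rewrite addn1 addSn ltnS.
    by move=> x; rewrite !mnmDE !mnm1E eq_rshift eq_lrshift addn0 muln1 eq_sym.
  - by move: eu; rewrite de1 de2 !lead_u_addkk => /addIm/addIm.
  by move: eS; rewrite de1 de2 !lead_S_addkk.
have {}u0 i : lead_u d1 (rshift m i) = 0%N by apply/eqP; have := u0 i; rewrite -eqn0Ngt.
have [/existsP[q0 bq0]|/existsPn nob] := boolP [exists q, both (lead_S d1) q]; last first.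
  have nokk d : lead_u d = lead_u d1 -> forall a b, idx_kk d (a, b) = 0%N.
    move=> ed a b; apply/eqP; rewrite -leqn0 leqNgt; apply/negP => /kk_lead_uR.
    by rewrite ed u0.
  have nos d : good d -> lead_S d = lead_S d1 -> forall a b, idx_s d (a, b) = false.
    move=> gd ed a b; apply/negbTE/negP => H; have := nob b; rewrite -ed both_lead //.
    by move=> /negP; apply; apply/orP; right; apply/existsP; exists a.
  have noll d : good d -> lead_S d = lead_S d1 -> forall a b, idx_ll d (a, b) = false.
    move=> gd ed a b; apply/negbTE/negP => H; have := nob b; rewrite -ed both_lead //.
    by move=> /negP; apply; apply/orP; left; apply/existsP; exists a.
  apply: index_data_eq => [t|[a b]|x|[a b]|[a b]].
  - have := congr1 (fun u : 'X_{1..m + m} => u (lshift m t)) eu.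
    rewrite !lead_uL !big1 ?addn0 // => x _;
      rewrite ?(nokk d1 erefl) ?(nokk d2 (esym eu)) // ?(nos d1) ?(nos d2) //.
  - by rewrite !nokk.
  - have := congr1 (fun S : {set _} => x \in S) eS; rewrite !inE.
    have ntop d : good d -> lead_S d = lead_S d1 -> is_top d (pair_of x) = false.
      by move=> gd ed; rewrite -both_lead // ed; apply/negbTE.
    by rewrite !ntop // !orbF.
  - by rewrite !noll.
  by rewrite !nos.
have [q bq tq] := @ex_min _ (both (lead_S d1)) _ bq0.
have [/existsP[p0 lp0]|/existsPn v0] := boolP [exists p, 0 < lead_u d1 (lshift m p)]%N.
  have [p lp up] := @ex_min _ (fun p => 0 < lead_u d1 (lshift m p))%N _ lp0.
  have [e1 [de1 ge1 le1]] := l2s_split g1 u0 lp up bq tq.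
  rewrite eu eS in u0 lp up bq tq; have [e2 [de2 ge2 le2]] := l2s_split g2 u0 lp up bq tq.
  have [_ _ _ _ /(_ p) s1] := l2s_site_facts le1 ge1.
  have [_ _ _ _ /(_ p) s2] := l2s_site_facts le2 ge2.
  have r1 := rshift_lead_l2s le1 ge1; have r2 := rshift_lead_l2s le2 ge2.
  rewrite de1 de2 (IH e1 e2) //.
  - move: leN; rewrite de1 (lead_S_l2s _ le1) (lead_u_l2s s1) /lead_size.
    rewrite [X in (_ + X)%N](@sumn_at _ predT q _ (both (lead_S e1)) 1).
      rewrite (eq_bigr (fun i => lead_u e1 (rshift m i))) ?addn1 ?addnS ?ltnS //.
      by move=> i _; rewrite mnmDE mnm1E eq_lrshift addn0.
    by apply: both_addR => //; rewrite lead_SL le1.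
  - by move: eu; rewrite de1 de2 (lead_u_l2s s1) (lead_u_l2s s2) => /addIm.
  move: eS; rewrite de1 de2 (lead_S_l2s _ le1) (lead_S_l2s _ le2) => eS.
  by rewrite -(setU1K r1) eS setU1K.
have {}v0 x : lead_u d1 x = 0%N.
  case: (split_ordP x) => t ->; last exact: u0.
  by apply/eqP; have := v0 t; rewrite -eqn0Ngt.
have [a laq] : exists a, idx_ll d1 (a, q).
  move: bq; rewrite both_lead // => /orP[/existsP //|/existsP[b /s_lead_uL]].
  by rewrite v0.
have aq := g_ll_lt g1 laq.
have na : none (lead_S d1) a.
  by apply: ll_none laq _ => //; rewrite -both_lead //; apply/negP => /tq; rewrite leqNgt aq.
have Pa : (a < q)%N && none (lead_S d1) a by rewrite aq.
have [i /andP[iq ni] imax] := @ex_max _ (fun a => (a < q)%N && none (lead_S d1) a) a Pa.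
have {}imax (t : 'I_n) : (t < q)%N -> none (lead_S d1) t -> (t <= i)%N.
  by move=> lt nt; apply: imax; rewrite lt.
have [e1 [de1 ge1 li1 rq1]] := l2ll_split g1 v0 iq bq tq ni imax.
rewrite eu eS in v0 bq tq ni imax.
have [e2 [de2 ge2 li2 rq2]] := l2ll_split g2 v0 iq bq tq ni imax.
rewrite de1 de2 (IH e1 e2) //.
- move: leN; rewrite de1 lead_u_l2ll /lead_size.
  have eb t : (both (lead_S (l2ll e1 i q)) t = both (lead_S e1) t + (t == q) * 1 :> nat)%N.
    have gC : good (l2ll e1 i q) by rewrite -de1.
    rewrite (both_lead _ gC) (both_lead _ ge1) is_top_l2ll muln1.
    by case: eqVneq => [->|_]; rewrite ?addn0 // (top_e li1 rq1 ge1).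
  by rewrite (@sumn_at _ predT q _ (both (lead_S e1)) 1 eb) addn1 addnS ltnS.
- by move: eu; rewrite de1 de2.
by rewrite (lead_S_l2ll_inv iq li1 rq1 ge1) (lead_S_l2ll_inv iq li2 rq2 ge2) -de1 -de2 eS.
Qed.

(* A ballot condition at each site, when the x- and y-variables are read from   *)
(* x_m down to x_1 and then the theta-pairs from 1 to n.                        *)
Definition ballot u S : Prop :=
  (forall i : 'I_m, (\sum_(a < m | i <= a) u (rshift m a) <= \sum_(a < m | i < a) u (lshift m a))%N)
  /\ (forall j : 'I_n, (\sum_a u (rshift m a) + \sum_(t < n | t <= j) both S t
        <= \sum_a u (lshift m a) + \sum_(t < n | t <= j) none S t)%N).

Lemma sum_eq0 (I : finType) (P : pred I) (f : I -> nat) :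
  (forall x, P x -> f x = 0%N) -> (\sum_(x | P x) f x = 0)%N.
Proof. by move=> H; apply: big1. Qed.

(** The matching built greedily: the ballot inequalities supply a partner for the extremal y, namely
    a later x, and then for the first full pair, namely the smallest remaining x or, failing that,
    an earlier empty site. Undoing the match preserves the inequalities. *)
Lemma lead_exists u S : ballot u S ->
  exists2 d, good d & lead_u d = u /\ lead_S d = S.
Proof.
move: {2}(lead_size _ _).+1 (ltnSn (lead_size u S)) => N.
elim: N u S => // N IH u S leN [bx bt].
have [/existsP[i0 ri0]|/existsPn u0] := boolP [exists i, 0 < u (rshift m i)]%N.
  have [i ri ui] := @ex_max _ (fun i => 0 < u (rshift m i))%N _ ri0.
  (* The inequality at i itself produces an x of index beyond i. *)
  have : (0 < \sum_(a < m | i < a) u (lshift m a))%N.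
    by apply: leq_trans (bx i); rewrite (bigD1 i) //= addn_gt0 ri.
  rewrite lt0n => nz; have [j0 ij0 lj0] : exists2 j0 : 'I_m, (i < j0)%N & (0 < u (lshift m j0))%N.
    apply/exists_inP; apply: contraNT nz; rewrite negb_exists_in => /forall_inP H.
    by rewrite big1 // => b /H; rewrite -eqn0Ngt => /eqP.
  have [j lj uj] := @ex_max _ (fun j => 0 < u (lshift m j))%N _ lj0.
  have ij : (i < j)%N by apply: leq_trans ij0 (uj _ lj0).
  pose v := (u - U_(rshift m i) - U_(lshift m j))%MM.
  have uE : u = (v + U_(rshift m i) + U_(lshift m j))%MM.
    rewrite -[in RHS]addmA [(U_(_) + U_(_))%MM]addmC addmA !submK //.
      by apply/mnm_lepP => x; rewrite mnm1E; case: eqP => // <-.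
    apply/mnm_lepP => x; rewrite mnmBE !mnm1E; case: eqP => // <-.
    by rewrite eq_rlshift subn0.
  have vR P : (\sum_(a | P a) u (rshift m a) = \sum_(a | P a) v (rshift m a) + P i * 1)%N.
    apply: sumn_at => x.
    by rewrite {1}uE !mnmDE !mnm1E eq_rshift eq_lrshift addn0 muln1 eq_sym.
  have vL P : (\sum_(a | P a) u (lshift m a) = \sum_(a | P a) v (lshift m a) + P j * 1)%N.
    apply: sumn_at => x.
    by rewrite {1}uE !mnmDE !mnm1E eq_lshift eq_rlshift addn0 muln1 eq_sym.
  have [||e ge [eu eS]] := IH v S.
  - by move: leN; rewrite /lead_size vR /= addn1 addSn ltnS.
  (* In the theta-inequalities both sides drop by one, and likewise in the x-inequality at a <= i.
     For a > i there is no y left to count, by maximality of i. *)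
  - split=> [a|t]; last first.
      by have := bt t; rewrite vR vL /= addnAC [X in (_ <= X)%N]addnAC leq_add2r.
    have [ai|ia] := leqP a i.
      by have := bx a; rewrite vR vL /= ai (leq_ltn_trans ai ij) leq_add2r.
    rewrite sum_eq0 // => x ax; apply/eqP; rewrite -leqn0 leqNgt; apply/negP => H.
    have : (0 < u (rshift m x))%N by rewrite uE !mnmDE !addn_gt0 H.
    by move=> /ui; rewrite leqNgt (leq_trans ia ax).
  have mono x : (0 < v x)%N -> (0 < u x)%N by rewrite uE !mnmDE !addn_gt0 => ->.
  exists (addkk e i j); last by rewrite lead_u_addkk lead_S_addkk eu eS -uE.
  apply: good_addkk => // a; rewrite eu => /mono; [exact: ui | exact: uj].
have {}u0 i : u (rshift m i) = 0%N by apply/eqP; have := u0 i; rewrite -eqn0Ngt.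
have [/existsP[q0 bq0]|/existsPn nob] := boolP [exists q, both S q]; last first.
  pose d := IndexData [ffun t => u (lshift m t)] [ffun=> 0%N] [ffun p => p \in S]
    [ffun=> false] [ffun=> false] : index_data m n.
  have top t : is_top d t = false.
    apply/negbTE; rewrite negb_or !negb_exists.
    by apply/andP; split; apply/forallP => a; rewrite ffunE.
  exists d.
    have st t : (site d t <= 1)%N.
      have l0 : ll_at d t = 0%N by rewrite /ll_at !big1 // => x _; rewrite ffunE.
      have s0 : s_at d t = 0%N by rewrite /s_at big1 // => x _; rewrite ffunE.
      rewrite /site l0 s0 /= !ffunE; move: (nob t); rewrite /both.
      by case: (_ \in S); case: (_ \in S).
    by split=> //= >; rewrite !ffunE.
  split; last by apply/setP => x; rewrite inE top orbF ffunE.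
  apply/mnmP => x; case: (split_ordP x) => t ->.
    by rewrite lead_uL !big1 ?addn0 ?ffunE // => y _; rewrite ffunE.
  by rewrite lead_uR big1 ?u0 // => y _; rewrite ffunE.
have [q bq tq] := @ex_min _ (both S) _ bq0.
have [lqS rqS] := andP bq.
have both0 (j : 'I_n) : (j < q)%N -> (\sum_(t < n | t <= j) both S t = 0)%N.
  move=> jq; apply: sum_eq0 => t tj; apply/eqP; rewrite eqb0; apply/negP => /tq.
  by rewrite leqNgt (leq_ltn_trans tj jq).
have [/existsP[p0 lp0]|/existsPn v0] := boolP [exists p, 0 < u (lshift m p)]%N.
  have [p lp up] := @ex_min _ (fun p => 0 < u (lshift m p))%N _ lp0.
  pose v := (u - U_(lshift m p))%MM; pose S' := S :\ rshift n q.
  have uE : u = (v + U_(lshift m p))%MM.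
    by rewrite submK //; apply/mnm_lepP => x; rewrite mnm1E; case: eqP => // <-.
  have SE : S = rshift n q |: S' by rewrite setD1K.
  have lqS' : lshift n q \in S' by rewrite !inE eq_lrshift.
  have rqS' : rshift n q \notin S' by rewrite !inE eqxx.
  have bS P : (\sum_(t | P t) both S t = \sum_(t | P t) both S' t + P q * 1)%N.
    by apply: sumn_at; rewrite {1}SE; apply: both_addR.
  have nS t : none S' t = none S t.
    by rewrite /none !inE eq_lrshift eq_rshift /=; case: eqVneq => [->|] //=; rewrite lqS.
  have vR i : v (rshift m i) = 0%N by rewrite mnmBE u0.
  have vL : (\sum_a u (lshift m a) = \sum_a v (lshift m a) + 1)%N.
    rewrite (@sumn_at _ predT p _ (fun x => v (lshift m x)) 1) // => x.
    by rewrite {1}uE mnmDE mnm1E eq_lshift muln1 eq_sym.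
  have U0 : (\sum_i u (rshift m i) = 0)%N by apply: sum_eq0 => i _; apply: u0.
  have V0 : (\sum_i v (rshift m i) = 0)%N by apply: sum_eq0 => i _; apply: vR.
  have nSum (t : 'I_n) : (\sum_(x < n | x <= t) none S' x = \sum_(x < n | x <= t) none S x)%N.
    by apply: eq_bigr => x _; rewrite nS.
  have [||e ge [eu eS]] := IH v S'.
  - by move: leN; rewrite /lead_size bS /= addn1 addnS ltnS U0 V0.
  - split=> [a|t]; first by rewrite sum_eq0 // => x _; rewrite vR.
    rewrite V0 add0n nSum; have := bt t; rewrite U0 add0n bS vL.
    case: (leqP q t) => qt /=; first by rewrite addnAC leq_add2r.
    by move=> _; have := both0 _ qt; rewrite bS /= leqNgt qt addn0 => ->.
  have lq : idx_l e (lshift n q).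
    have tp : is_top e q = false by rewrite -both_lead // eS /both (negPf rqS') andbF.
    by move: lqS'; rewrite -eS lead_SL tp orbF.
  have [_ _ _ _ /(_ p) s0] := l2s_site_facts lq ge.
  exists (l2s e p q); last by rewrite (lead_u_l2s s0) (lead_S_l2s _ lq) eu eS -uE -SE.
  apply: good_l2s => //; rewrite ?eu ?eS //.
    by move=> a H; apply: up; rewrite uE mnmDE addn_gt0 H.
  by move=> t bt'; apply: tq; move: bt'; rewrite SE /both !in_setU1 => /andP[-> ->]; rewrite !orbT.
have {}v0 x : u x = 0%N.
  case: (split_ordP x) => t ->; last exact: u0.
  by apply/eqP; have := v0 t; rewrite -eqn0Ngt.
have U0 : (\sum_i u (rshift m i) = 0)%N by apply: sum_eq0 => i _; apply: v0.
have L0 : (\sum_i u (lshift m i) = 0)%N by apply: sum_eq0 => i _; apply: v0.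
(* With all exponents zero, the inequality at q says that some site up to q is empty; it is not q
   itself, which is full. *)
have [a aq na] : exists2 a : 'I_n, (a <= q)%N & none S a.
  apply: sum_bool_gt0; have := bt q; rewrite U0 L0 !add0n; apply: leq_trans.
  by rewrite (bigD1 q) //= bq.
have {}aq : (a < q)%N.
  rewrite ltn_neqAle aq andbT; apply/eqP => /val_inj ea.
  by move: na; rewrite ea /none lqS.
have Pa : (a < q)%N && none S a by rewrite aq.
have [i /andP[iq ni] imax] := @ex_max _ (fun a => (a < q)%N && none S a) a Pa.
have [li ri] := andP ni.
pose S0 := S :\ lshift n q; pose S' := lshift n i |: S0.
have niq : i != q by rewrite neq_ltn iq.
have SE : S = lshift n q |: S0 by rewrite setD1K.
have bS P : (\sum_(t | P t) both S t = \sum_(t | P t) both S' t + P q * 1)%N.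
  apply: sumn_at => t; rewrite /both !inE !eq_lshift !eq_rlshift /= muln1.
  case: (eqVneq t q) => [->|]; first by rewrite [q == i]eq_sym (negPf niq) lqS rqS.
  case: (eqVneq t i) => [->|] _ /=; last by rewrite addn0.
  by rewrite (negPf li) (negPf ri).
have nS P : (\sum_(t | P t) none S t = \sum_(t | P t) none S' t + P i * 1)%N.
  apply: sumn_at => t; rewrite /none !inE !eq_lshift !eq_rlshift /= muln1.
  case: (eqVneq t i) => [->|]; first by rewrite li ri.
  case: (eqVneq t q) => [->|] _ /=; last by rewrite addn0.
  by rewrite lqS rqS.
have [||e ge [eu eS]] := IH u S'.
- by move: leN; rewrite /lead_size bS /= addn1 addnS ltnS.
- split=> [b|t]; first by rewrite sum_eq0 // => x _; rewrite u0.
  rewrite U0 L0 !add0n; have := bt t; rewrite U0 L0 !add0n bS nS.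
  case: (leqP q t) => qt /=; first by rewrite (leq_trans (ltnW iq) qt) leq_add2r.
  move=> _; have := both0 _ qt; rewrite bS /= leqNgt qt addn0 => ->.
  by [].
have le : idx_l e (lshift n i).
  have H1 : lshift n i \in S' by rewrite !inE eqxx.
  have H2 : rshift n i \notin S' by rewrite !inE !eq_rlshift.
  have tp : is_top e i = false by rewrite -both_lead // eS /both (negPf H2) andbF.
  by move: H1; rewrite -eS lead_SL tp orbF.
have re : idx_l e (rshift n q).
  have H1 : rshift n q \in S' by rewrite !inE !eq_rlshift.
  have H2 : lshift n q \notin S' by rewrite !inE !eq_lshift eqxx eq_sym (negPf niq).
  have tp : is_top e q = false by rewrite -both_lead // eS /both (negPf H2).
  by move: H1; rewrite -eS lead_SR tp orbF.
exists (l2ll e i q).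
  apply: good_l2ll => //; rewrite ?eu ?eS // => t.
    rewrite /both !inE eq_lshift !eq_rlshift /= => /andP[+ rt].
    case: (eqVneq t i) => [ti _|_ /= /andP[_ lt]]; last by apply: tq; rewrite /both lt rt.
    by rewrite -ti rt in ri.
  move=> tq' nt; apply: imax; rewrite tq' /=; move: nt; rewrite /none !inE !eq_lshift !eq_rlshift /=.
  by case: (eqVneq t i) => //= _; case: (eqVneq t q) tq' => [->|_ _] //=; rewrite ltnn.
split; first by rewrite lead_u_l2ll.
rewrite (lead_S_l2ll iq le re ge) eS setU1K -?SE //.
by rewrite !inE negb_and li orbT.
Qed.

End LeadBijection.

(** * Monomials in the kernel of Delta *)

Section BallotMonomial.
Variables (F : numFieldType) (m n : nat).
Local Notation A := (spoly F (m + m) (n + n)).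
Implicit Types (f g h : A) (u v : 'X_{1..m + m}) (S : {set 'I_(n + n)}).

Lemma eq_DeltaP (P P' : pred 'I_m) (Q Q' : pred 'I_n) f : P =1 P' -> Q =1 Q' ->
  DeltaP P Q f = DeltaP P' Q' f.
Proof. by move=> eP eQ; rewrite /DeltaP (eq_bigl _ _ eP) (eq_bigl _ _ eQ). Qed.

Lemma spoly_neq0 f : f != 0 -> exists u S, cf f u S != 0.
Proof.
move=> f0; have [S fS] : exists S, f S != 0.
  apply/existsP; apply: contraR f0; rewrite negb_exists => /forallP H.
  by apply/eqP/ffunP => S; rewrite ffunE; apply/eqP; have := H S; rewrite negbK.
exists (mlead (f S)), S; rewrite /cf -mcoeff_msupp; exact: mlead_supp.
Qed.

Lemma xvarX_emon i c u S : xvar F (n + n) i ^+ c * emon F u S = emon F (u + U_(i) *+ c)%MM S.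
Proof.
have := prod_xvar_emon F [:: i] (fun=> c) u S.
by rewrite !big_seq1.
Qed.

Lemma xvarX_dvd i c f : supp (fun u S => (c <= u i)%N) f ->
  exists2 g, f = xvar F (n + n) i ^+ c * g &
    forall u S, (c <= u i)%N -> cf g (u - U_(i) *+ c)%MM S = cf f u S.
Proof.
move=> cu; pose g := \sum_S \sum_(u <- msupp (f S)) cf f u S *: emon F (u - U_(i) *+ c)%MM S.
have cfK h v S : cf (xvar F (n + n) i ^+ c * h) (v + U_(i) *+ c)%MM S = cf h v S.
  elim: c {cu g} => [|c IH]; first by rewrite expr0 mul1r mulm0n addm0.
  by rewrite exprS -mulrA mulmS [(U_(i) + _)%MM]addmC addmA cf_xvarMD IH.
have le u : (c <= u i)%N -> (U_(i) *+ c <= u)%MM.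
  move=> cui; apply/mnm_lepP => j; rewrite mulmnE mnm1E.
  by case: eqP => [<-|_]; rewrite ?mul1n ?mul0n.
have fE : f = xvar F (n + n) i ^+ c * g.
  rewrite {1}(emonE f) mulr_sumr; apply: eq_bigr => S _.
  rewrite mulr_sumr !big_seq; apply: eq_bigr => u uf.
  rewrite -scalerAr xvarX_emon submK //; apply/le/cu.
  by rewrite mcoeff_msupp in uf; exact: uf.
by exists g => // u S cui; rewrite fE -cfK submK //; apply: le.
Qed.

Lemma DeltaP_xLX P Q i c f :
  DeltaP P Q (xL F n i ^+ c * f) = xL F n i ^+ c * DeltaP P Q f.
Proof.
elim: c f => [|c IH] f; first by rewrite !expr0 !mul1r.
by rewrite !exprS -!mulrA DeltaP_xL IH.
Qed.

Lemma xvarX_inj i c f : xvar F (n + n) i ^+ c * f = 0 -> f = 0.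
Proof.
elim: c => [|c IH]; first by rewrite expr0 mul1r.
rewrite exprS -mulrA => e; apply: IH; apply: cf_inj => u S.
by rewrite -(cf_xvarMD i) e !cf0.
Qed.

Lemma DeltaP_rmx (P P' : pred 'I_m) Q i f : P i -> (forall x, P' x = (x != i) && P x) ->
  DeltaP P Q f = DeltaP P' Q f - xL F n i * dx (rshift m i) f.
Proof.
move=> Pi P'E; rewrite /DeltaP (bigD1 i) //= opprD -addrA addrC; congr (- _ + _ - _).
by apply: eq_bigl => x; rewrite P'E andbC.
Qed.

Lemma ex_supp_max (phi : 'X_{1..m + m} -> {set 'I_(n + n)} -> nat)
    (Pr : 'X_{1..m + m} -> {set 'I_(n + n)} -> bool) f u0 S0 :
  cf f u0 S0 != 0 -> Pr u0 S0 ->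
  exists u S, [/\ cf f u S != 0, Pr u S &
    forall v T, cf f v T != 0 -> Pr v T -> (phi v T <= phi u S)%N].
Proof.
move=> nz P0; have [K bK] := supp_bounded phi f.
pose hit c := [exists S, has (fun u => [&& Pr u S & phi u S == c]) (msupp (f S))].
have hitP u S : cf f u S != 0 -> Pr u S -> hit (phi u S).
  move=> cn Pn; apply/existsP; exists S; apply/hasP; exists u; last by rewrite Pn eqxx.
  by rewrite mcoeff_msupp.
have ex : exists c, hit c by exists (phi u0 S0); apply: hitP.
have bd c : hit c -> (c <= K)%N.
  case/existsP => S /hasP[u]; rewrite mcoeff_msupp => cn /andP[_ /eqP <-].
  exact: ltnW (bK u S cn).
case: (ex_maxnP ex bd) => c /existsP[S /hasP[u]]; rewrite mcoeff_msupp => cn /andP[Pn /eqP <-] max.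
by exists u, S; split=> // v T cv Pv; apply: max; apply: hitP.
Qed.

Lemma res0 (b : 'X_{1..m + m} -> {set 'I_(n + n)} -> bool) : res b (0 : A) = 0.
Proof. by apply: cf_inj => u S; rewrite cf_res !cf0 if_same. Qed.

(* Restrict to terms of maximal degree b in y_i among those of fixed degree d0  *)
(* in (x_i, y_i): this part is x_i^(d0 - b) h, where h is still killed by the   *)
(* partial Laplacian, so that all its weights are nonpositive.                  *)
Lemma kernel_ballot_x k : forall i f, (i + k = m)%N -> f != 0 ->
  DeltaP (fun a => i <= a)%N pred0 f = 0 ->
  exists u S, cf f u S != 0 /\ forall a : 'I_m, (i <= a)%N ->
    (\sum_(b < m | a <= b) u (rshift m b) <= \sum_(b < m | a < b) u (lshift m b))%N.
Proof.
elim: k => [|k IH] i f ik f0 Df.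
  have [u [S nz]] := spoly_neq0 f0; exists u, S; split=> // a.
  by rewrite leqNgt; move: ik; rewrite addn0 => ->; rewrite ltn_ord.
have im : (i < m)%N by lia.
pose s := Ordinal im; set P := (fun a : 'I_m => i <= a)%N in Df.
pose P' := (fun a : 'I_m => i.+1 <= a)%N.
have P'E x : P' x = (x != s) && P x by rewrite /P' /P ltn_neqAle -val_eqE /= eq_sym.
have [u0 [S0 nz0]] := spoly_neq0 f0.
pose deg (u : 'X_{1..m + m}) := (u (lshift m s) + u (rshift m s))%N.
pose d0 := deg u0.
have [u1 [S1 [nz1 /eqP deg1 max1]]] := @ex_supp_max
  (fun u _ => u (rshift m s)) (fun u _ => deg u == d0) f u0 S0 nz0 (eqxx _).
set b := u1 (rshift m s) in max1.
pose fd := res (fun u _ => deg u == d0) f.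
pose g := res (fun u _ => u (rshift m s) == b) fd.
have deg_up u x : (0 < u (lshift m x))%N -> deg (up_u u x) = deg u.
  by move=> ux; rewrite /deg up_uL up_uR; case: eqP ux => [->|_]; lia.
(* A term x_s d/dy_s of f landing at y_s-exponent b would come from exponent b + 1, excluded by
   maximality. So the remaining Laplacian kills [g] on its own. *)
have Dg : DeltaP P' pred0 g = 0.
  rewrite (@DeltaP_res _ _ _ _ _ _ (fun u _ => u (rshift m s) == b)) //; last first.
    by move=> u S x; rewrite P'E up_uR => /andP[/negPf ->]; rewrite addn0.
  rewrite (@DeltaP_res _ _ _ _ _ _ (fun u _ => deg u == d0)) //; last first.
    by move=> u S x _ ux; rewrite deg_up.
  have Ds : DeltaP P' pred0 f = xL F n s * dx (rshift m s) f.
    apply/eqP; rewrite -subr_eq0 -(DeltaP_rmx (P := P)) //; first by rewrite Df.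
    exact: leqnn.
  rewrite Ds; apply: cf_inj => u S; rewrite !cf_res cf0.
  case: eqP => // ub; case: eqP => // du; rewrite cf_xvarM; case: ifP => // us.
  rewrite cf_dx; apply/eqP; rewrite mulrn_eq0 /=; apply: contraT => nz.
  have := max1 _ _ nz; rewrite -/(up_u u s) deg_up // du eqxx => /(_ isT).
  by rewrite up_uR eqxx ub; lia.
have g0 : g != 0.
  by apply: contraNneq nz1 => g0; have := cf_res (fun u _ => u (rshift m s) == b) fd u1 S1;
     rewrite -/g g0 cf0 eqxx cf_res deg1 eqxx => /esym/eqP.
have [u [S [nzg ballot_u]]] := IH i.+1 g (etrans (addSnnS _ _) ik) g0 Dg.
move: nzg; rewrite !cf_res; case: ifP => [/eqP ub|_]; last by rewrite eqxx.
case: ifP => [/eqP du|_]; last by rewrite eqxx.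
move=> nz; exists u, S; split=> // a; rewrite leq_eqVlt => /orP[/eqP ia|]; last exact: ballot_u.
have {ia} -> : a = s by apply: val_inj.
have Dfd : DeltaP P pred0 fd = 0.
  rewrite (@DeltaP_res _ _ _ _ _ _ (fun u _ => deg u == d0)) ?Df ?res0 //.
  by move=> v T x _ vx; rewrite deg_up.
have bd : (b <= d0)%N by rewrite -deg1 leq_addl.
(* Since y_s-exponents are at most b, the power x_s^(d0 - b) divides [fd]. Dividing it out leaves no
   x_s at the chosen monomial, which is why the right side of the ballot inequality counts only
   indices beyond i. *)
have [|h fh cfh] := @xvarX_dvd (lshift m s) (d0 - b) fd.
  move=> v T; rewrite cf_res; case: ifP => [/eqP dv nzv|_]; last by rewrite eqxx.
  by have := max1 _ _ nzv; rewrite /= dv eqxx => /(_ isT); move: dv; rewrite /deg; lia.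
have Dh : DeltaP P pred0 h = 0.
  by apply: (@xvarX_inj (lshift m s) (d0 - b)); rewrite -DeltaP_xLX -fh.
have nzh : cf h (u - U_(lshift m s) *+ (d0 - b))%MM S != 0.
  rewrite cfh; first by rewrite cf_res du eqxx.
  by move: du; rewrite /deg ub; lia.
have := DeltaP_ker_weight Dh nzh; rewrite /hval big_pred0_eq addr0 sumrB.
set w := (u - _)%MM; have wr x : w (rshift m x) = u (rshift m x).
  by rewrite mnmBE mulmnE mnm1E eq_lrshift subn0.
have wl x : w (lshift m x) = (u (lshift m x) - (s == x) * (d0 - b))%N.
  by rewrite mnmBE mulmnE mnm1E eq_lshift.
have -> : \sum_(x | P x) (w (rshift m x))%:Z = (\sum_(x | P x) u (rshift m x))%N%:Z.
  by rewrite (big_morph Posz PoszD (erefl _)); apply: eq_bigr => x _; rewrite wr.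
have -> : \sum_(x | P x) (w (lshift m x))%:Z = (\sum_(x | P' x) u (lshift m x))%N%:Z.
  rewrite (bigD1 s) /=; last exact: leqnn.
  rewrite wl eqxx mul1n (_ : _ - _ = 0)%N; last by move: du; rewrite /deg ub; lia.
  rewrite add0r (big_morph Posz PoszD (erefl _)); apply: eq_big => x.
    by rewrite P'E andbC.
  by move=> /andP[_ /negPf nx]; rewrite wl eq_sym nx subn0.
by rewrite subr_le0 lez_nat.
Qed.

Lemma DeltaP_rmQ P (Q Q' : pred 'I_n) j f : Q j -> (forall x, Q' x = (x != j) && Q x) ->
  DeltaP P Q f = DeltaP P Q' f + dtheta (lshift n j) (dtheta (rshift n j) f).
Proof.
move=> Qj Q'E; rewrite /DeltaP (bigD1 j Qj) /= -addrA; congr (_ + _); rewrite addrC.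
by congr (_ + _); apply: eq_bigl => x; rewrite Q'E andbC.
Qed.

(** Theta pairs are added one at a time. The new inequality is nonpositivity of the weight, to which
    a pair contributes 1 if full, - 1 if empty and 0 otherwise. *)
Lemma kernel_ballot_th j : forall f, (j <= n)%N -> f != 0 ->
  DeltaP predT (fun t => t < j)%N f = 0 ->
  exists u S, [/\ cf f u S != 0, forall a : 'I_m,
    (\sum_(b < m | a <= b) u (rshift m b) <= \sum_(b < m | a < b) u (lshift m b))%N &
    forall q : 'I_n, (q < j)%N ->
      (\sum_a u (rshift m a) + \sum_(t < n | t <= q) both S t
        <= \sum_a u (lshift m a) + \sum_(t < n | t <= q) none S t)%N].
Proof.
elim: j => [|j IH] f jn f0 Df.
  have Df' : DeltaP (fun a : 'I_m => 0 <= a)%N pred0 f = 0 by rewrite -Df; apply: eq_DeltaP.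
  have [u [S [nz bu]]] := @kernel_ballot_x m 0%N f erefl f0 Df'.
  by exists u, S; split=> // a; apply: bu.
pose s := Ordinal jn; set Q := (fun t : 'I_n => t < j.+1)%N in Df.
pose Q' := (fun t : 'I_n => t < j)%N.
have Q'E x : Q' x = (x != s) && Q x by rewrite /Q' /Q ltn_neqAle -val_eqE /= ltnS.
have [u0 [S0 nz0]] := spoly_neq0 f0.
have [u1 [S1 [nz1 _ max1]]] := @ex_supp_max
  (fun _ S => both S s) (fun _ _ => true) f u0 S0 nz0 isT.
set b := both S1 s in max1.
pose g := res (fun _ S => both S s == b) f.
(* The operator of the new pair takes terms with the pair full to terms with it empty. If b = 1 the
   results lie outside the retained part, and if b = 0 there are no sources. *)
have Dg : DeltaP predT Q' g = 0.
  rewrite (@DeltaP_res _ _ _ _ _ _ (fun _ S => both S s == b)) //; last first.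
    move=> u S x; rewrite Q'E /both pairs_upL pairs_upR eq_sym => /andP[/negPf -> _] _ _.
    by [].
  have Ds : DeltaP predT Q' f = - dtheta (lshift n s) (dtheta (rshift n s) f).
    apply/eqP; rewrite -addr_eq0 -(@DeltaP_rmQ predT Q Q' s) //; first by rewrite Df.
    exact: ltnSn.
  rewrite Ds; apply: cf_inj => u S; rewrite !cf_res cf0.
  case: ifP => // /eqP bS; rewrite cfN !cf_dtheta !inE eq_rlshift /=.
  case: ifPn => lS; first by rewrite oppr0.
  case: ifPn => rS; first by rewrite mulr0 oppr0.
  have [->|nz] := eqVneq (cf f u (rshift n s |: (lshift n s |: S))) 0.
    by rewrite !mulr0 oppr0.
  have := max1 _ _ nz isT.
  by rewrite /both !inE !eqxx !orbT -bS /both (negPf lS).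
have g0 : g != 0.
  by apply: contraNneq nz1 => g0; have := cf_res (fun _ S => both S s == b) f u1 S1;
     rewrite -/g g0 cf0 eqxx => /esym/eqP.
have [u [S [nzg bu bt]]] := IH g (ltnW jn) g0 Dg.
move: nzg; rewrite !cf_res; case: ifP => [/eqP bS|_]; last by rewrite eqxx.
move=> nz; exists u, S; split=> // q; rewrite ltnS leq_eqVlt => /orP[/eqP qj|]; last exact: bt.
have {qj} -> : q = s by apply: val_inj.
have := DeltaP_ker_weight Df nz; rewrite /hval sumrB.
have -> : \sum_(t | Q t) ((lshift n t \in S)%:Z + (rshift n t \in S)%:Z - 1) =
    (\sum_(t | Q t) both S t)%N%:Z - (\sum_(t | Q t) none S t)%N%:Z.
  rewrite !(big_morph Posz PoszD (erefl _)) -sumrB; apply: eq_bigr => t _.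
  by rewrite /both /none; case: (_ \in S); case: (_ \in S).
rewrite -!(big_morph Posz PoszD (erefl _)) -lez_nat !PoszD.
rewrite /Q /=; set a1 := (\sum_(t < m) _)%N; set a2 := (\sum_(t < m) _)%N.
set a3 := (\sum_(t < n | _) _)%N; set a4 := (\sum_(t < n | _) _)%N.
by lia.
Qed.

Lemma kernel_ballot f : f != 0 -> Delta f = 0 ->
  exists u S, cf f u S != 0 /\ ballot u S.
Proof.
move=> f0 Df; have Df' : DeltaP predT (fun t : 'I_n => t < n)%N f = 0.
  by rewrite -Df DeltaPT; apply: eq_DeltaP => // t; rewrite ltn_ord.
have [u [S [nz bu bt]]] := kernel_ballot_th (leqnn n) f0 Df'.
by exists u, S; split=> //; split=> // q; apply: bt.
Qed.

End BallotMonomial.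

(** * The elements h(k, l, s) *)

Section Hvec.
Variables (F : numFieldType) (m n : nat).
Local Notation A := (spoly F (m + m) (n + n)).
Local Notation hv d := (hvec F d).
Implicit Types (f g h : A) (u v : 'X_{1..m + m}) (S : {set 'I_(n + n)}).
Implicit Types (d e : index_data m n).

(** Induction on words in the generators, used to prove that products of two thetas are central. *)
Lemma spoly_ind (W : A -> Prop) : subspace W -> W 1 ->
  (forall i g, W g -> W (xvar F (n + n) i * g)) ->
  (forall p g, W g -> W (theta F (m + m) p * g)) -> forall g, W g.
Proof.
move=> sW W1 Wx Wt g; rewrite (emonE g).
apply: subspace_sum => // S _; apply: subspace_sum => // u _; apply: subspaceZ => //.
have Wth (s : seq 'I_(n + n)) : W (\prod_(p <- s) theta F (m + m) p).
  by elim: s => [|p s IH]; rewrite ?big_nil ?big_cons //; apply: Wt.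
have [c c0 e] := @emonS_theta F m n _ (enum_uniq (mem S)).
have kE : [set p in enum S] = S by apply/setP => p; rewrite inE mem_enum.
rewrite kE in e.
have -> : emon F u S = c^-1 *:
   (\prod_(i < m + m) xvar F (n + n) i ^+ u i * \prod_(p <- enum S) theta F (m + m) p).
  rewrite e -scalerAr scalerA mulVf // scale1r prod_xvar_emon add0m.
  by congr (emon F _ S); rewrite [LHS]multinomUE_id.
apply: subspaceZ => //; elim: (index_enum _) => [|i r IH]; first by rewrite big_nil mul1r.
rewrite big_cons -mulrA; elim: (u i) => [|c' IH']; first by rewrite expr0 mul1r.
by rewrite exprS -mulrA; apply: Wx.
Qed.

Definition central (c : A) := forall g, c * g = g * c.

Lemma central_theta2 p q : central (theta F (m + m) p * theta F (m + m) q).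
Proof.
pose W g := theta F (m + m) p * theta F (m + m) q * g
  = g * (theta F (m + m) p * theta F (m + m) q).
apply: (@spoly_ind W).
- by split=> [|c f g Wf Wg]; rewrite /W ?mulr0 ?mul0r // mulrDl mulrDr -scalerAr -scalerAl Wf Wg.
- by rewrite /W mul1r mulr1.
- by move=> i g Wg; rewrite /W xvarCA Wg mulrA.
move=> r g Wg; rewrite /W -[RHS]mulrA -Wg -!mulrA.
rewrite [theta F (m + m) q * (theta F (m + m) r * g)]theta_thetaM mulrN.
by rewrite [theta F (m + m) p * (theta F (m + m) r * _)]theta_thetaM opprK.
Qed.

Lemma central_xvar i : central (xvar F (n + n) i).
Proof. by move=> g; apply: xvarC. Qed.

Lemma central1 : central 1. Proof. by move=> g; rewrite mul1r mulr1. Qed.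

Lemma centralB c1 c2 : central c1 -> central c2 -> central (c1 - c2).
Proof. by move=> H1 H2 g; rewrite mulrBl mulrBr H1 H2. Qed.

Lemma centralM c1 c2 : central c1 -> central c2 -> central (c1 * c2).
Proof. by move=> H1 H2 g; rewrite -mulrA H2 mulrA H1 mulrA. Qed.

Lemma centralX c k : central c -> central (c ^+ k).
Proof.
move=> H; elim: k => [|k IH]; first by rewrite expr0; apply: central1.
by rewrite exprS; apply: centralM.
Qed.

Lemma central_prod I (r : seq I) (P : pred I) (G : I -> A) :
  (forall i, P i -> central (G i)) -> central (\prod_(i <- r | P i) G i).
Proof. by move=> H; elim/big_ind: _ => //; [exact: central1 | exact: centralM]. Qed.

(** The ring is not commutative, so centrality of c is what lets the extra factor be pulled to the
    front. *)
Lemma prod_bump (I : finType) (P : pred I) (a : I) (c : A) (G G' : I -> A) :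
  P a -> central c -> G' a = c * G a -> (forall i, i != a -> G' i = G i) ->
  \prod_(i | P i) G' i = c * \prod_(i | P i) G i.
Proof.
move=> Pa cc Ga Gn; have aux (r : seq I) : uniq r ->
    \prod_(i <- r | P i) G' i =
    (if a \in r then c else 1) * \prod_(i <- r | P i) G i.
  elim: r => [_|x r IH /= /andP[xr ur]]; first by rewrite !big_nil mul1r.
  rewrite !big_cons inE eq_sym; case: (eqVneq x a) => [xa|nxa] /=.
    by rewrite xa Pa Ga IH // -xa (negPf xr) mul1r mulrA.
  case: ifP => _; last exact: IH.
  rewrite IH // Gn //; case: ifP => _; rewrite ?mul1r //.
  by rewrite mulrA -cc mulrA.
by rewrite aux ?index_enum_uniq // mem_index_enum.
Qed.

Definition minor i j : A := xL F n i * xR F n j - xL F n j * xR F n i.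
Definition pdiff i j : A := thL F m i * thR F m i - thL F m j * thR F m j.
Definition sfac p q : A := xR F n p - xL F n p * thL F m q * thR F m q.

Lemma central_minor i j : central (minor i j).
Proof. by apply: centralB; apply: centralM; apply: central_xvar. Qed.

Lemma central_pdiff i j : central (pdiff i j).
Proof. by apply: centralB; apply: central_theta2. Qed.

Lemma central_sfac p q : central (sfac p q).
Proof.
apply: centralB; first exact: central_xvar.
by rewrite -mulrA; apply: centralM; [apply: central_xvar | apply: central_theta2].
Qed.

Definition hx d : A := \prod_(t < m) xL F n t ^+ idx_k d t.
Definition hkk d : A :=
  \prod_(i < m) \prod_(j < m | (i < j)%N) minor i j ^+ idx_kk d (i, j).
Definition hth d : A := \prod_(j < n)
  (thL F m j ^+ idx_l d (lshift n j) * thR F m j ^+ idx_l d (rshift n j)).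
Definition hll d : A :=
  \prod_(i < n) \prod_(j < n | (i < j)%N) pdiff i j ^+ idx_ll d (i, j).
Definition hs d : A := \prod_(p < m) \prod_(q < n) sfac p q ^+ idx_s d (p, q).

Lemma hvecE d : hv d = hx d * hkk d * hth d * hll d * hs d. Proof. by []. Qed.

Lemma central_hx d : central (hx d).
Proof. by apply: central_prod => t _; apply/centralX/central_xvar. Qed.

Lemma central_hkk d : central (hkk d).
Proof.
by apply: central_prod => i _; apply: central_prod => j _; apply/centralX/central_minor.
Qed.

Lemma central_hll d : central (hll d).
Proof.
by apply: central_prod => i _; apply: central_prod => j _; apply/centralX/central_pdiff.
Qed.

Lemma prod2_bump (I J : finType) (Q : I -> pred J) (a : I) (b : J) (c : A) (G G' : I -> J -> A) :
  Q a b -> central c -> G' a b = c * G a b ->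
  (forall i j, (i, j) != (a, b) -> G' i j = G i j) ->
  \prod_i \prod_(j | Q i j) G' i j = c * \prod_i \prod_(j | Q i j) G i j.
Proof.
move=> Qab cc Gab Gn; apply: (@prod_bump _ _ a) => // [|i nia].
  by apply: (@prod_bump _ _ b) => // j nj; apply: Gn; rewrite xpair_eqE eqxx.
by apply: eq_bigr => j _; apply: Gn; rewrite xpair_eqE (negPf nia).
Qed.

Lemma central_mid c x y z : central c -> x * (c * y) * z = c * (x * y * z).
Proof. by move=> cc; rewrite [x * _]mulrA -cc -!mulrA. Qed.

Lemma hvec_addkk e (i j : 'I_m) : (i < j)%N -> hv (addkk e i j) = minor i j * hv e.
Proof.
move=> ij; rewrite !hvecE (_ : hkk (addkk e i j) = minor i j * hkk e).
  rewrite -!mulrA (_ : hx (addkk e i j) = hx e) // (_ : hth (addkk e i j) = hth e) //.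
  rewrite (_ : hll (addkk e i j) = hll e) // (_ : hs (addkk e i j) = hs e) //.
  have := central_minor i j; move: (minor i j) (hx e) => c x cc.
  by rewrite mulrA -cc -mulrA.
apply: (@prod2_bump _ _ (fun i j : 'I_m => i < j)%N i j _
  (fun a b => minor a b ^+ idx_kk e (a, b))
  (fun a b => minor a b ^+ idx_kk (addkk e i j) (a, b))) => // [||a b /negPf nab].
- exact: central_minor.
- by rewrite /= fupdE eqxx exprS.
by rewrite /= fupdE nab.
Qed.

Lemma hvec_upd_ll e (i j : 'I_n) : (i < j)%N -> idx_ll e (i, j) = false ->
  hv (upd_ll e (i, j) true) = pdiff i j * hv e.
Proof.
move=> ij e0; rewrite !hvecE (_ : hll (upd_ll e (i, j) true) = pdiff i j * hll e).
  rewrite central_mid; last exact: central_pdiff.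
  by congr (_ * _).
apply: (@prod2_bump _ _ (fun i j : 'I_n => i < j)%N i j _
  (fun a b => pdiff a b ^+ idx_ll e (a, b))
  (fun a b => pdiff a b ^+ idx_ll (upd_ll e (i, j) true) (a, b))) => // [||a b /negPf nab].
- exact: central_pdiff.
- by rewrite /= fupdE eqxx e0 expr0 mulr1.
by rewrite /= fupdE nab.
Qed.

Lemma hvec_upd_s e (p : 'I_m) (q : 'I_n) : idx_s e (p, q) = false ->
  hv (upd_s e (p, q) true) = sfac p q * hv e.
Proof.
move=> e0; rewrite !hvecE (_ : hs (upd_s e (p, q) true) = sfac p q * hs e).
  rewrite -[LHS]mulr1 central_mid; last exact: central_sfac.
  by rewrite mulr1; congr (_ * _).
apply: (@prod2_bump _ _ (fun _ _ => true) p q _ (fun a b => sfac a b ^+ idx_s e (a, b))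
  (fun a b => sfac a b ^+ idx_s (upd_s e (p, q) true) (a, b))) => // [||a b /negPf nab].
- exact: central_sfac.
- by rewrite /= fupdE eqxx e0 expr0 mulr1.
by rewrite /= fupdE nab.
Qed.

Definition lset d : {set 'I_(n + n)} := [set p | idx_l d p].

Lemma pair_ofL (q : 'I_n) : pair_of (lshift n q) = q.
Proof. by rewrite /pair_of split_lshift. Qed.

Lemma pair_ofR (q : 'I_n) : pair_of (rshift n q) = q.
Proof. by rewrite /pair_of split_rshift. Qed.

Lemma hth_emon d : exists2 c : F, c != 0 & hth d = c *: emon F 0 (lset d).
Proof.
have aux (r : seq 'I_n) : uniq r -> exists2 c : F, c != 0 &
    \prod_(j <- r) (thL F m j ^+ idx_l d (lshift n j) * thR F m j ^+ idx_l d (rshift n j))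
    = c *: emon F 0 [set p in lset d | pair_of p \in r].
  elim: r => [_|j r IH /= /andP[jr ur]].
    exists 1; rewrite ?oner_neq0 // big_nil scale1r (_ : [set p in _ | _] = set0) ?emon1 //.
    by apply/setP => p; rewrite !inE andbF.
  have [c c0 e] := IH ur; rewrite big_cons e -mulrA.
  set T := [set p in lset d | _ \in r] in e *.
  have tj p : pair_of p = j -> p \notin T by move=> pj; rewrite !inE pj (negPf jr) andbF.
  have lj := tj (lshift n j); have rj := tj (rshift n j).
  rewrite /pair_of split_lshift in lj; rewrite /pair_of split_rshift in rj.
  have {}lj := lj erefl; have {}rj := rj erefl.
  have [c1 c10 e1] : exists2 c1 : F, c1 != 0 & thR F m j ^+ idx_l d (rshift n j) * (c *: emon F 0 T)
      = c1 *: emon F 0 (if idx_l d (rshift n j) then rshift n j |: T else T).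
    case: (idx_l d _) => /=; last by exists c; rewrite ?expr0 ?mul1r.
    exists (c * msgn F (rshift n j) T); first by rewrite mulf_neq0 // msgn_neq0.
    by rewrite expr1 -scalerAr theta_emon (negPf rj) scalerA.
  rewrite {}e1; set T' := (if _ then _ else T).
  have lj' : lshift n j \notin T'.
    by rewrite /T'; case: ifP => _ //; rewrite !inE eq_lrshift /= in lj *.
  have [c2 c20 e2] : exists2 c2 : F, c2 != 0 & thL F m j ^+ idx_l d (lshift n j) * (c1 *: emon F 0 T')
      = c2 *: emon F 0 (if idx_l d (lshift n j) then lshift n j |: T' else T').
    case: (idx_l d _) => /=; last by exists c1; rewrite ?expr0 ?mul1r.
    exists (c1 * msgn F (lshift n j) T'); first by rewrite mulf_neq0 // msgn_neq0.
    by rewrite expr1 -scalerAr theta_emon (negPf lj') scalerA.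
  exists c2 => //; rewrite e2; congr (_ *: emon F 0 _); apply/setP => p.
  have ifE (b : bool) (x y : 'I_(n + n)) (B : {set 'I_(n + n)}) :
      (x \in if b then y |: B else B) = b && (x == y) || (x \in B).
    by case: b; rewrite ?in_setU1.
  rewrite ifE /T' ifE !inE; case: (split_ordP p) => q ->.
    rewrite !pair_ofL eq_lshift eq_lrshift andbF /= andb_orr.
    by case: (eqVneq q j) => [->|]; rewrite ?andbT ?andbF.
  rewrite !pair_ofR eq_rlshift eq_rshift andbF /= andb_orr.
  by case: (eqVneq q j) => [->|]; rewrite ?andbT ?andbF.
have [c c0 e] := aux (index_enum _) (index_enum_uniq _).
exists c => //; rewrite /hth e; congr (_ *: emon F 0 _); apply/setP => p.
by rewrite inE mem_index_enum andbT.
Qed.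

(** All factors other than the single thetas are central, so the thetas can be collected at the
    right end into one monomial. *)
Lemma hvec_emon d : exists2 c : F, c != 0 &
  hv d = c *: (hx d * hkk d * hll d * hs d * emon F 0 (lset d)).
Proof.
have [c c0 e] := hth_emon d; exists c => //; rewrite hvecE e.
rewrite -scalerAr -!scalerAl; congr (_ *: _); rewrite -!mulrA; congr (_ * (_ * _)).
have cs : central (hs d).
  by apply: central_prod => i _; apply: central_prod => j _; apply/centralX/central_sfac.
by rewrite -(centralM (central_hll d) cs) mulrA.
Qed.

Lemma hvec_upd_l d p : idx_l d p = false -> exists2 c : F, c != 0 &
  hv (upd_l d p true) = c *: (theta F (m + m) p * hv d).
Proof.
move=> dp; have [c c0 e] := hvec_emon d; have [c' c'0 e'] := hvec_emon (upd_l d p true).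
have El : lset (upd_l d p true) = p |: lset d.
  by apply/setP => x; rewrite !inE fupdE; case: eqP.
have pl : p \notin lset d by rewrite inE dp.
pose H := hx d * hkk d * hll d * hs d.
have {}e : hv d = c *: (H * emon F 0 (lset d)) by exact: e.
have {}e' : hv (upd_l d p true) = c' *: (H * emon F 0 (p |: lset d)) by rewrite -El; exact: e'.
have cH : central H.
  apply: centralM; last first.
    by apply: central_prod => i _; apply: central_prod => j _; apply/centralX/central_sfac.
  by apply: centralM (central_hll d); apply: centralM (central_hx d) (central_hkk d).
exists (c' / (c * msgn F p (lset d))).
  by rewrite mulf_neq0 // invr_neq0 // mulf_neq0 // msgn_neq0.
have tH : theta F (m + m) p * (H * emon F 0 (lset d))
    = msgn F p (lset d) *: (H * emon F 0 (p |: lset d)).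
  by rewrite mulrA -cH -mulrA theta_emon (negPf pl) scalerAr.
rewrite e' e -scalerAr tH !scalerA; congr (_ *: _).
by rewrite -mulrA divfK // mulf_neq0 // msgn_neq0.
Qed.

End Hvec.

(** * Well-formed index data and induction on factors *)

Section WellFormed.
Variables m n : nat.
Implicit Types (d e : index_data m n).

(** What suffices for h to be harmonic, homogeneous and to have the expected leading monomial. It is
    stable under removing one factor, whereas [good] is not: removing an inner ll-factor can open a
    gap under an outer one. *)
Definition wf d : Prop :=
  [/\ forall i j : 'I_m, (0 < idx_kk d (i, j))%N -> (i < j)%N,
      forall i j : 'I_n, idx_ll d (i, j) -> (i < j)%N &
      forall t, (site d t <= 1)%N].

Lemma good_wf d : good d -> wf d.
Proof. by case=> H1 H2 H3 *; split. Qed.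

Definition meas d : nat :=
  (\sum_x idx_kk d x + \sum_x idx_s d x + \sum_x idx_ll d x)%N.

Lemma sum_fupd (T : finType) (f : {ffun T -> nat}) a c :
  (\sum_x fupd f a c x + f a = \sum_x f x + c)%N.
Proof.
rewrite (bigD1 a) //= [in RHS](bigD1 a) //= fupdE eqxx (eq_bigr (fun x => f x)).
  by move: (\sum_(x | _) f x)%N => s; lia.
by move=> x /negPf nx; rewrite fupdE nx.
Qed.

Lemma sum_fupd_bool (T : finType) (f : {ffun T -> bool}) a : f a = false ->
  (\sum_x fupd f a true x = (\sum_x f x).+1)%N.
Proof.
move=> fa; rewrite (@sumn_at _ predT a _ (fun x => nat_of_bool (f x)) 1) ?addn1 // => x.
by rewrite fupdE muln1; case: eqP => [->|_]; rewrite ?fa // addn0.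
Qed.

Lemma site_upd_s e p q t : idx_s e (p, q) = false ->
  site (upd_s e (p, q) true) t = (site e t + (t == q))%N.
Proof.
move=> s0; have H : s_at (upd_s e (p, q) true) t = (s_at e t + (t == q))%N.
  exact: (s_at_l2s s0 t).
by rewrite /site H addnA.
Qed.

Lemma site_upd_ll e (i j t : 'I_n) : (i < j)%N -> idx_ll e (i, j) = false ->
  site (upd_ll e (i, j) true) t = (site e t + (t == i) + (t == j))%N.
Proof.
move=> ij l0; have H : ll_at (upd_ll e (i, j) true) t = (ll_at e t + (t == i) + (t == j))%N.
  exact: (ll_at_l2ll ij l0 t).
by rewrite /site H -[s_at (upd_ll _ _ _) t]/(s_at e t) /=; lia.
Qed.

Lemma wf_addkk_inv e i j : wf (addkk e i j) -> wf e.
Proof.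
case=> H1 H2 H3; split=> // a b H; apply: H1.
by rewrite kk_addkk addn_gt0 H.
Qed.

Lemma wf_upd_s_inv e p q : idx_s e (p, q) = false -> wf (upd_s e (p, q) true) ->
  wf e /\ site e q = 0%N.
Proof.
move=> s0 [H1 H2 H3]; split; last by have := H3 q; rewrite (site_upd_s _ s0) eqxx; lia.
by split=> // t; have := H3 t; rewrite (site_upd_s _ s0); lia.
Qed.

Lemma wf_upd_ll_inv e (i j : 'I_n) : (i < j)%N -> idx_ll e (i, j) = false ->
  wf (upd_ll e (i, j) true) -> [/\ wf e, site e i = 0%N & site e j = 0%N].
Proof.
move=> ij l0 [H1 H2 H3]; split; first split=> //.
- by move=> a b H; apply: H2; rewrite /= fupdE H if_same.
- by move=> t; have := H3 t; rewrite (site_upd_ll _ ij l0); lia.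
- by have := H3 i; rewrite (site_upd_ll _ ij l0) eqxx; lia.
by have := H3 j; rewrite (site_upd_ll _ ij l0) eqxx; lia.
Qed.

Variant wf_spec d : Prop :=
  | WfBase of (forall x, idx_kk d x = 0%N) & (forall x, idx_s d x = false)
      & (forall x, idx_ll d x = false)
  | WfA e (i j : 'I_m) of d = addkk e i j & (i < j)%N & wf e & (meas e < meas d)%N
  | WfB e p q of d = upd_s e (p, q) true & idx_s e (p, q) = false & wf e
      & site e q = 0%N & (meas e < meas d)%N
  | WfC e (i j : 'I_n) of d = upd_ll e (i, j) true & (i < j)%N & idx_ll e (i, j) = false & wf e
      & site e i = 0%N & site e j = 0%N & (meas e < meas d)%N.

Lemma wfP d : wf d -> wf_spec d.
Proof.
move=> wd; have [H1 H2 H3] := wd.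
have [/existsP[[i j] kij]|/existsPn k0] := boolP [exists x, 0 < idx_kk d x]%N.
  pose e := upd_kk d (i, j) (idx_kk d (i, j)).-1.
  have de : d = addkk e i j.
    apply: index_data_eq => //= x; rewrite !fupdE eqxx prednK //.
    by case: eqP => // ->.
  apply: (@WfA _ e i j de (H1 _ _ kij)); first by apply: (@wf_addkk_inv e i j); rewrite -de.
  rewrite /meas /e /= !ltn_add2r -(ltn_add2r (idx_kk d (i, j))) sum_fupd ltn_add2l.
  by rewrite prednK.
have [/existsP[[p q] spq]|/existsPn s0] := boolP [exists x, idx_s d x].
  pose e := upd_s d (p, q) false.
  have de : d = upd_s e (p, q) true.
    apply: index_data_eq => //= x; rewrite !fupdE.
    by case: eqP => // ->.
  have e0 : idx_s e (p, q) = false by rewrite /= fupdE eqxx.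
  have [we se] : wf e /\ site e q = 0%N by apply: wf_upd_s_inv e0 _; rewrite -de.
  apply: (@WfB _ e p q) => //; rewrite {1}de /meas /= (sum_fupd_bool e0).
  by rewrite addnS addSn.
have [/existsP[[i j] lij]|/existsPn l0] := boolP [exists x, idx_ll d x].
  pose e := upd_ll d (i, j) false; have ij := H2 _ _ lij.
  have de : d = upd_ll e (i, j) true.
    apply: index_data_eq => //= x; rewrite !fupdE.
    by case: eqP => // ->.
  have e0 : idx_ll e (i, j) = false by rewrite /= fupdE eqxx.
  have [we si sj] : [/\ wf e, site e i = 0%N & site e j = 0%N].
    by apply: wf_upd_ll_inv ij e0 _; rewrite -de.
  apply: (@WfC _ e i j) => //; rewrite {1}de /meas /= (sum_fupd_bool e0).
  by rewrite addnS.
apply: WfBase => x; first by apply/eqP; have := k0 x; rewrite -eqn0Ngt.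
  by apply/negbTE/s0.
by apply/negbTE/l0.
Qed.

Lemma wf_ind (Pr : index_data m n -> Prop) :
  (forall d, wf d -> (forall x, idx_kk d x = 0%N) -> (forall x, idx_s d x = false) ->
    (forall x, idx_ll d x = false) -> Pr d) ->
  (forall e (i j : 'I_m), (i < j)%N -> wf e -> Pr e -> Pr (addkk e i j)) ->
  (forall e p q, idx_s e (p, q) = false -> wf e -> site e q = 0%N -> Pr e ->
    Pr (upd_s e (p, q) true)) ->
  (forall e (i j : 'I_n), (i < j)%N -> idx_ll e (i, j) = false -> wf e -> site e i = 0%N ->
    site e j = 0%N -> Pr e -> Pr (upd_ll e (i, j) true)) ->
  forall d, wf d -> Pr d.
Proof.
move=> P0 PA PB PC d; move: {2}(meas d).+1 (ltnSn (meas d)) => N.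
elim: N d => // N IH d leN wd.
have sp := wfP wd; case: sp leN wd => [k0 s0 l0|e i j -> ij we me|e p q -> s0 we sq me
  |e i j -> ij l0 we si sj me] leN wd.
- exact: P0.
- by apply: PA => //; apply: IH => //; apply: leq_trans me _; rewrite -ltnS.
- by apply: PB => //; apply: IH => //; apply: leq_trans me _; rewrite -ltnS.
by apply: PC => //; apply: IH => //; apply: leq_trans me _; rewrite -ltnS.
Qed.

End WellFormed.

(** * The h(k, l, s) are harmonic *)

Section HvecProperties.
Variables (F : numFieldType) (m n : nat).
Local Notation A := (spoly F (m + m) (n + n)).
Local Notation hv d := (hvec F d).
Implicit Types (f g h : A) (u v : 'X_{1..m + m}) (S T : {set 'I_(n + n)}).
Implicit Types (d e : index_data m n).

Lemma hvec_base d : (forall x, idx_kk d x = 0%N) -> (forall x, idx_s d x = false) ->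
  (forall x, idx_ll d x = false) ->
  exists2 c : F, c != 0 & hv d = c *: emon F (lead_u d) (lset d).
Proof.
move=> k0 s0 l0; have [c c0 e] := hvec_emon F d; exists c => //; rewrite e.
have -> : hkk F d = 1 by rewrite /hkk big1 // => i _; rewrite big1 // => j _; rewrite k0.
have -> : hll F d = 1 by rewrite /hll big1 // => i _; rewrite big1 // => j _; rewrite l0.
have -> : hs F d = 1 by rewrite /hs big1 // => i _; rewrite big1 // => j _; rewrite s0.
rewrite !mulr1; congr (_ *: _).
have -> : hx F d = \prod_(i < m + m) xvar F (n + n) i ^+ lead_u d i.
  rewrite big_split_ord /= [X in _ * X]big1 ?mulr1 => [|i _]; last first.
    by rewrite lead_uR big1 ?expr0.
  apply: eq_bigr => t _; rewrite lead_uL big1 ?addn0 // big1 ?addn0 // => q _.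
  by rewrite s0.
rewrite prod_xvar_emon add0m; congr (emon F _ _).
by rewrite [RHS]multinomUE_id.
Qed.

Definition avoid (q : 'I_n) : A -> Prop :=
  supp (fun u S => lshift n q \notin S /\ rshift n q \notin S).

Lemma avoid_subspace q : subspace (avoid q). Proof. exact: supp_subspace. Qed.

Lemma avoid_xvar q i f : avoid q f -> avoid q (xvar F (n + n) i * f).
Proof. by move=> af u S; rewrite cf_xvarM; case: ifP => _; rewrite ?eqxx // => /af. Qed.

Lemma avoid_theta q p f : pair_of p != q -> avoid q f -> avoid q (theta F (m + m) p * f).
Proof.
move=> pq af u S; rewrite cf_thetaM; case: ifP => pS; rewrite ?eqxx //.
rewrite mulf_eq0 negb_or => /andP[_ /af]; rewrite !inE !negb_and !negbK.
have -> : lshift n q == p = false.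
  by apply: contraNF pq => /eqP <-; rewrite pair_ofL.
have -> // : rshift n q == p = false.
by apply: contraNF pq => /eqP <-; rewrite pair_ofR.
Qed.

Lemma avoid_dtheta q p f : pair_of p = q -> avoid q f -> dtheta p f = 0.
Proof.
move=> pq af; apply: cf_inj => u S; rewrite cf0 cf_dtheta; case: ifP => // _.
have [->|/af[]] := eqVneq (cf f u (p |: S)) 0; first by rewrite mulr0.
rewrite !inE !negb_or -pq => /andP[+ _] /andP[+ _].
by case: (split_ordP p) => t ->; rewrite ?pair_ofL ?pair_ofR eqxx.
Qed.

Lemma hvec_avoid d q : wf d -> site d q = 0%N -> avoid q (hv d).
Proof.
move=> wd; elim/wf_ind: d / wd => [d wd k0 s0 l0|e i j ij we IH|e p t s0 we st IH
  |e i j ij l0 we si sj IH] sq.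
- have [c _ ->] := hvec_base k0 s0 l0.
  apply: (@subspaceZ F A (avoid q) c _ (avoid_subspace q)) => u S.
  rewrite cf_emon pnatr_eq0 eqb0 negbK => /andP[_ /eqP ->]; rewrite !inE.
  by move: sq => /site_eq0[+ + _ _]; case: (idx_l d _); case: (idx_l d _).
- rewrite hvec_addkk //; have := IH sq => af; rewrite /minor mulrBl -!mulrA.
  by apply: (subspaceB (avoid_subspace q)); do 2 apply: avoid_xvar.
- move: sq; rewrite (site_upd_s _ s0) => sq.
  have nqt : q != t by apply: contra_eqN sq => /eqP ->; rewrite eqxx; lia.
  have {}sq : site e q = 0%N by lia.
  have af := IH sq; rewrite hvec_upd_s // /sfac mulrBl -!mulrA.
  apply: (subspaceB (avoid_subspace q)); apply: avoid_xvar => //.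
  by do 2 (apply: avoid_theta; rewrite ?pair_ofL ?pair_ofR 1?eq_sym //).
move: sq; rewrite (site_upd_ll _ ij l0) => sq.
have nqi : q != i by apply: contra_eqN sq => /eqP ->; rewrite eqxx; lia.
have nqj : q != j by apply: contra_eqN sq => /eqP ->; rewrite eqxx; lia.
have {}sq : site e q = 0%N by lia.
have af := IH sq; rewrite hvec_upd_ll // /pdiff mulrBl -!mulrA.
by apply: (subspaceB (avoid_subspace q));
   do 2 (apply: avoid_theta; rewrite ?pair_ofL ?pair_ofR 1?eq_sym //).
Qed.

Lemma DeltaB f g : Delta (f - g) = Delta f - Delta g :> A.
Proof. by rewrite !DeltaPT linearB. Qed.

Lemma Delta_xL i f : Delta (xL F n i * f) = xL F n i * Delta f.
Proof. by rewrite !DeltaPT DeltaP_xL. Qed.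

Lemma Delta_xR i f : Delta (xR F n i * f) = xR F n i * Delta f - xL F n i * f.
Proof. by rewrite !DeltaPT DeltaP_xR scale1r. Qed.

Lemma Delta_thL j f : Delta (thL F m j * f) = thL F m j * Delta f - dtheta (rshift n j) f.
Proof. by rewrite !DeltaPT DeltaP_thL scale1r. Qed.

Lemma Delta_thR j f : Delta (thR F m j * f) = thR F m j * Delta f + dtheta (lshift n j) f.
Proof. by rewrite !DeltaPT DeltaP_thR scale1r. Qed.

Lemma Delta_minor i j f : Delta (minor F n i j * f) = minor F n i j * Delta f.
Proof.
have E g : minor F n i j * g = xL F n i * (xR F n j * g) - xL F n j * (xR F n i * g).
  by rewrite /minor mulrBl !mulrA.
have C : xL F n j * (xL F n i * f) = xL F n i * (xL F n j * f).
  exact: xvarCA.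
rewrite !E DeltaB [Delta (xL F n i * _)]Delta_xL [Delta (xL F n j * _)]Delta_xL.
rewrite [Delta (xR F n i * _)]Delta_xR [Delta (xR F n j * _)]Delta_xR.
by rewrite 2!mulrBr C opprB addrA subrK.
Qed.

(** When f is free of the pair q the correction is exactly - f. It cancels between the two terms of
    [pdiff], and in [sfac] against the correction - x_p f produced by y_p. *)
Lemma Delta_theta2 (q : 'I_n) f : avoid q f ->
  Delta (thL F m q * (thR F m q * f)) = thL F m q * (thR F m q * Delta f) - f.
Proof.
move=> af; rewrite Delta_thL Delta_thR.
rewrite (@avoid_dtheta q (lshift n q)) ?pair_ofL // addr0 dtheta_thetaM eqxx scale1r.
by rewrite (@avoid_dtheta q (rshift n q)) ?pair_ofR // mulr0 subr0.
Qed.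

Lemma Delta_pdiff i j f : avoid i f -> avoid j f ->
  Delta (pdiff F m i j * f) = pdiff F m i j * Delta f.
Proof.
have E g : pdiff F m i j * g = thL F m i * (thR F m i * g) - thL F m j * (thR F m j * g).
  by rewrite /pdiff mulrBl !mulrA.
move=> ai aj; rewrite !E DeltaB (Delta_theta2 ai) (Delta_theta2 aj).
by rewrite opprB addrA subrK.
Qed.

Lemma Delta_sfac p q f : avoid q f -> Delta (sfac F p q * f) = sfac F p q * Delta f.
Proof.
have E g : sfac F p q * g = xR F n p * g - xL F n p * (thL F m q * (thR F m q * g)).
  by rewrite /sfac mulrBl !mulrA.
move=> aq; rewrite !E DeltaB Delta_xR Delta_xL (Delta_theta2 aq) mulrBr.
by rewrite opprB addrA subrK.
Qed.

(** The even factors commute with [Delta] on what they multiply, leaving a monomial with no y and no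
    full theta pair, on which every term of [Delta] vanishes. *)
Lemma hvec_Delta d : wf d -> Delta (hv d) = 0.
Proof.
move=> wd; elim/wf_ind: d / wd => [d wd k0 s0 l0|e i j ij we IH|e p t s0 we st IH
  |e i j ij l0 we si sj IH].
- have [c _ ->] := hvec_base k0 s0 l0; rewrite DeltaPT linearZ /=.
  have -> : DeltaP predT predT (emon F (lead_u d) (lset d)) = 0; last by rewrite scaler0.
  apply: supp_false => u S /cf_DeltaP_neq0[[i _ [_]]|[j _ [lS rS]]].
    rewrite cf_emon pnatr_eq0 eqb0 negbK => /andP[/eqP e _].
    have := congr1 (fun w : 'X_{1..m + m} => w (rshift m i)) e.
    by rewrite lead_uR big1 // -/(up_u u i) up_uR eqxx addn1.
  rewrite cf_emon pnatr_eq0 eqb0 negbK => /andP[_ /eqP e].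
  have [_ _ /(_ j)] := wd; rewrite /site.
  have : lshift n j \in lset d by rewrite -e !inE eqxx.
  have : rshift n j \in lset d by rewrite -e !inE eqxx orbT.
  by rewrite !inE => -> ->.
- by rewrite hvec_addkk // Delta_minor IH mulr0.
- by rewrite hvec_upd_s // Delta_sfac ?IH ?mulr0 //; apply: hvec_avoid.
by rewrite hvec_upd_ll // Delta_pdiff ?IH ?mulr0 //; apply: hvec_avoid.
Qed.

End HvecProperties.

(** * Degrees and leading monomials of the h(k, l, s) *)

Section HvecLead.
Variables (F : numFieldType) (m n : nat).
Local Notation A := (spoly F (m + m) (n + n)).
Local Notation hv d := (hvec F d).
Implicit Types (f g h : A) (u v : 'X_{1..m + m}) (S T : {set 'I_(n + n)}).
Implicit Types (d e : index_data m n).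

Lemma index_degree_upd_s e p q : idx_s e (p, q) = false ->
  index_degree (upd_s e (p, q) true) = index_degree e + 1.
Proof.
move=> s0; rewrite /index_degree /=.
rewrite [in LHS](@sumn_at _ predT p _ (fun a => \sum_(b < n) idx_s e (a, b))%N 1).
  by rewrite muln1 PoszD /=; ring.
move=> a; rewrite (@sumn_at _ predT q _ (fun b => nat_of_bool (idx_s e (a, b))) (a == p)).
  by rewrite mul1n muln1.
move=> b; rewrite fupdE xpair_eqE andbC mulnb.
by case: (b =P q) => [->|_] /=; rewrite ?addn0 //; case: (a =P p) => [->|_]; rewrite ?s0 ?addn0.
Qed.

Lemma index_degree_upd_ll e (i j : 'I_n) : (i < j)%N -> idx_ll e (i, j) = false ->
  index_degree (upd_ll e (i, j) true) = index_degree e + 2.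
Proof.
move=> ij l0; rewrite /index_degree /=.
rewrite [X in _ + 2 * X%:Z + _ - _ = _](@sumn_at _ predT i _ (fun a => \sum_(b < n | a < b) idx_ll e (a, b))%N 1).
  by rewrite muln1 PoszD /=; ring.
move=> a; rewrite (@sumn_at _ (fun b : 'I_n => a < b)%N j _
  (fun b => nat_of_bool (idx_ll e (a, b))) (a == i)).
  by rewrite muln1; case: (a =P i) => [->|_]; rewrite ?ij ?muln0.
move=> b; rewrite fupdE xpair_eqE andbC mulnb.
by case: (b =P j) => [->|_] /=; rewrite ?addn0 //; case: (a =P i) => [->|_]; rewrite ?l0 ?addn0.
Qed.

Lemma kgrade_minor i j : kgrade 0 (minor F n i j : A).
Proof.
have xL0 (a : 'I_m) : kgrade (- 1) (xL F n a : A) by exact: kgrade_xL.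
have xR0 (a : 'I_m) : kgrade 1 (xR F n a : A) by exact: kgrade_xR.
apply: (subspaceB (@kgrade_subspace F m n 0)).
  exact: (kgradeM (xL0 i) (xR0 j)).
exact: (kgradeM (xL0 j) (xR0 i)).
Qed.

Lemma kgrade_pdiff i j : kgrade 2 (pdiff F m i j : A).
Proof.
have th p : kgrade 1 (theta F (m + m) p : A) by exact: kgrade_theta.
apply: (subspaceB (@kgrade_subspace F m n 2)).
  exact: (kgradeM (th _) (th _)).
exact: (kgradeM (th _) (th _)).
Qed.

Lemma kgrade_sfac p q : kgrade 1 (sfac F p q : A).
Proof.
have xL0 (a : 'I_m) : kgrade (- 1) (xL F n a : A) by exact: kgrade_xL.
have th p' : kgrade 1 (theta F (m + m) p' : A) by exact: kgrade_theta.
apply: (subspaceB (@kgrade_subspace F m n 1)); first exact: kgrade_xR.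
exact: (kgradeM (kgradeM (xL0 p) (th _)) (th _)).
Qed.

Lemma hvec_kgrade d : wf d -> kgrade (index_degree d) (hv d).
Proof.
move=> wd; elim/wf_ind: d / wd => [d wd k0 s0 l0|e i j ij we IH|e p t s0 we st IH
  |e i j ij l0 we si sj IH].
- have [c _ ->] := hvec_base F k0 s0 l0.
  apply: (@subspaceZ F A _ c _ (@kgrade_subspace F m n _)).
  suff -> : index_degree d = kdeg (lead_u d) (lset d) by exact: kgrade_emon.
  rewrite /index_degree /kdeg card_pairs.
  rewrite [X in 2 * X%:Z]big1 => [|i _]; last by rewrite big1 // => j _; rewrite l0.
  rewrite [X in _ + _ + X%:Z]big1 => [|i _]; last by rewrite big1 // => j _; rewrite s0.
  rewrite [X in _ = _ + X]big1 => [|i _]; last by rewrite lead_uR big1.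
  rewrite mulr0 !addr0 -(big_morph Posz PoszD (erefl _)); congr (_%:Z - _%:Z).
    by apply: eq_bigr => j _; rewrite !inE.
  apply: eq_bigr => t _; rewrite lead_uL big1 ?addn0 // big1 ?addn0 // => q _.
  by rewrite s0.
- rewrite hvec_addkk // -[index_degree (addkk e i j)]/(index_degree e) -[index_degree e]add0r.
  exact: (kgradeM (@kgrade_minor i j) IH).
- rewrite hvec_upd_s // index_degree_upd_s // addrC.
  exact: (kgradeM (@kgrade_sfac p t) IH).
rewrite hvec_upd_ll // index_degree_upd_ll // addrC.
exact: (kgradeM (@kgrade_pdiff i j) IH).
Qed.

(* The weight of a monomial: y_i counts m - i and theta_q (q < n) counts       *)
(* m + 1 + q, so that each factor of [hvec] has a single heaviest monomial.    *)
Definition wtx (i : 'I_(m + m)) : nat :=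
  match split i with inl _ => 0 | inr i => (m - i)%N end.
Definition wtth (p : 'I_(n + n)) : nat :=
  match split p with inl q => (m + q.+1)%N | inr _ => 0 end.
Definition mwt u S : nat := (\sum_i u i * wtx i + \sum_(p in S) wtth p)%N.

Lemma wtxL i : wtx (lshift m i) = 0%N. Proof. by rewrite /wtx split_lshift. Qed.
Lemma wtxR i : wtx (rshift m i) = (m - i)%N. Proof. by rewrite /wtx split_rshift. Qed.
Lemma wtthL q : wtth (lshift n q) = (m + q.+1)%N. Proof. by rewrite /wtth split_lshift. Qed.
Lemma wtthR q : wtth (rshift n q) = 0%N. Proof. by rewrite /wtth split_rshift. Qed.

Lemma mwt_addU u S i : mwt (u + U_(i)) S = (mwt u S + wtx i)%N.
Proof.
rewrite /mwt (@sumn_at _ predT i _ (fun j => u j * wtx j)%N (wtx i)).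
  by rewrite mul1n addnAC.
move=> j; rewrite mnmDE mnm1E mulnDl eq_sym.
by case: eqVneq => [->|_]; rewrite ?mul1n.
Qed.

Lemma mwt_setU1 u S p : p \notin S -> mwt u (p |: S) = (mwt u S + wtth p)%N.
Proof. by move=> pS; rewrite /mwt big_setU1 //= addnA addnAC. Qed.

Definition lead_of f u S : Prop := cf f u S != 0 /\
  forall v T, cf f v T != 0 -> (v = u /\ T = S) \/ (mwt v T < mwt u S)%N.

Definition mwt_lt f (c : nat) : Prop := supp (fun v T => mwt v T < c)%N f.

Lemma lead_of_lt f u S c : lead_of f u S -> (mwt u S < c)%N -> mwt_lt f c.
Proof. by case=> _ H lt v T /H[[-> ->]//|lt']; apply: ltn_trans lt' lt. Qed.

Lemma lead_of_xvar f u S i : lead_of f u S ->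
  lead_of (xvar F (n + n) i * f) (u + U_(i))%MM S.
Proof.
case=> nz H; split=> [|v T]; first by rewrite cf_xvarMD.
rewrite cf_xvarM; case: ifP => [vi|_]; last by rewrite eqxx.
have vE : v = (v - U_(i) + U_(i))%MM.
  by rewrite submK //; apply/mnm_lepP => x; rewrite mnm1E; case: eqP => // <-.
move=> /H[[uE ->]|lt]; first by left; rewrite vE uE.
by right; rewrite vE !mwt_addU ltn_add2r.
Qed.

Lemma lead_of_theta f u S p : p \notin S -> lead_of f u S ->
  lead_of (theta F (m + m) p * f) u (p |: S).
Proof.
move=> pS [nz H]; split=> [|v T].
  by rewrite cf_thetaM setU11 setU1K // mulf_neq0 // msgn_neq0.
rewrite cf_thetaM; case: ifP => [pT|_]; last by rewrite eqxx.
rewrite mulf_eq0 negb_or => /andP[_ /H[[-> TS]|lt]].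
  by left; rewrite -TS setD1K.
right; rewrite -(setD1K pT) !mwt_setU1 ?ltn_add2r //.
by rewrite !inE eqxx.
Qed.

Lemma lead_ofB f g u S : lead_of f u S -> mwt_lt g (mwt u S) -> lead_of (f - g) u S.
Proof.
case=> nz H lt; split=> [|v T].
  rewrite cfB; have [->|/lt] := eqVneq (cf g u S) 0; first by rewrite subr0.
  by rewrite ltnn.
rewrite cfB; have [->|/lt lt'] := eqVneq (cf g v T) 0; first by rewrite subr0 => /H.
by move=> _; right.
Qed.

Lemma lead_ofN f u S : lead_of f u S -> lead_of (- f) u S.
Proof. by case=> nz H; split=> [|v T]; rewrite cfN oppr_eq0 => // /H. Qed.

Lemma lead_ofZ c f u S : c != 0 -> lead_of f u S -> lead_of (c *: f) u S.
Proof.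
move=> c0 [nz H]; split=> [|v T]; rewrite cfZ mulf_eq0 negb_or ?c0 //=.
by move/H.
Qed.

Lemma site0_lead d t : wf d -> site d t = 0%N -> none (lead_S d) t.
Proof.
move=> [_ H2 _] /site_eq0[Hl Hr Hs Hll]; rewrite none_lead.
case: (idx_l d _) Hl => // _; case: (idx_l d _) Hr => // _ /=.
rewrite negb_or !negb_exists; apply/andP; split; apply/forallP => x; apply/negP => H.
  by have := ll_at_gt0R H (H2 _ _ H); rewrite Hll.
by have := s_at_gt0 H; rewrite Hs.
Qed.

(** Each factor is a difference whose chosen term is strictly heavier than the other, so multiplying
    by it keeps a unique heaviest monomial; only nonvanishing of its coefficient is recorded. *)
Lemma hvec_lead d : wf d -> lead_of (hv d) (lead_u d) (lead_S d).
Proof.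
move=> wd; elim/wf_ind: d / wd => [d wd k0 s0 l0|e i j ij we IH|e p q s0 we sq IH
  |e i j ij l0 we si sj IH].
- have [c c0 ->] := hvec_base F k0 s0 l0; apply: lead_ofZ => //.
  have -> : lset d = lead_S d.
    apply/setP => x; rewrite !inE (_ : is_top d _ = false) ?orbF //.
    apply/negbTE; rewrite negb_or !negb_exists; apply/andP.
    by split; apply/forallP => a; rewrite ?l0 ?s0.
  split=> [|v T]; rewrite cf_emon pnatr_eq0 eqb0 negbK ?eqxx //.
  by move=> /andP[/eqP -> /eqP ->]; left.
- rewrite hvec_addkk // lead_u_addkk lead_S_addkk.
  rewrite (_ : minor F n i j * hv e = - (xL F n j * (xR F n i * hv e) - xL F n i * (xR F n j * hv e))).
    apply: lead_ofN; apply: lead_ofB; first by do 2 apply: lead_of_xvar.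
    apply: (lead_of_lt (u := (lead_u e + U_(rshift m j) + U_(lshift m i))%MM) (S := lead_S e)).
      by do 2 apply: lead_of_xvar.
    (* For i < j < m the variable y_i outweighs y_j, since m - j < m - i. *)
    rewrite !mwt_addU !wtxL !wtxR !addn0 ltn_add2l; have := ltn_ord j; lia.
  by rewrite /minor mulrBl !mulrA opprB.
- have nq := site0_lead we sq; have [lq rq] := andP nq.
  rewrite hvec_upd_s //.
  have -> : lead_u (upd_s e (p, q) true) = (lead_u e + U_(lshift m p))%MM.
    exact: (lead_u_l2s s0).
  have topE t : is_top (upd_s e (p, q) true) t = (t == q) || is_top e t.
    exact: (is_top_l2s e p q t).
  have -> : lead_S (upd_s e (p, q) true) = lshift n q |: (rshift n q |: lead_S e).
    apply/setP => x; rewrite !in_setU1; case: (split_ordP x) => t ->.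
      by rewrite !lead_SL topE /= eq_lshift eq_lrshift /= orbCA.
    by rewrite !lead_SR topE /= eq_rlshift eq_rshift /= orbCA.
  rewrite (_ : sfac F p q * hv e = - (xL F n p * (thL F m q * (thR F m q * hv e)) - xR F n p * hv e)).
    have lq' : lshift n q \notin rshift n q |: lead_S e by rewrite in_setU1 eq_lrshift.
    apply: lead_ofN; apply: lead_ofB.
      by apply: lead_of_xvar; apply: lead_of_theta => //; apply: lead_of_theta.
    apply: (lead_of_lt (u := (lead_u e + U_(rshift m p))%MM) (S := lead_S e)).
      exact: lead_of_xvar.
    (* The theta pair at q has weight m + q + 1, more than the weight m - p of y_p. *)
    by rewrite !mwt_addU !mwt_setU1 // wtxL wtxR wtthL wtthR !addn0 ltn_add2l; lia.
  by rewrite /sfac mulrBl !mulrA opprB.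
have [li ri] := andP (site0_lead we si); have [lj rj] := andP (site0_lead we sj).
rewrite hvec_upd_ll //.
have topE t : is_top (upd_ll e (i, j) true) t = (t == j) || is_top e t.
  exact: (is_top_l2ll e i j t).
rewrite -[lead_u (upd_ll e (i, j) true)]/(lead_u e).
have -> : lead_S (upd_ll e (i, j) true) = lshift n j |: (rshift n j |: lead_S e).
  apply/setP => x; rewrite !in_setU1; case: (split_ordP x) => t ->.
    by rewrite !lead_SL topE /= eq_lshift eq_lrshift /= orbCA.
  by rewrite !lead_SR topE /= eq_rlshift eq_rshift /= orbCA.
have lj' : lshift n j \notin rshift n j |: lead_S e by rewrite in_setU1 eq_lrshift.
have li' : lshift n i \notin rshift n i |: lead_S e by rewrite in_setU1 eq_lrshift.
rewrite (_ : pdiff F m i j * hv e = - (thL F m j * (thR F m j * hv e) - thL F m i * (thR F m i * hv e))).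
  apply: lead_ofN; apply: lead_ofB.
    by apply: lead_of_theta => //; apply: lead_of_theta.
  apply: (lead_of_lt (u := lead_u e) (S := lshift n i |: (rshift n i |: lead_S e))).
    by apply: lead_of_theta => //; apply: lead_of_theta.
  rewrite !mwt_setU1 // !wtthL !wtthR !addn0 ltn_add2l; lia.
by rewrite /pdiff mulrBl !mulrA opprB.
Qed.

End HvecLead.

(** * Linear independence and spanning *)

Section BasisTheorem.
Variables (F : numFieldType) (m n : nat).
Local Notation A := (spoly F (m + m) (n + n)).
Local Notation hv d := (hvec F d).
Implicit Types (f g h : A) (u v : 'X_{1..m + m}) (S T : {set 'I_(n + n)}).
Implicit Types (d e : index_data m n).

Lemma ballot_dec u S : ballot u S \/ ~ ballot u S.
Proof.
pose b1 := [forall i : 'I_m, (\sum_(a < m | i <= a) u (rshift m a)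
  <= \sum_(a < m | i < a) u (lshift m a))%N].
pose b2 := [forall j : 'I_n, (\sum_a u (rshift m a) + \sum_(t < n | t <= j) both S t
  <= \sum_a u (lshift m a) + \sum_(t < n | t <= j) none S t)%N].
case: (boolP b1) => [/forallP H1|/forallPn[i /negP H1]]; last by right; case=> H _; exact: H1.
case: (boolP b2) => [/forallP H2|/forallPn[i /negP H2]]; last by right; case=> _ H; exact: H2.
by left.
Qed.

Lemma hvec_Hk d : wf d -> Hk (index_degree d) (hv d).
Proof. by move=> wd; split; [apply/AkE/hvec_kgrade | apply: hvec_Delta]. Qed.

(** Take t with heaviest leading monomial among the nonzero c t. No other term contributes to that
    coefficient: it would need the same leading monomial, hence by [lead_inj] the same index
    data. *)
Lemma hvec_lin_indep k :
  lin_indep (fun d : index_data m n => in_I d /\ index_degree d = k) (@hvec F m n).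
Proof.
move=> N i c inj_i Pi sum0; have gi t : good (i t) by apply/in_IP; case: (Pi t).
have c0P : [forall t, c t == 0].
  apply: contraT; rewrite negb_forall => /existsP[t0 ct0].
  pose w t := mwt (lead_u (i t)) (lead_S (i t)).
  case: (@arg_maxnP _ t0 (fun t => c t != 0) w ct0) => t ct max.
  have := congr1 (fun f => cf f (lead_u (i t)) (lead_S (i t))) sum0.
  rewrite cf_sum cf0 (bigD1 t) //= big1 ?addr0.
    rewrite cfZ => /eqP; rewrite mulf_eq0 (negPf ct) /=.
    by have [/negPf ->] := hvec_lead F (good_wf (gi t)).
  move=> s nst; rewrite cfZ; have [->|cs] := eqVneq (c s) 0; first by rewrite mul0r.
  have [->|nz] := eqVneq (cf (hv (i s)) (lead_u (i t)) (lead_S (i t))) 0.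
    by rewrite mulr0.
  have [_ H] := hvec_lead F (good_wf (gi s)); case: (H _ _ nz) => [[eu eS]|lt].
    by move: nst; rewrite (inj_i _ _ (lead_inj (gi t) (gi s) eu eS)) eqxx.
  by have := leq_trans lt (max _ cs); rewrite ltnn.
by move=> t; apply/eqP; have := forallP c0P t.
Qed.

Let B k : A -> Prop := in_span (fun f => exists2 d : index_data m n,
  in_I d /\ index_degree d = k & f = hv d).

Lemma supp_seq f : exists s : seq ('X_{1..m + m} * {set 'I_(n + n)}),
  supp (fun u S => (u, S) \in s) f.
Proof.
exists (flatten [seq [seq (u, T) | u <- msupp (f T)] | T <- enum {set 'I_(n + n)}]).
move=> u S nz; apply/flattenP; exists [seq (u, S) | u <- msupp (f S)].
  by apply/mapP; exists S; rewrite ?mem_enum.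
by apply/mapP; exists u; rewrite // mcoeff_msupp.
Qed.

(** Elimination controlled by ballot monomials only: the outer induction bounds their weight, the
    inner one lists those of the top weight W. Once none is left the element is zero by
    [kernel_ballot], whatever other monomials could occur. *)
Lemma Hk_in_span k f : Hk k f -> B k f.
Proof.
have [W] := supp_bounded (fun u S => mwt u S) f.
move=> fW; have {fW} : supp (fun u S => ballot u S -> (mwt u S < W)%N) f by move=> u S /fW.
elim: W f => [|W IHW] f fW Hf.
  have [->|f0] := eqVneq f 0; first by apply (in_span_subspace _).1.
  have [u [S [nz bu]]] := kernel_ballot f0 (proj2 Hf).
  by have := fW u S nz bu.
have [s fs] : exists s : seq ('X_{1..m + m} * {set 'I_(n + n)}),
    supp (fun u S => ballot u S -> (mwt u S < W)%N \/ (mwt u S = W /\ (u, S) \in s)) f.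
  have [s fs] := supp_seq f; exists s => u S nz bu.
  have := fW u S nz bu; rewrite ltnS leq_eqVlt => /orP[/eqP|]; last by left.
  by right; split; last exact: fs.
elim: s f {fW} Hf fs => [|[u S] s IHs] f Hf fs.
  apply: IHW => // u S nz bu.
  by case: (fs u S nz bu) => [//|[_]]; rewrite in_nil.
have drop v T : (v, T) <> (u, S) -> (v, T) \in (u, S) :: s -> (v, T) \in s.
  by move=> ne; rewrite inE => /orP[/eqP //|].
have [c0|nz] := eqVneq (cf f u S) 0.
  apply: IHs => // v T nzv bv; case: (fs v T nzv bv) => [|[we]]; first by left.
  move=> ins; right; split=> //; apply: drop ins => -[ev eT].
  by move: nzv; rewrite ev eT c0 eqxx.
case: (ballot_dec u S) => [bu|nb]; last first.
  apply: IHs => // v T nzv bv; case: (fs v T nzv bv) => [|[we]]; first by left.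
  move=> ins; right; split=> //; apply: drop ins => -[ev eT].
  by apply: nb; rewrite -ev -eT.
have [d gd [eu eS]] := lead_exists bu; have wd := good_wf gd.
have [nzd Hd] := hvec_lead F wd; rewrite eu eS in nzd Hd.
(* The leading monomial of this h also occurs in f, so both have degree k. *)
have dk : index_degree d = k.
  by rewrite -(hvec_kgrade wd nzd); apply: (proj1 (AkE k f) (proj1 Hf)).
have Bd : B k (hv d) by apply: in_span_incl; exists d => //; split=> //; apply/in_IP.
pose a := cf f u S / cf (hv d) u S.
have -> : f = (f - a *: hv d) + a *: hv d by rewrite subrK.
apply: subspaceD; first exact: in_span_subspace; last first.
  by apply: subspaceZ => //; exact: in_span_subspace.
apply: IHs.
  apply: (subspaceB (@Hk_subspace F m n k)) => //.
  by apply: (subspaceZ _ (@Hk_subspace F m n k)); rewrite -dk; apply: hvec_Hk.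
have z0 : cf (f - a *: hv d) u S = 0 by rewrite cfB cfZ divfK ?subrr.
have wu : (mwt u S <= W)%N by case: (fs u S nz bu) => [/ltnW //|[-> //]].
move=> v T nzv bv; have ne : (v, T) <> (u, S).
  by move=> [ev eT]; move: nzv; rewrite ev eT z0 eqxx.
(* Subtracting the multiple of h may create ballot monomials, but only strictly lighter ones. *)
have [h0|hnz] := eqVneq (cf (hv d) v T) 0; last first.
  case: (Hd v T hnz) => [[ev eT]|lt]; first by case: ne; rewrite ev eT.
  by left; apply: leq_trans lt wu.
move: nzv; rewrite cfB cfZ h0 mulr0 subr0 => nzv.
case: (fs v T nzv bv) => [|[we ins]]; first by left.
by right; split=> //; apply: drop ins.
Qed.

Theorem hvec_basis k :
  is_basis (fun d : index_data m n => in_I d /\ index_degree d = k)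
    (@hvec F m n) (@Hk F m n k).
Proof.
split; first exact: hvec_lin_indep.
move=> f; split; first exact: Hk_in_span.
apply: in_span_min; first exact: Hk_subspace.
by move=> _ [d [/in_IP gd <-] ->]; apply/hvec_Hk/good_wf.
Qed.

End BasisTheorem.

(** * Generation by the highest weight vector *)

Section Generation.
Variables (F : numFieldType) (m n : nat).
Local Notation A := (spoly F (m + m) (n + n)).
Local Notation hv d := (hvec F d).
Implicit Types (f g h : A) (u v : 'X_{1..m + m}) (S T : {set 'I_(n + n)}).
Implicit Types (d e : index_data m n).

Lemma dtheta_emon p u S : dtheta p (emon F u S : A) =
  if p \in S then msgn F p S *: emon F u (S :\ p) else 0.
Proof.
apply: cf_inj => v T; rewrite cf_dtheta cf_emon; case: ifPn => pT.
  case: ifPn => pS; rewrite ?cf0 // cfZ cf_emon.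
  rewrite (_ : T == _ = false) ?andbF ?mulr0 //.
  by apply: contraTF pT => /eqP ->; rewrite !inE eqxx.
case: ifPn => pS; last first.
  rewrite cf0 (_ : p |: T == S = false) ?andbF ?mulr0 //.
  by apply: contraNF pS => /eqP <-; rewrite !inE eqxx.
rewrite cfZ cf_emon; case: eqVneq => [_|]; rewrite ?mulr0 // !andTb.
have -> : (p |: T == S) = (T == S :\ p).
  by apply/eqP/eqP => [<-|->]; rewrite ?setU1K ?setD1K.
by case: eqVneq => [->|]; rewrite ?mulr0 // msgnD1.
Qed.

Lemma dx_emon i u S : u i = 0%N -> dx i (emon F u S : A) = 0.
Proof.
move=> u0; apply: cf_inj => v T; rewrite cf0 cf_dx cf_emon.
case: (u =P _) => [e|_]; last by rewrite mul0rn.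
by move: u0; rewrite e mnmDE mnm1E eqxx addn1.
Qed.

Lemma dx_emonD i u S : dx i (emon F (u + U_(i))%MM S : A) = (u i).+1%:R *: emon F u S.
Proof.
apply: cf_inj => v T; rewrite cf_dx cfZ !cf_emon.
have -> : (u + U_(i) == v + U_(i))%MM = (u == v).
  by apply/eqP/eqP => [/addIm|->].
by case: eqVneq => [->|_]; rewrite ?mul0rn ?mulr0 // mulr_natl.
Qed.

Lemma submoduleZ (U : A -> Prop) c f : submodule U -> c != 0 -> U (c *: f) -> U f.
Proof.
move=> [sU _] c0 Uf; rewrite -[f]scale1r -(mulVf c0) -scalerA.
exact: (subspaceZ _ sU).
Qed.

Lemma wf_upd_l e p : wf e -> idx_l e p = false -> site e (pair_of p) = 0%N ->
  wf (upd_l e p true) /\ index_degree (upd_l e p true) = index_degree e + 1.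
Proof.
move=> [H1 H2 H3] lp sp.
have lE t : (idx_l (upd_l e p true) (lshift n t) + idx_l (upd_l e p true) (rshift n t)
    = idx_l e (lshift n t) + idx_l e (rshift n t) + (t == pair_of p) * 1)%N.
  rewrite /= !fupdE; case: (split_ordP p) lp => q -> lp.
    rewrite eq_lshift eq_rlshift pair_ofL.
    by case: eqVneq => [->|_] /=; rewrite ?lp ?addn0 // addnC.
  rewrite eq_rshift eq_lrshift pair_ofR.
  by case: eqVneq => [->|_] /=; rewrite ?lp ?addn0.
split.
  split=> // t; rewrite /site lE; case: eqVneq => [->|_].
    by move: sp; rewrite /site -[ll_at (upd_l _ _ _) _]/(ll_at e _) -[s_at (upd_l _ _ _) _]/(s_at e _); lia.
  by rewrite addn0; apply: H3.
rewrite /index_degree (@sumn_at _ predT (pair_of p) _ _ 1 lE) muln1 PoszD /=; ring.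
Qed.

Section Submodule.
Variables (U : A -> Prop) (k : int).
Hypothesis sU : submodule U.

(** Each even factor is produced by an element of osp from an h with fewer of them: C multiplies by
    a minor, K turns theta_q into [sfac p q], and D turns theta_j theta_(n+i) into [pdiff i j],
    without changing the degree. The intermediate index data may leave I, which is why the induction
    runs over [wf]. *)
Lemma gen_base :
  (forall d, wf d -> (forall x, idx_kk d x = 0%N) -> (forall x, idx_s d x = false) ->
    (forall x, idx_ll d x = false) -> index_degree d = k -> U (hv d)) ->
  forall d, wf d -> index_degree d = k -> U (hv d).
Proof.
move=> base d; move: {2}(meas d).+1 (ltnSn (meas d)) => N.
elim: N d => // N IH d leN wd dk; have sp := wfP wd.
case: sp leN wd dk => [k0 s0 l0|e i j -> ij we me|e p q -> s0 we sq me
  |e i j -> ij l0 we si sj me] leN wd dk; first exact: base.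
- have Ue : U (hv e) by apply: IH => //; apply: leq_trans me _; rewrite -ltnS.
  have := submodule_op (GenC n i j) sU Ue; rewrite /= hvec_addkk // /minor mulrBl -!mulrA.
  by rewrite [xR F n j * (xL F n i * hv e)]xvarCA [xR F n i * (xL F n j * hv e)]xvarCA.
- have lq : idx_l e (lshift n q) = false.
    by have [+ _ _ _] := (site_eq0 e q).1 sq; case: (idx_l e _).
  have pq : pair_of (lshift n q) = q by rewrite pair_ofL.
  have [we' de'] := @wf_upd_l e (lshift n q) we lq (etrans (congr1 (site e) pq) sq).
  have Ue : U (hv (upd_l e (lshift n q) true)).
    apply: IH => //; last by rewrite de' -(index_degree_upd_s s0).
    by apply: leq_trans me _; rewrite -ltnS.
  have [c c0 ce] := hvec_upd_l F lq; rewrite ce in Ue.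
  have {}Ue : U (thL F m q * hv e) by apply: submoduleZ Ue.
  have := submodule_op (GenK p q) sU Ue; rewrite /= hvec_upd_s //.
  have av := @hvec_avoid F m n e q we sq.
  rewrite dtheta_thetaM eqxx scale1r (@avoid_dtheta F m n q (lshift n q)) // mulr0 subr0.
  have -> : sfac F p q * hv e = xR F n p * hv e - xL F n p * (thL F m q * (thR F m q * hv e)).
    by rewrite /sfac mulrBl !mulrA.
  have -> : thR F m q * (xL F n p * (thL F m q * hv e))
      = - (xL F n p * (thL F m q * (thR F m q * hv e))).
    by rewrite xvarCA theta_thetaM mulrN.
  by [].
have lj : idx_l e (lshift n j) = false.
  by have [+ _ _ _] := (site_eq0 e j).1 sj; case: (idx_l e _).
have ri : idx_l e (rshift n i) = false.
  by have [_ + _ _] := (site_eq0 e i).1 si; case: (idx_l e _).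
have pj : pair_of (lshift n j) = j by rewrite pair_ofL.
have pi : pair_of (rshift n i) = i by rewrite pair_ofR.
have [we1 de1] := @wf_upd_l e (rshift n i) we ri (etrans (congr1 (site e) pi) si).
pose e1 := upd_l e (rshift n i) true.
have nij : j != i by rewrite neq_ltn ij orbT.
have lj1 : idx_l e1 (lshift n j) = false by rewrite /= fupdE eq_lrshift.
have sj1 : site e1 (pair_of (lshift n j)) = 0%N.
  move: sj; rewrite pj /site /= !fupdE eq_lrshift eq_rshift (negPf nij).
  by [].
have [we2 de2] := wf_upd_l we1 lj1 sj1.
have Ue : U (hv (upd_l e1 (lshift n j) true)).
  apply: IH => //; first by apply: leq_trans me _; rewrite -ltnS.
  by rewrite de2 de1 -addrA -(index_degree_upd_ll ij l0).
have [c c0 ce] := hvec_upd_l F lj1; rewrite {}ce in Ue.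
have [c1 c10 ce] := hvec_upd_l F ri; rewrite -/e1 in ce.
have {}Ue : U (thL F m j * (thR F m i * hv e)).
  apply: (submoduleZ sU c10); rewrite scalerAr -ce; exact: (submoduleZ sU c0 Ue).
have := submodule_op (GenD m i j) sU Ue; rewrite /= hvec_upd_ll //.
have ai := @hvec_avoid F m n e i we si; have aj := @hvec_avoid F m n e j we sj.
have -> : dtheta (lshift n j) (thL F m j * (thR F m i * hv e)) = thR F m i * hv e.
  rewrite dtheta_thetaM eqxx scale1r dtheta_thetaM eq_lrshift scale0r sub0r.
  by rewrite (@avoid_dtheta F m n j (lshift n j)) // mulr0 oppr0 mulr0 subr0.
have -> : dtheta (rshift n i) (thL F m j * (thR F m i * hv e)) = - (thL F m j * hv e).
  rewrite dtheta_thetaM eq_rlshift scale0r sub0r dtheta_thetaM eqxx scale1r.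
  by rewrite (@avoid_dtheta F m n i (rshift n i)) // mulr0 subr0.
have -> : pdiff F m i j * hv e = thL F m i * (thR F m i * hv e) - thL F m j * (thR F m j * hv e).
  by rewrite /pdiff mulrBl !mulrA.
by rewrite mulrN opprK [thR F m j * (thL F m j * _)]theta_thetaM.
Qed.

End Submodule.
End Generation.

(** * Generating the reduced monomials from the top one *)

Section TopMonomial.
Variables (F : numFieldType) (m n : nat).
Local Notation A := (spoly F (m + m) (n + n)).
Implicit Types (f g h : A) (u v : 'X_{1..m + m}) (S T : {set 'I_(n + n)}).

(** The shape of the monomials h(k, l, s) having no minor, s- or ll-factor. *)
Definition reduced u S : Prop :=
  (forall i, u (rshift m i) = 0%N) /\ (forall t, ~~ both S t).

Definition first_thetas (k : nat) : {set 'I_(n + n)} :=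
  [set p | match split p with inl j => (j < k)%N | inr _ => false end].

Lemma first_thetasL k j : (lshift n j \in first_thetas k) = (j < k)%N.
Proof. by rewrite inE split_lshift. Qed.

Lemma first_thetasR k j : (rshift n j \in first_thetas k) = false.
Proof. by rewrite inE split_rshift. Qed.

Lemma card_first_thetas k : (k <= n)%N -> #|first_thetas k| = k.
Proof.
move=> kn; have -> : first_thetas k = @lshift n n @: [set j : 'I_n | (j < k)%N].
  apply/setP => p; case: (split_ordP p) => j ->; rewrite ?first_thetasL ?first_thetasR.
    by rewrite (mem_imset _ _ (@lshift_inj _ _)) inE.
  by symmetry; apply/negbTE/negP => /imsetP[i _ /eqP]; rewrite eq_rlshift.
rewrite card_imset; last exact: lshift_inj.
rewrite -[RHS]card_ord -sum1_card -[RHS]sum1_card (@big_ord_widen _ _ _ k n (fun=> 1%N)) //.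
by apply: eq_bigl => j; rewrite inE.
Qed.

(** The index i is a parameter: generation works from a power of any x_i, while the highest weight
    vector takes the last one. *)
Definition top_u (k : int) (i : 'I_m) : 'X_{1..m + m} :=
  if k <= 0 then (U_(lshift m i) *+ `|k|)%MM else 0%MM.

Definition top_S (k : int) : {set 'I_(n + n)} := if k <= 0 then set0 else first_thetas `|k|.

Lemma top_uR k i j : top_u k i (rshift m j) = 0%N.
Proof.
by rewrite /top_u; case: ifP => _; rewrite ?mnm0E // mulmnE mnm1E eq_lrshift.
Qed.

Lemma top_both k t : ~~ both (top_S k) t.
Proof.
by rewrite /both /top_S; case: ifP => _; rewrite ?first_thetasR ?andbF // inE.
Qed.

Lemma kdeg_reduced u S : reduced u S ->
  kdeg u S = #|S|%:Z - (\sum_(i < m) u (lshift m i))%N%:Z.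
Proof.
move=> [uR _]; rewrite /kdeg [X in _ + X]big1 ?addr0 => [|i _]; last by rewrite uR.
by rewrite (big_morph Posz PoszD (erefl _)).
Qed.

Lemma top_kdeg k i : k <= n%:Z -> kdeg (top_u k i) (top_S k) = k.
Proof.
move=> kn; rewrite kdeg_reduced; last by split=> *; rewrite ?top_uR ?top_both.
rewrite /top_u /top_S; case: ifPn => k0.
  rewrite cards0 (bigD1 i) //= mulmnE mnm1E eqxx big1 => [|j /negPf nj].
    by rewrite mul1n addn0; lia.
  by rewrite mulmnE mnm1E eq_lshift eq_sym nj.
rewrite big1 => [|j _]; last by rewrite mnm0E.
by rewrite card_first_thetas; lia.
Qed.

Section Submodule.
Variables (U : A -> Prop).
Hypothesis sU : submodule U.

Let UN f : U (- f) -> U f.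
Proof. by move=> Uf; rewrite -[f]opprK; apply: subspaceN sU.1 Uf. Qed.

(** The generator K or K1 multiplies by x_t theta_p up to sign; its other term vanishes because the
    partner of p is absent. *)
Lemma emon_insert u S p t : ~~ both S (pair_of p) -> p \in S ->
  U (emon F u (S :\ p)) -> U (emon F (u + U_(lshift m t))%MM S).
Proof.
case: (split_ordP p) => q ->; rewrite ?pair_ofL ?pair_ofR /both => nb pS Uf.
  move: nb; rewrite pS /= => nb; have := submodule_op (GenK1 t q) sU Uf.
  rewrite /= dtheta_emon !inE (negPf nb) andbF mulr0 sub0r => /UN.
  rewrite xvar_emon theta_emon !inE eqxx /= setD1K //.
  exact: (submoduleZ sU (msgn_neq0 _ _ _)).
move: nb; rewrite pS andbT => nb; have := submodule_op (GenK t q) sU Uf.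
rewrite /= dtheta_emon !inE (negPf nb) andbF mulr0 add0r.
rewrite xvar_emon theta_emon !inE eqxx /= setD1K //.
exact: (submoduleZ sU (msgn_neq0 _ _ _)).
Qed.

Lemma emon_move_x u S i j : u (rshift m i) = 0%N -> i != j ->
  U (emon F (u + U_(lshift m i))%MM S) -> U (emon F (u + U_(lshift m j))%MM S).
Proof.
move=> u0 /negPf nij Uf; have := submodule_op (GenP n i j) sU Uf.
rewrite /= nij scale0r subr0 [dx (rshift m i) _]dx_emon ?mulr0 ?subr0; last first.
  by rewrite mnmDE u0 mnm1E eq_lrshift.
rewrite dx_emonD -scalerAr xvar_emon => /UN.
by apply: (submoduleZ sU); rewrite pnatr_eq0.
Qed.

(** The diagonal generator F sends theta_q to twice theta_(n+q). *)
Lemma emon_flip u S q : rshift n q \in S -> lshift n q \notin S ->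
  U (emon F u (lshift n q |: S :\ rshift n q)) -> U (emon F u S).
Proof.
move=> rS lS Uf; have := submodule_op (GenF m q q) sU Uf.
have lS' : lshift n q \notin S :\ rshift n q by rewrite !inE (negPf lS) andbF.
rewrite /= dtheta_emon !inE eqxx /= setU1K // -scalerAr theta_emon !inE eqxx /= setD1K //.
rewrite scalerA -mulr2n -scaler_nat scalerA; apply: (submoduleZ sU).
by rewrite !mulf_neq0 ?msgn_neq0 // pnatr_eq0.
Qed.

Lemma emon_move_theta u S p q : rshift n q \notin S -> lshift n q \in S -> lshift n p \notin S ->
  U (emon F u (lshift n p |: S :\ lshift n q)) -> U (emon F u S).
Proof.
move=> rS qS pS Uf; have := submodule_op (GenD m q p) sU Uf.
have pS' : lshift n p \notin S :\ lshift n q by rewrite !inE (negPf pS) andbF.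
rewrite /= !dtheta_emon !inE eq_rlshift eqxx (negPf rS) andbF /= mulr0 subr0 setU1K //.
rewrite -scalerAr theta_emon !inE eqxx /= setD1K // scalerA.
by apply: (submoduleZ sU); rewrite mulf_neq0 ?msgn_neq0.
Qed.

(** Exponents are moved from x_i to the other variables, by induction on the degree outside x_i. *)
Lemma gen_emon_x k i u : reduced u set0 -> kdeg u (set0 : {set 'I_(n + n)}) = k ->
  U (emon F (top_u k i) (top_S k)) -> U (emon F u set0).
Proof.
move=> ru; have uk := kdeg_reduced ru; have := ru; rewrite uk cards0 sub0r => {uk} [[uR _]] <-.
have le0 : - (\sum_(j < m) u (lshift m j))%N%:Z <= 0 by lia.
rewrite /top_u /top_S le0 abszN absz_nat => U0.
have [N leN] := ubnP (\sum_(j < m | j != i) u (lshift m j))%N.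
elim: N u uR U0 leN {ru le0} => // N IH u uR U0 leN.
have [/existsP[j /andP[nji uj]]|] := boolP [exists j, (j != i) && (0 < u (lshift m j))%N].
  have uE : u = (u - U_(lshift m j) + U_(lshift m j))%MM.
    rewrite submK //; apply/mnm_lepP => l; rewrite mnm1E.
    by case: eqVneq => [<-|].
  set w := (u - U_(lshift m j))%MM in uE.
  have wR l : w (rshift m l) = 0%N by rewrite mnmBE uR.
  have wi l : (w + U_(lshift m i))%MM (lshift m l) = (w (lshift m l) + (i == l))%N.
    by rewrite mnmDE mnm1E eq_lshift.
  have wj l : u (lshift m l) = (w (lshift m l) + (j == l))%N.
    by rewrite uE mnmDE mnm1E eq_lshift.
  have one (P : pred 'I_m) l : P l -> (\sum_(t | P t) (l == t) = 1)%N.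
    move=> Pl; rewrite (bigD1 l) //= eqxx big1 ?addn0 // => t /andP[_].
    by rewrite eq_sym => /negPf ->.
  rewrite uE; apply: (@emon_move_x _ _ i j); rewrite ?wR 1?eq_sym //.
  apply: IH.
  - by move=> l; rewrite mnmDE wR mnm1E eq_lrshift.
  - rewrite (eq_bigr _ (fun l _ => wi l)) big_split /= one //.
    by move: U0; rewrite (eq_bigr _ (fun l _ => wj l)) big_split /= one.
  rewrite (eq_bigr _ (fun l _ => wi l)) big_split /= [X in (_ + X)%N]big1 ?addn0; last first.
    by move=> l /negPf; rewrite eq_sym => ->.
  move: leN; rewrite (eq_bigr _ (fun l _ => wj l)) big_split /= one //.
  by rewrite addn1.
rewrite negb_exists => /forallP nz.
have z j : j != i -> u (lshift m j) = 0%N.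
  by move=> nj; have := nz j; rewrite nj /= -eqn0Ngt => /eqP.
suff -> : u = (U_(lshift m i) *+ \sum_(j < m) u (lshift m j))%MM by [].
apply/mnmP => l; rewrite mulmnE mnm1E; case: (split_ordP l) => j ->.
  rewrite eq_lshift (bigD1 i) //= big1 // addn0.
  by have [<-|nj] := eqVneq i j; rewrite ?mul1n // z // eq_sym.
by rewrite eq_lrshift uR.
Qed.

(** Induction on the number of thetas with index at least #|S|: each is obtained from a theta at a
    free index below #|S|. *)
Lemma gen_emon_thetaL S : (forall t, rshift n t \notin S) ->
  U (emon F 0 (first_thetas #|S|)) -> U (emon F 0 S).
Proof.
have [M] := ubnP (\sum_(t < n) ((#|S| <= t)%N && (lshift n t \in S)))%N.
elim: M S => // M IH S leM SR U0.
have [/existsP[q /andP[kq qS]]|] := boolP [exists t : 'I_n, (#|S| <= t)%N && (lshift n t \in S)].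
  have kn : (#|S| <= n)%N by apply: leq_trans kq (ltnW (ltn_ord q)).
  have [/existsP[p /andP[pk pS]]|] := boolP [exists t : 'I_n, (t < #|S|)%N && (lshift n t \notin S)].
    apply: (emon_move_theta (SR q) qS pS); set T := _ |: _.
    have TS : #|T| = #|S|.
      by rewrite cardsU1 !inE (negPf pS) andbF (cardsD1 (lshift n q) S) qS.
    apply: IH; rewrite ?TS //; last first.
      by move=> t; rewrite !inE !eq_rlshift /= (negPf (SR t)).
    move: leM; rewrite (bigD1 q) //= kq qS ltnS; apply: leq_trans.
    rewrite add1n ltnS (bigD1 q) //= {1}/T !inE eqxx /= eq_lshift.
    have -> : (q == p) = false by apply: contraTF kq => /eqP ->; rewrite -ltnNge.
    rewrite andbF add0n; apply: leq_sum => t /negPf nq; rewrite !inE !eq_lshift nq /=.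
    case: eqVneq => [->|_] //=; first by rewrite (leqNgt #|S| p) pk.
  rewrite negb_exists => /forallP sub.
  (* If no index below #|S| were free, S would contain [first_thetas #|S|] and theta_q as well, one
     element too many. *)
  suff : (#|lshift n q |: first_thetas #|S| | <= #|S|)%N.
    by rewrite cardsU1 first_thetasL ltnNge kq card_first_thetas // ltnn.
  apply/subset_leq_card/subsetP => x; rewrite !inE => /predU1P[->|] //.
  case: (split_ordP x) => t -> // tk; have := sub t; rewrite tk /=.
  by rewrite negbK.
rewrite negb_exists => /forallP sub.
suff -> : S = first_thetas #|S| by [].
apply/eqP; rewrite eqEcard; apply/andP; split.
  apply/subsetP => x xS; case: (split_ordP x) xS => t -> xS.
    by rewrite first_thetasL ltnNge; have := sub t; rewrite xS andbT.
  by rewrite (negPf (SR t)) in xS.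
have inj : {in S &, injective (@pair_of n)}.
  by move=> x y; case: (split_ordP x) => s ->; case: (split_ordP y) => t ->;
    rewrite ?(negPf (SR _)) // !pair_ofL => _ _ ->.
by rewrite card_first_thetas // -(card_in_imset inj) -[leqRHS]card_ord max_card.
Qed.

Lemma gen_emon_theta S : (forall t, ~~ both S t) ->
  U (emon F 0 (first_thetas #|S|)) -> U (emon F 0 S).
Proof.
have [N] := ubnP (\sum_(t < n) (rshift n t \in S))%N; elim: N S => // N IH S leN nb U0.
have [/existsP[q qS]|] := boolP [exists t, rshift n t \in S].
  have lq : lshift n q \notin S by have := nb q; rewrite /both qS andbT.
  apply: (emon_flip qS lq).
  set T := lshift n q |: _.
  have TS : #|T| = #|S| by rewrite cardsU1 !inE (negPf lq) andbF (cardsD1 (rshift n q) S) qS.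
  have TR t : (rshift n t \in T) = (t != q) && (rshift n t \in S).
    by rewrite !inE eq_rlshift eq_rshift.
  have TL t : (lshift n t \in T) = (t == q) || (lshift n t \in S).
    by rewrite !inE eq_lshift eq_lrshift.
  apply: IH; rewrite ?TS //.
    move: leN; rewrite (bigD1 q) //= qS => leN; rewrite (bigD1 q) //= TR eqxx /=.
    rewrite (eq_bigr (fun t => nat_of_bool (rshift n t \in S))) //.
    by move=> t nt; rewrite TR nt.
  move=> t; rewrite /both TR TL; case: eqVneq => [->|_] //=; exact: nb.
rewrite negb_exists => /forallP SR.
by apply: gen_emon_thetaL U0 => t; apply: SR.
Qed.
(** Factors x_t theta_p are stripped while both kinds of variables occur. What remains is a monomial
    in the x alone or in the thetas alone, of the same degree k. *)
Lemma gen_emon k i u S : reduced u S -> kdeg u S = k ->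
  U (emon F (top_u k i) (top_S k)) -> U (emon F u S).
Proof.
move=> [uR nb] uk U0.
have [N] := ubnP (\sum_(t < m) u (lshift m t))%N; elim: N u S uR nb uk => // N IH u S uR nb uk leN.
have [S0|[p pS]] := set_0Vmem S; first by rewrite S0 in nb uk *; apply: (gen_emon_x _ uk U0).
have [/existsP[t ut]|] := boolP [exists t, (0 < u (lshift m t))%N].
  have uE : u = (u - U_(lshift m t) + U_(lshift m t))%MM.
    by rewrite submK //; apply/mnm_lepP => l; rewrite mnm1E; case: eqVneq => [<-|].
  set w := (u - U_(lshift m t))%MM in uE.
  have wR l : w (rshift m l) = 0%N by rewrite mnmBE uR.
  have bS s : ~~ both (S :\ p) s.
    by apply: contra (nb s); rewrite /both !inE => /andP[/andP[_ ->] /andP[_ ->]].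
  rewrite uE; apply: (@emon_insert w S p t (nb _) pS); apply: IH => //.
    move: uk; rewrite uE kdeg_addL !kdeg_reduced ?(cardsD1 p S) ?pS; try by split.
    by move=> <-; rewrite (PoszD 1); ring.
  suff eN : (\sum_(l < m) u (lshift m l) = \sum_(l < m) w (lshift m l) + 1)%N.
    by move: leN; rewrite eN addn1.
  apply: (@sum_bump _ _ predT t) => // [|l nl]; first by rewrite uE mnmDE mnm1E eqxx.
  by rewrite uE mnmDE mnm1E eq_lshift eq_sym (negPf nl) addn0.
rewrite negb_exists => /forallP u0.
have {u0}uE : u = 0%MM.
  apply/mnmP => l; rewrite mnm0E; case: (split_ordP l) => s ->; last exact: uR.
  by apply/eqP; have := u0 s; rewrite -eqn0Ngt.
have kS : k = #|S|.
  by rewrite -uk kdeg_reduced // uE big1 ?subr0 // => s _; rewrite mnm0E.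
rewrite uE; apply: gen_emon_theta => //.
have nk : (#|S|%:Z <= 0) = false.
  by apply/negbTE; rewrite -ltNge ltz_nat card_gt0; apply/set0Pn; exists p.
by move: U0; rewrite /top_u /top_S kS nk absz_nat.
Qed.

End Submodule.
End TopMonomial.

(** * Irreducibility *)

Section Irreducibility.
Variables (F : numFieldType) (m n : nat).
Local Notation A := (spoly F (m + m) (n + n)).
Implicit Types (f g h : A) (u v : 'X_{1..m + m}) (S T : {set 'I_(n + n)}).

Lemma wf_reduced (d : index_data m n) : wf d -> (forall x, idx_kk d x = 0%N) ->
  reduced (lead_u d) (lset d).
Proof.
move=> [_ _ st] k0; split=> [i|t]; first by rewrite lead_uR big1.
by have := st t; rewrite /site /both !inE; do 2 case: (idx_l d _).
Qed.

Lemma gen_Hk (U : A -> Prop) (k : int) i : submodule U ->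
  U (emon F (top_u k i) (top_S n k)) -> forall f, Hk k f -> U f.
Proof.
move=> sU U0 f /Hk_in_span; apply: in_span_min; first exact: sU.1.
move=> _ [d [/in_IP/good_wf wd dk] ->]; apply: (@gen_base F m n U k) => // {}d {}wd k0 s0 l0 {}dk.
have [c c0 e] := hvec_base F k0 s0 l0; have kd := @hvec_kgrade F m n d wd; rewrite e.
apply: (subspaceZ _ sU.1); apply: (@gen_emon F m n U sU k i) => //; first exact: wf_reduced.
by rewrite -dk; apply: kd; rewrite e cfZ cf_emon !eqxx mulr1.
Qed.

Definition cartan_gen (x : 'I_m + 'I_n) : osp_gen m n :=
  match x with inl i => GenP n i i | inr j => GenD m j j end.

(** The successor accounts for the term - delta_(i,j) in the action of E_(i,j). *)
Definition cartan_wt (x : 'I_m + 'I_n) u S : F :=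
  match x with
  | inl i => - (u (lshift m i) + u (rshift m i)).+1%:R
  | inr j => (lshift n j \in S)%:R - (rshift n j \in S)%:R
  end.

Lemma cf_cartan_gen x f u S : cf (gen_op (cartan_gen x) f) u S = cartan_wt x u S * cf f u S.
Proof.
case: x => [i|j] /=.
  by rewrite eqxx scale1r !(cfB, cfN) !cf_xvar_dx -addn1 !natrD; ring.
by rewrite cfB !cf_theta_dtheta mulrBl.
Qed.

(** Multiplicity one: the theta-weights force S0 to be contained in S, and comparing degrees gives
    #|S| + 2 (sum of y-exponents) = #|S0|, so S = S0 and no y occurs. *)
Lemma cartan_wt_inj u S u0 S0 : (forall i, u0 (rshift m i) = 0%N) ->
  (forall j, rshift n j \notin S0) -> kdeg u S = kdeg u0 S0 ->
  (forall x, cartan_wt x u S = cartan_wt x u0 S0) -> u = u0 /\ S = S0.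
Proof.
move=> u0R S0R ku wt.
have uE i : (u (lshift m i) + u (rshift m i) = u0 (lshift m i))%N.
  have /= := wt (inl i); rewrite u0R addn0 => /oppr_inj/eqP.
  by rewrite eqr_nat => /eqP[].
have sub : S0 \subset S.
  apply/subsetP => p; case: (split_ordP p) => j ->; last by rewrite (negPf (S0R j)).
  move=> pS; have /= := wt (inr j); rewrite pS (negPf (S0R j)).
  case: (_ \in S) => //; case: (_ \in S) => /= /eqP; rewrite ?subr0 ?sub0r.
    by rewrite eq_sym -subr_eq0 opprK -natrD pnatr_eq0.
  by rewrite eq_sym oner_eq0.
have kE : (#|S| + 2 * \sum_(i < m) u (rshift m i) = #|S0|)%N.
  move: ku; rewrite /kdeg [X in _ = _ + X -> _]big1 => [|i _]; last by rewrite u0R.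
  have -> : \sum_(i < m) (u0 (lshift m i))%:Z
      = \sum_(i < m) (u (lshift m i))%:Z + \sum_(i < m) (u (rshift m i))%:Z.
    by rewrite -big_split; apply: eq_bigr => i _; rewrite -uE PoszD.
  rewrite -!(big_morph Posz PoszD (erefl _)).
  by move: (\sum_(i < m) _)%N (\sum_(i < m) _)%N => a b; lia.
have leS := subset_leq_card sub.
have SE : S = S0 by apply/esym/eqP; rewrite eqEcard sub -kE leq_addr.
split=> //; have /eqP : (\sum_(i < m) u (rshift m i) = 0)%N by lia.
rewrite sum_nat_eq0 => /forallP uR.
have {}uR i : u (rshift m i) = 0%N by apply/eqP; have := uR i.
apply/mnmP => l; case: (split_ordP l) => i ->; last by rewrite u0R uR.
by rewrite -uE uR addn0.
Qed.

(** For each unwanted monomial, a Cartan element minus its eigenvalue there kills that monomial and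
    only rescales the coefficient at (u0, S0) by a nonzero number. *)
Lemma emon_of_weight (U : A -> Prop) k f u0 S0 : submodule U ->
  (forall i, u0 (rshift m i) = 0%N) -> (forall j, rshift n j \notin S0) ->
  kgrade k f -> U f -> cf f u0 S0 != 0 -> U (emon F u0 S0).
Proof.
move=> sU u0R S0R kf Uf nz; have k0 := kf _ _ nz.
have [s fs] := supp_seq f.
have {fs} : supp (fun v T => (v, T) = (u0, S0) \/ (v, T) \in s) f.
  by move=> v T /fs ?; right.
elim: s f nz Uf kf => [|[u S] s IH] f nz Uf kf fs.
  apply: (submoduleZ sU nz); suff <- : f = cf f u0 S0 *: emon F u0 S0 by [].
  apply: cf_inj => v T; rewrite cfZ cf_emon.
  have [fz|/fs[[-> ->]|//]] := eqVneq (cf f v T) 0; last by rewrite !eqxx mulr1.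
  rewrite fz; case: eqVneq => [e1|_]; rewrite ?mulr0 //; case: eqVneq => [e2|_]; rewrite ?mulr0 //.
  by move: nz; rewrite e1 -e2 fz eqxx.
have drop g : cf g u0 S0 != 0 -> U g -> supp (fun v T => cf f v T != 0) g ->
    (u, S) = (u0, S0) \/ cf g u S = 0 -> U (emon F u0 S0).
  move=> gnz Ug gf gu; apply: (IH g) => // [v T /gf/kf //|v T gv].
  case: (fs v T (gf v T gv)) => [|]; first by left.
  rewrite inE => /orP[/eqP[ev eT]|]; last by right.
  by case: gu => [<-|gz]; [left; rewrite ev eT | rewrite ev eT gz eqxx in gv].
have [z|nzu] := eqVneq (cf f u S) 0; first by apply: (drop f) => //; right.
have [/forallP wt|] := boolP [forall x, cartan_wt x u S == cartan_wt x u0 S0].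
  have kE : kdeg u S = kdeg u0 S0 by rewrite k0; apply: kf nzu.
  have [eu eS] := cartan_wt_inj u0R S0R kE (fun x => eqP (wt x)).
  by apply: (drop f nz Uf (fun _ _ => id)); left; rewrite eu eS.
rewrite negb_forall => /existsP[x nx].
apply: (drop (gen_op (cartan_gen x) f - cartan_wt x u S *: f)).
- by rewrite cfB cfZ cf_cartan_gen -mulrBl mulf_neq0 // subr_eq0 eq_sym.
- apply: (subspaceB sU.1); first exact: submodule_op.
  exact: (subspaceZ _ sU.1).
- by move=> v T; rewrite cfB cfZ cf_cartan_gen -mulrBl mulf_eq0 negb_or => /andP[].
by right; rewrite cfB cfZ cf_cartan_gen subrr.
Qed.

Lemma emon_Hk u S : (forall i, u (rshift m i) = 0%N) -> (forall j, rshift n j \notin S) ->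
  Hk (kdeg u S) (emon F u S).
Proof.
move=> uR SR; split; first by apply/AkE/kgrade_emon.
rewrite /Delta !big1 ?oppr0 ?addr0 // => [j|i] _; last by rewrite dx_emon ?mulr0.
by rewrite [dtheta (rshift n j) _]dtheta_emon (negPf (SR j)) linear0.
Qed.

Lemma top_SR k j : rshift n j \notin top_S n k.
Proof. by rewrite /top_S; case: ifP => _; rewrite ?first_thetasR // inE. Qed.

Lemma emon_neq0 u S : emon F u S <> 0 :> A.
Proof.
move/(congr1 (fun f => cf f u S)); rewrite cf0 cf_emon !eqxx => /eqP.
by rewrite oner_eq0.
Qed.

Theorem Hk_irreducible k : (0 < m)%N -> k <= n%:Z -> @irreducible F m n (Hk k).
Proof.
move=> m0 kn; pose i := Ordinal m0; set u0 := top_u k i; pose S0 := top_S n k.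
have uR j : u0 (rshift m j) = 0%N by exact: top_uR.
have SR j : rshift n j \notin S0 by exact: top_SR.
have Hv : Hk k (emon F u0 S0) by rewrite -{1}(top_kdeg i kn); apply: emon_Hk.
split; [exact: Hk_submodule | by exists (emon F u0 S0) => //; apply: emon_neq0 |].
move=> U sU UH; have [[f [Uf nz]]|noU] := boolp.EM (exists f, U f /\ cf f u0 S0 != 0).
  right; apply: (@gen_Hk U k i) => //; apply: (emon_of_weight sU uR SR _ Uf nz).
  exact/AkE/(UH f Uf).1.
left=> f Uf; apply/eqP/negP => /negP f0.
(* By contravariance the orthogonal of U in H_k is a submodule; it contains the top monomial, hence
   is all of H_k. *)
pose perp w := Hk k w /\ forall g, U g -> sform g w = 0.
have sP : submodule perp.
  apply: submodule_gen => [|x w [Hw pw]].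
    split; first by split=> [|g _]; [exact: (@Hk_subspace F m n k).1 | exact: sform0r].
    move=> c v w [Hv' pv] [Hw pw]; split; first exact: (@Hk_subspace F m n k).2.
    by move=> g Ug; rewrite sformDr sformZr pv // pw // mulr0 addr0.
  split; first exact: (@submodule_op F m n (Hk k) x w (@Hk_submodule F m n k) Hw).
  move=> g Ug; have [c [y adj]] := gen_op_adjoint F x.
  by rewrite sformC adj sformC pw ?mulr0 //; apply: submodule_op.
have Hperp : forall w, Hk k w -> perp w.
  apply: (@gen_Hk perp k i sP); split=> // g Ug; rewrite sform_emon.
  have [->|nz] := eqVneq (cf g u0 S0) 0; first by rewrite mulr0.
  by case: noU; exists g.
have [u [S nz]] := spoly_neq0 f0; have [Af Df] := UH f Uf.
have kE : kdeg u S = k by apply: (AkE k f).1 nz.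
have : Ak k (emon F u S) by apply/AkE; rewrite -kE; apply: kgrade_emon.
(* Split a monomial of f as h + eta g. Then f is orthogonal to h by [Hperp] and to eta g because
   Delta f = 0, yet its pairing with the monomial is a nonzero multiple of a nonzero coefficient. *)
move=> /((Ak_direct_sum F m kn).1 _)[h [_ [Hh [g _ ->] e]]].
have := sform_emon f u S; rewrite e sformDr (Hperp h Hh).2 // add0r.
have := sform_Delta f g; rewrite Df sformC sform0r => /esym/eqP; rewrite oppr_eq0 => /eqP ->.
by move=> /esym/eqP; rewrite mulf_eq0 (negPf nz) (negPf (mfact_neq0 _ _)).
Qed.

End Irreducibility.

(** * Highest weights *)

Section HighestWeight.
Variables (F : numFieldType) (m n : nat).
Local Notation A := (spoly F (m + m) (n + n)).
Local Notation G := 'M[F]_(m + m + (n + n)).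
Implicit Types (f : A) (g h : G).

Lemma emon_cartan x u S : gen_op (cartan_gen x) (emon F u S : A)
  = cartan_wt F x u S *: emon F u S.
Proof.
apply: cf_inj => v T; rewrite cf_cartan_gen cfZ cf_emon.
by case: eqVneq => [->|]; rewrite ?mulr0 //; case: eqVneq => [->|]; rewrite ?mulr0.
Qed.

Lemma action0 f : action (0 : G) f = 0.
Proof. by have := actionP (-1) (0 : G) 0 f; rewrite scaler0 addr0 scaleN1r addNr. Qed.

Lemma gen_opZ (x : osp_gen m n) c f : gen_op x (c *: f) = c *: gen_op x f.
Proof.
case: x => i j; apply: cf_inj => u S;
  rewrite /= ?linearZ /= -?scalerAr ?linearZ /= -?scalerAr ?scalerA !(cfD, cfN, cfZ); ring.
Qed.

Definition wt_linear (wt : G -> F) := forall c g h, wt (c *: g + h) = c * wt g + wt h.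

Lemma eps_wt_linear i : wt_linear (@eps_wt F m n i).
Proof. by move=> c g h; rewrite /eps_wt !mxE. Qed.

Lemma delta_wt_linear j : wt_linear (@delta_wt F m n j).
Proof. by move=> c g h; rewrite /delta_wt !mxE. Qed.

Lemma sum_wt_linear (I : finType) (P : pred I) (w : I -> G -> F) :
  (forall i, wt_linear (w i)) -> wt_linear (fun g => \sum_(i | P i) w i g).
Proof.
by move=> wl c g h; rewrite mulr_sumr -big_split; apply: eq_bigr => i _; apply: wl.
Qed.

Lemma scale_wt_linear a (w : G -> F) : wt_linear w -> wt_linear (fun g => a * w g).
Proof. by move=> wl c g h; rewrite wl; ring. Qed.

Lemma lambda_wt_linear i : wt_linear (@lambda_wt F m n i).
Proof.
have sE (P : pred 'I_m) : wt_linear (fun g => \sum_(j | P j) @eps_wt F m n j g).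
  by apply: sum_wt_linear => j; apply: eps_wt_linear.
move=> c g h; rewrite /lambda_wt; case: ifP => _; first exact: (scale_wt_linear _ (sE predT)).
case: ifP => _; last exact: sE.
pose w (j : 'I_m) g := if j.+1 == m then - @eps_wt F m n j g else eps_wt j g.
apply: (@scale_wt_linear _ (fun g => \sum_(j < m) w j g)).
rewrite /w; apply: sum_wt_linear => j {}c {}g {}h; case: ifP => _; rewrite eps_wt_linear //.
by rewrite opprD mulrN.
Qed.

Lemma eps_wt_cartan i x : @eps_wt F m n i (gen_mx F (cartan_gen x)) = (x == inl i)%:R.
Proof.
case: x => j; rewrite /eps_wt /= !mxE /ixL /ixR /ithL /ithR.
  by rewrite !eq_lshift !eq_lrshift subr0 andbb eq_sym.
by rewrite !eq_lrshift subr0.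
Qed.

Lemma delta_wt_cartan j x : @delta_wt F m n j (gen_mx F (cartan_gen x)) = (x == inr j)%:R.
Proof.
case: x => i; rewrite /delta_wt /= !mxE /ixL /ixR /ithL /ithR.
  by rewrite !eq_rlshift subr0.
by rewrite !eq_rshift eq_lshift !eq_lrshift subr0 andbb eq_sym.
Qed.

(** The top monomial involves either x_m alone or theta_1, ..., theta_k alone. Every positive
    generator therefore differentiates by an absent variable or, for D, repeats a theta. *)
Lemma top_highest_weight (k : int) (i : 'I_m) (c : F) (wt : G -> F) :
  i.+1 = m -> k <= n%:Z -> c != 0 -> wt_linear wt ->
  (forall x, wt (gen_mx F (cartan_gen x)) = cartan_wt F x (top_u k i) (top_S n k)) ->
  highest_weight_submodule (@Hk F m n k) (c *: emon F (top_u k i) (top_S n k)) wt.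
Proof.
move=> im kn c0 wtl wtE; set u0 := top_u k i; set S0 := top_S n k; set v := emon F u0 S0 : A.
have uR j : u0 (rshift m j) = 0%N by exact: top_uR.
have SR j : rshift n j \notin S0 by exact: top_SR.
have drv j : dx (rshift m j) v = 0 by rewrite dx_emon.
have erv j : dtheta (rshift n j) v = 0 by rewrite dtheta_emon (negPf (SR j)).
have uL (a b : 'I_m) : (a < b)%N -> u0 (lshift m a) = 0%N.
  move=> ab; rewrite /u0 /top_u; case: ifP => _; rewrite ?mnm0E // mulmnE mnm1E eq_lshift.
  rewrite (_ : i == a = false) //; apply/negbTE; rewrite neq_ltn.
  by rewrite (leq_trans ab) ?orbT // -ltnS im.
have dlv (a b : 'I_m) : (a < b)%N -> dx (lshift m a) v = 0 by move=> /uL ?; rewrite dx_emon.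
have elv a q : dx (lshift m a) (dtheta (lshift n q) v) = 0.
  rewrite dtheta_emon; case: ifP => qS; last by rewrite linear0.
  rewrite linearZ /= dx_emon ?scaler0 //.
  move: qS; rewrite /u0 /S0 /top_u /top_S.
  by case: ifP => _; rewrite ?inE // mnm0E.
have Hv : Hk k v by rewrite -{1}(top_kdeg i kn); apply: emon_Hk.
split; first exact: Hk_submodule.
  split.
  - exact: (subspaceZ c (@Hk_subspace F m n k) Hv).
  - move=> /(congr1 (fun f => c^-1 *: f)); rewrite scaler0 scalerA mulVf // scale1r.
    exact: emon_neq0.
  - pose W g := action g (c *: v) = wt g *: (c *: v).
    have sW : subspace W.
      have WL a g h : W g -> W h -> W (a *: g + h).
        by rewrite /W => Wg Wh; rewrite actionP Wg Wh wtl scalerDl scalerA.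
      split=> //; have wt0 : wt 0 = 0 by have := wtl (-1) 0 0; rewrite scaler0 addr0 mulN1r addNr.
      by rewrite /W wt0 scale0r action0.
    move=> g; apply: (@in_span_min _ _ _ W) => // {}g gE.
    have [x ->] : exists x, g = gen_mx F (cartan_gen x).
      by case: gE => -[j ->]; [exists (inl j) | exists (inr j)].
    by rewrite /W action_gen gen_opZ emon_cartan wtE scalerA mulrC -scalerA.
  pose W g := action g (c *: v) = 0.
  have sW : subspace W.
    split; first exact: action0.
    by rewrite /W => a g h Wg Wh; rewrite actionP Wg Wh scaler0 addr0.
  move=> g; apply: (in_span_min sW) => {}g.
  have Wgen x : gen_op x v = 0 -> W (gen_mx F x).
    by rewrite /W action_gen gen_opZ => ->; rewrite scaler0.
  case=> [[a [b [ab [->|->]]]]|[[p [q [pq ->]]]|[[p [q [_ ->]]]|[a [q [->|->]]]]]].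
  - apply: (Wgen (GenP n a b)); rewrite /= drv (dlv _ _ ab) !mulr0 subr0 oppr0 sub0r.
    by rewrite -val_eqE ltn_eqF // scale0r oppr0.
  - by apply: (Wgen (GenB n a b)); rewrite /= !drv !linear0 addr0.
  - apply: (Wgen (GenD m p q)); rewrite /= erv mulr0 subr0 dtheta_emon.
    case: ifP => qS; last by rewrite mulr0.
    rewrite -scalerAr theta_emon ifT ?scaler0 // !inE eq_lshift neq_ltn pq /=.
    move: qS; rewrite /S0 /top_S; case: ifP => _; first by rewrite inE.
    by rewrite !first_thetasL; apply: ltn_trans.
  - by apply: (Wgen (GenE m p q)); rewrite /= !erv !mulr0 addr0.
  - by apply: (Wgen (GenH a q)); rewrite /= drv mulr0 subr0.
  by apply: (Wgen (GenH1 a q)); rewrite /= drv erv linear0 mulr0 addr0.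
move=> U sU Ucv; apply: (@gen_Hk F m n U k i sU).
exact: submoduleZ Ucv.
Qed.

Lemma top_thetas (k : int) (i : 'I_m) : 0 < k -> exists2 c : F, c != 0 &
  \prod_(j < n | (j < `|k|)%N) thL F m j = c *: emon F (top_u k i) (top_S n k).
Proof.
move=> k0; pose s : seq 'I_(n + n) :=
  [seq lshift n j | j <- [seq j : 'I_n <- index_enum 'I_n | (j < `|k|)%N]].
have us : uniq s.
  by rewrite map_inj_uniq ?filter_uniq ?index_enum_uniq //; apply: lshift_inj.
have [c c0 e] := @emonS_theta F m n s us.
exists c => //; rewrite /top_u /top_S leNgt k0 /=; move: e.
rewrite big_map big_filter => ->; congr (_ *: emon F 0 _); apply/setP => p.
rewrite inE; case: (split_ordP p) => j ->; rewrite ?first_thetasL ?first_thetasR.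
  by rewrite (mem_map (@lshift_inj _ _)) mem_filter mem_index_enum andbT.
by apply/negbTE/negP => /mapP[l _ /eqP]; rewrite eq_rlshift.
Qed.

Lemma top_xvar (k : int) (i : 'I_m) : k <= 0 ->
  xL F n i ^+ `|k| = emon F (top_u k i) (top_S n k).
Proof.
move=> k0; have := @xvarX_emon F m n (lshift m i) `|k| 0 set0.
by rewrite /top_u /top_S k0 emon1 mulr1 add0m.
Qed.

Lemma sum_eps_cartan x : \sum_(i < m) @eps_wt F m n i (gen_mx F (cartan_gen x))
  = (if x is inl _ then 1 else 0).
Proof.
rewrite (eq_bigr _ (fun i _ => eps_wt_cartan i x)).
case: x => [a|b]; last by rewrite big1.
by rewrite (bigD1 a) //= eqxx big1 ?addr0 // => j nj; rewrite -[_ == _]/(a == j) eq_sym (negPf nj).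
Qed.

(** Without x or y all eps-weights are - 1, which is - 2 lambda_m, and the thetas contribute
    nu_k. *)
Lemma highest_weight_pos (k : int) : (0 < m)%N -> k <= n%:Z -> 0 < k ->
  highest_weight_submodule (@Hk F m n k) (\prod_(j < n | (j < `|k|)%N) thL F m j)
    (fun g => - 2%:R * lambda_wt m g + nu_wt `|k|%N g).
Proof.
move=> m0 kn k0; have lt_i : (m.-1 < m)%N by rewrite prednK.
pose i := Ordinal lt_i; have [c c0 ->] := top_thetas i k0.
apply: top_highest_weight => //; first by rewrite /= prednK.
  move=> a g h; rewrite lambda_wt_linear.
  rewrite [nu_wt _ _](@sum_wt_linear _ (fun j : 'I_n => (j < `|k|)%N) _ delta_wt_linear a g h).
  rewrite /nu_wt; ring.
move=> x; rewrite /lambda_wt eqxx sum_eps_cartan /nu_wt.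
rewrite (eq_bigr _ (fun j _ => delta_wt_cartan j x)).
rewrite /top_u /top_S leNgt k0 /=; case: x => [a|b] /=.
  by rewrite !mnm0E big1 // addr0 mulr1 mulNr mulfV ?pnatr_eq0.
rewrite first_thetasL first_thetasR subr0 !mulr0 add0r big_mkcond (bigD1 b) //= eqxx.
by rewrite big1 ?addr0 => [|j /negPf nj];
  rewrite -?[inr _ == _]/(b == j) 1?[b == j]eq_sym ?nj ?if_same //; case: ifP.
Qed.

(** As lambda_m - lambda_(m-1) = eps_m, the claimed weight is - 2 lambda_m + k eps_m: it is - 1 on
    every eps-coordinate except k - 1 on the last. *)
Lemma highest_weight_neg (k : int) (i : 'I_m) : i.+1 = m -> k <= 0 ->
  highest_weight_submodule (@Hk F m n k) (xL F n i ^+ `|k|)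
    (fun g => - k%:~R * lambda_wt m.-1 g + (k - 2)%:~R * lambda_wt m g).
Proof.
move=> im k0; have m0 : (0 < m)%N by rewrite -im.
rewrite top_xvar // -[emon _ _ _]scale1r.
apply: top_highest_weight; rewrite ?oner_neq0 //; first by lia.
  by move=> a g h; rewrite !lambda_wt_linear; ring.
move=> x; rewrite /lambda_wt prednK // eqxx sum_eps_cartan.
rewrite (_ : m.-1 == m = false); last by rewrite -{2}(prednK m0) ltn_eqF.
have -> : \sum_(j < m) (if j.+1 == m then - @eps_wt F m n j (gen_mx F (cartan_gen x))
      else eps_wt j (gen_mx F (cartan_gen x)))
    = \sum_(j < m) @eps_wt F m n j (gen_mx F (cartan_gen x))
      - 2 * @eps_wt F m n i (gen_mx F (cartan_gen x)).
  rewrite (bigD1 i) //= im eqxx [in RHS](bigD1 i) //= [X in _ + X](eq_bigr (fun j => 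
    @eps_wt F m n j (gen_mx F (cartan_gen x)))); first by ring.
  by move=> j nj; rewrite ifF //; apply: contraNF nj => /eqP jm; apply/eqP/val_inj/succn_inj; rewrite jm.
rewrite sum_eps_cartan eps_wt_cartan /top_u /top_S k0; case: x => [a|b] /=; last first.
  by rewrite !inE mulr0n; ring.
rewrite -[inl a == inl i]/(a == i) !mulmnE !mnm1E eq_lshift eq_lrshift mul0n addn0.
have kE : (`|k|%:R : F) = - k%:~R.
  by rewrite pmulrn lez0_abs // mulrNz.
rewrite -[(_ * _).+1]addn1 natrD natrM kE rmorphB /= eq_sym; have h2 : (2 : F) != 0 by rewrite pnatr_eq0.
by case: eqVneq => _ /=; field.
Qed.

End HighestWeight.

Theorem theorem2p3 (R : realType) (m1 n : nat) (k : int)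
    (hm : (1 <= m1)%N) (hn : (1 <= n)%N) (hk : k <= n%:Z) :
  let C := complex R in
  [/\ @irreducible C m1 n (Hk k),
      0 < k ->
        highest_weight_submodule (@Hk C m1 n k)
          (\prod_(j < n | (j < `|k|)%N) thL C m1 j)
          (fun g => - 2%:R * lambda_wt m1 g + nu_wt `|k|%N g),
      k <= 0 ->
        forall i : 'I_m1, i.+1 = m1 ->
        highest_weight_submodule (@Hk C m1 n k)
          (xL C n i ^+ `|k|%N)
          (fun g => - k%:~R * lambda_wt m1.-1 g + (k - 2)%:~R * lambda_wt m1 g),
      direct_sum_of (@Ak C m1 n k) (Hk k) (etaAk (k - 2)) &
      is_basis (fun d : index_data m1 n => in_I d /\ index_degree d = k)
        (@hvec C m1 n) (@Hk C m1 n k)].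
Proof.
move=> C; split.
- exact: Hk_irreducible.
- exact: highest_weight_pos.
- by move=> k0 i im; apply: highest_weight_neg.
- exact: Ak_direct_sum.
exact: hvec_basis.
Qed.
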